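(* The dynamic safety problem is undecidable. This holds even when restricted to dynamic network games $(G,R)$ in which every rule of $R$ is a weak creation rule, a movement rule, or a relabeling rule (relabeling rules may perform several relabelings in one turn).
   Context: A network is a tuple $G=(V,E,A,S,(P_a)_{a\in\Sigma})$ where $V$ is a finite set of nodes, $E$ is an undirected edge relation on $V$, $A\subseteq V$ is the set of active nodes, $S\subseteq A$ is the set of strong nodes, and $(P_a)_{a\in\Sigma}$ is a partition of $V$ indexed by a finite label alphabet $\Sigma$ (a node in $P_a$ carries label $a$). Nodes in $V\setminus A$ are called deactivated (deleted); nodes in $A\setminus S$ are called weak. A network is connected if the subgraph induced by $A$ is connected. A dynamic network game is a pair $(G,R)$ of an initial network $G$ and a finite set $R$ of rules for Constructor. Destructor and Constructor move in alternation, Destructor first, and each may skip. A Destructor move deletes one weak node $v$ (i.e. $A:=A\setminus\{v\}$). A Constructor move applies one rule of $R$: - Relabeling rule $\langle a,b\longrightarrow c,d\rangle$: for active adjacent nodes $u\in P_a$, $v\in P_b$ with $(u,v)\in E$, relabel $u$ with $c$ and $v$ with $d$. A rule $\langle a,b\longrightarrow c,d\,;\,e,f\longrightarrow g,h\rangle$ (and similarly with more parts) performs several such relabelings one after another in the same turn. - Movement rule $\langle a\xrightarrow{\text{move}} b\rangle$: for $u\in S\cap P_a$ and $v\in P_b\setminus S$ with $(u,v)\in E$, set $S:=(S\setminus\{u\})\cup\{v\}$ and $A:=A\cup\{v\}$ (if $v$ was deleted, it is restored). This is called shifting the strongness from $u$ to $v$. - Creation rule $\langle a_1,\dots,a_n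 \xrightarrow{\text{create}(c)} a'_1,\dots,a'_n\rangle$: choose $n$ distinct strong nodes $u_1,\dots,u_n$ with $u_i$ labeled $a_i$; add a new node $w\notin V$ to $V$ and $A$, label it $c$, add edges between $w$ and each $u_i$, and relabel each $u_i$ with $a'_i$. Such a rule is a weak creation rule ($w$ is not strong). A strong creation rule is the same except that additionally $w$ is added to $S$. A play is an infinite sequence $G_1G_2\cdots$ with $G_1$ the initial network, where $G_{i+1}$ arises from $G_i$ by a Destructor move (or skip) if $i$ is odd and by a Constructor move (or skip) if $i$ is even. Strategies map play prefixes to the next network. In the safety game the initial network is connected and Constructor wins a play if every network in it is connected; in the reachability game the initial network is disconnected and Constructor wins a play if some network in it is connected. Constructor wins the game if she has a strategy that wins every play consistent with it; otherwise Destructor wins. The dynamic safety (resp. reachability) problem asks, given $(G,R)$, whether Constructor wins the safety (resp. reachability) game. *)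

(* Defs.v *)
From mathcomp Require Import all_boot.
Set Implicit Arguments. Unset Strict Implicit. Unset Printing Implicit Defensive.

(* Networks.  Nodes are the naturals 0 .. nV-1 (any finite node set is  *)
(* isomorphic to such a one).  Labels are naturals: the finite alphabet *)
(* Sigma is the (finite) set of labels occurring in the instance.       *)
(* The partition (P_a) is given by the labelling  u |-> nth 0 nlab u.   *)
Record network := Network {
  nV : nat;
  nE : seq (nat * nat);     (* undirected edges (each pair read symmetrically) *)
  nA : seq nat;
  nS : seq nat;
  nlab : seq nat
}.

Definition label (G : network) (u : nat) : nat := nth 0 (nlab G) u.
Definition adj (G : network) (u v : nat) : bool :=
  ((u, v) \in nE G) || ((v, u) \in nE G).
Definition isactive (G : network) (u : nat) : bool := u \in nA G.
Definition isstrong (G : network) (u : nat) : bool := u \in nS G.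

Definition setlab (G : network) (u c : nat) : network :=
  Network (nV G) (nE G) (nA G) (nS G) (set_nth 0 (nlab G) u c).

Definition wf_network (G : network) : bool :=
  [&& all (fun u => u < nV G) (nA G),
      all (fun u => u \in nA G) (nS G),
      all (fun e => [&& e.1 < nV G, e.2 < nV G & e.1 != e.2]) (nE G)
    & size (nlab G) == nV G].

Definition connected (G : network) : Prop :=
  forall u v, u \in nA G -> v \in nA G ->
    exists p : seq nat,
      path (fun x y => adj G x y && (y \in nA G)) u p && (last u p == v).

Inductive rule :=
  (* < a1,b1 -> c1,d1 ; a2,b2 -> c2,d2 ; ... >, parts ((a,b),(c,d)) *)
  | Relabel of seq ((nat * nat) * (nat * nat))
  (* < a -move-> b > *)
  | Move of nat & nat
  (* < a1..an -create(c)-> a1'..an' >; the boolean is true for a strong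
     creation rule and false for a weak creation rule *)
  | Create of bool & seq nat & nat & seq nat.

Fixpoint relab_parts (ps : seq ((nat * nat) * (nat * nat)))
         (G G' : network) : Prop :=
  match ps with
  | [::] => G' = G
  | ((a, b), (c, d)) :: ps' =>
      exists u v, [/\ isactive G u, isactive G v, adj G u v,
                      label G u = a & label G v = b] /\
                  relab_parts ps' (setlab (setlab G u c) v d) G'
  end.

Definition relabel_list (l : seq nat) (us post : seq nat) : seq nat :=
  foldl (fun l' p => set_nth 0 l' p.1 p.2) l (zip us post).

Definition apply_rule (r : rule) (G G' : network) : Prop :=
  match r with
  | Relabel ps => relab_parts ps G G'
  | Move a b =>
      exists u v,
        [/\ isstrong G u /\ label G u = a, v < nV G /\ label G v = b,
            ~~ isstrong G v, adj G u v &
            G' = Network (nV G) (nE G) (v :: nA G)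
                         (v :: filter (predC1 u) (nS G)) (nlab G)]
  | Create st pre c post =>
      exists us : seq nat, let w := nV G in
        [/\ size pre = size post, uniq us, all (isstrong G) us,
            map (label G) us = pre &
            G' = Network w.+1 ([seq (w, u) | u <- us] ++ nE G) (w :: nA G)
                   (if st then w :: nS G else nS G)
                   (relabel_list (rcons (nlab G) c) us post)]
  end.

Definition dmove (G G' : network) : Prop :=
  G' = G \/
  exists v, [/\ v \in nA G, v \notin nS G &
                G' = Network (nV G) (nE G) (filter (predC1 v) (nA G))
                             (nS G) (nlab G)].

Definition cmove (R : seq rule) (G G' : network) : Prop :=
  G' = G \/ exists i, i < size R /\ apply_rule (nth (Relabel [::]) R i) G G'.

(* Constructor wins the safety game on (G, R).  Plays are indexed from 0:
   p 0 = G_1; the step p i -> p i.+1 is Destructor's when i is even and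
   Constructor's when i is odd.  A strategy maps the play prefix
   p 0, ..., p i to the next network; it must be legal along all plays
   consistent with it and keep every network connected. *)
Definition constructor_wins_safety (G : network) (R : seq rule) : Prop :=
  exists sigma : seq network -> network,
    forall p : nat -> network,
      p 0 = G ->
      (forall i, ~~ odd i -> dmove (p i) (p i.+1)) ->
      (forall i, odd i -> p i.+1 = sigma [seq p j | j <- iota 0 i.+1]) ->
      forall i, connected (p i) /\ (odd i -> cmove R (p i) (p i.+1)).

Definition restricted_rule (r : rule) : bool :=
  match r with
  | Create true _ _ _ => false
  | _ => true
  end.

Definition wf_rule (r : rule) : bool :=
  match r with
  | Create _ pre _ post => size pre == size post
  | _ => true
  end.

Definition restricted_safety_instance (G : network) (R : seq rule) : Prop :=
  [/\ wf_network G, connected G, all wf_rule R & all restricted_rule R].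

Definition enc_network (G : network) :=
  (nV G, nE G, nA G, nS G, nlab G).

Definition enc_rule (r : rule) :
  (seq ((nat * nat) * (nat * nat)) + (nat * nat)) + (bool * seq nat * nat * seq nat) :=
  match r with
  | Relabel ps => inl (inl ps)
  | Move a b => inl (inr (a, b))
  | Create st pre c post => inr (st, pre, c, post)
  end.

Definition code (G : network) (R : seq rule) : nat :=
  pickle (enc_network G, map enc_rule R).

(* Model of computation: (Minsky) counter machines.                     *)
Inductive instr :=
  | INC of nat
  | DEC of nat & nat.

Definition cm_config := (nat * seq nat)%type.

Definition cm_step (P : seq instr) (c : cm_config) : cm_config :=
  let: (pc, regs) := c in
  if pc < size P then
    match nth (INC 0) P pc with
    | INC r => (pc.+1, set_nth 0 regs r (nth 0 regs r).+1)
    | DEC r j =>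
        match nth 0 regs r with
        | 0 => (j, regs)
        | k.+1 => (pc.+1, set_nth 0 regs r k)
        end
    end
  else c.

Definition cm_run (P : seq instr) (k : nat) (c : cm_config) : cm_config :=
  iter k (cm_step P) c.

Definition cm_halted (P : seq instr) (c : cm_config) : bool := size P <= c.1.

(* Started on input n (in register 0, all others 0), P halts with
   output (register 0) equal to b (1 for yes, 0 for no). *)
Definition cm_outputs (P : seq instr) (n : nat) (b : bool) : Prop :=
  exists k, let c := cm_run P k (0, [:: n]) in
    cm_halted P c /\ nth 0 c.2 0 = nat_of_bool b.

(* Main.v *)
(* Destructor deletes one weak node per turn, so in order to survive Constructor has to gain
   a weak node in every turn, by a creation or by a movement.  The rules tie every such gain
   to one stage of the simulation of a queue machine.  The queue is a growing ladder: each
   layer carries one letter and has two cells, a strong "reader" walks along it, and two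
   strong "builders" extend it at the other end.  Deleted cells are still usable, since a
   movement restores its target.  Every cell is adjacent to a hub and to the strong endpoints
   whose triple of colours does not contain the colour of the cell.  Hence the three strong
   cells alone never reach all endpoints, and Constructor loses when the machine halts; but
   they do together with one weak node of a fourth colour, and by choosing the colours of new
   cells and the cells she moves to, Constructor keeps two such weak nodes after each of her
   turns as long as the machine runs.

   Queue machines simulate counter machines.  If [P] decided the game, then the counter
   machine that computes from [m] the code of the game in which it runs itself on input [m],
   applies [P], and halts iff the answer is yes, would yield a contradiction for a suitable
   [m]: take for [m] the code of all rules but those that supply the input. *)

Require Import Defs.
From HB Require Import structures.
From mathcomp Require Import all_boot zify.
From Stdlib Require Import Classical ClassicalEpsilon.

Set Implicit Arguments. Unset Strict Implicit. Unset Printing Implicit Defensive.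

(** * Winning and losing invariants *)

(** One queue step costs Constructor at most nine rules: start, reader move, reader arrival, three
    new cells, two builder moves, arrival. The hub label prescribes this order, and the only
    deviation that it permits strands the reader; so a bound on the runs of the queue machine bounds
    the number of her rule applications. The constants come from her side. The second builder must
    avoid two colours, that of the surviving weak node and that of the first builder's new cell;
    hence three candidate cells per layer. A new candidate must avoid the three strong cells, the
    two cells of the layer that the reader may enter next, and at most two earlier candidates; hence
    eight colours. Labels are finite in number, so a layer is recorded modulo 3, which is enough to
    tell the next layer from the previous one. In the diagonal argument the game must know [m], but
    [m] is the code of a part of its rules. The way out is to supply the input by [m] further rules
    outside that part: then [m] is at once the code from which the rule list is built and the number
    of rules to put in front of it. *)

Definition dec_rule (c : (seq ((nat * nat) * (nat * nat)) + (nat * nat)) +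
                         (bool * seq nat * nat * seq nat)) : rule :=
  match c with
  | inl (inl ps) => Relabel ps
  | inl (inr (a, b)) => Move a b
  | inr (st, pre, c, post) => Create st pre c post
  end.

Lemma enc_ruleK : cancel enc_rule dec_rule.
Proof. by case. Qed.

HB.instance Definition _ := Countable.copy rule (can_type enc_ruleK).

Definition del_node (G : network) (v : nat) : network :=
  Network (nV G) (nE G) (filter (predC1 v) (nA G)) (nS G) (nlab G).

Definition is_weak (G : network) (v : nat) : bool := (v \in nA G) && (v \notin nS G).

Definition weak_nodes (G : network) : seq nat := filter (is_weak G) (nA G).

Definition greedy (G : network) : network :=
  if weak_nodes G is v :: _ then del_node G v else G.

Lemma greedy_dmove G : dmove G (greedy G).
Proof.
rewrite /greedy; case E: (weak_nodes G) => [|v s]; first by left.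
right; exists v; have : v \in weak_nodes G by rewrite E mem_head.
by rewrite mem_filter => /andP[/andP[-> ->] _].
Qed.

Lemma weak_nodes_del G v : is_weak G v ->
  size (weak_nodes (del_node G v)) < size (weak_nodes G).
Proof.
move=> wv; rewrite /weak_nodes /= -filter_predI.
have -> : [seq x <- nA G | predI (is_weak (del_node G v)) (predC1 v) x] =
          filter (predC1 v) (weak_nodes G).
  rewrite /weak_nodes -filter_predI; apply: eq_filter => x /=.
  by rewrite /is_weak /= mem_filter /=; case: (x == v); rewrite ?andbF ?andbT.
rewrite -/(weak_nodes G) size_filter -(count_predC (predC1 v) (weak_nodes G)) -[X in X < _]addn0.
rewrite ltn_add2l -has_count; apply/hasP; exists v; last by rewrite /= eqxx.
by rewrite mem_filter wv /=; case/andP: wv.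
Qed.

Fixpoint history (sigma : seq network -> network) (G : network) (n : nat) : seq network :=
  if n is n'.+1 then
    let h := history sigma G n' in
    rcons h (if odd n' then sigma h else greedy (last G h))
  else [:: G].

Lemma history_map sigma G n :
  history sigma G n = [seq last G (history sigma G j) | j <- iota 0 n.+1].
Proof.
elim: n => // n IH; rewrite -[n.+2]addn1 iotaD map_cat -IH /=.
by rewrite last_rcons cats1.
Qed.

(** Greedy deletion wins by lexicographic descent on [n] and the number of weak nodes. An applied
    rule lowers [n], whatever it does to the weak nodes; if Constructor skips, the deletion just
    made has lowered the second component. So a network without weak nodes is reached. *)
Lemma losing_invariant (R : seq rule) (Inv : nat -> network -> Prop) :
  (forall n G v, Inv n G -> is_weak G v -> Inv n (del_node G v)) ->
  (forall n G G' r, Inv n G -> r \in R -> apply_rule r G G' ->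
     exists2 n', n' < n & Inv n' G') ->
  (forall n G, Inv n G -> weak_nodes G = [::] -> ~ connected G) ->
  forall n G, Inv n G -> ~ constructor_wins_safety G R.
Proof.
move=> Idel Irule Iend n G IG [sigma win].
pose p i := last G (history sigma G i).
have p0 : p 0 = G by [].
have pD i : ~~ odd i -> p i.+1 = greedy (p i).
  by move=> /negbTE oi; rewrite /p /= oi last_rcons.
have pC i : odd i -> p i.+1 = sigma [seq p j | j <- iota 0 i.+1].
  by move=> oi; rewrite {1}/p /= oi last_rcons {1}history_map.
have {win} W : forall i, connected (p i) /\ (odd i -> cmove R (p i) (p i.+1)).
  apply: win => // i oi; rewrite pD //; exact: greedy_dmove.
suff H : forall n c i, ~~ odd i -> Inv n (p i) -> size (weak_nodes (p i)) < c -> False.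
  exact: (H n (size (weak_nodes G)).+1 0).
elim/ltn_ind=> {IG} {}n IHn; elim=> [|c IHc] i oi Ii wi; first by rewrite ltn0 in wi.
have [con _] := W i.
case E : (weak_nodes (p i)) => [|v s]; first exact: Iend Ii E con.
have wv : is_weak (p i) v.
  have: v \in weak_nodes (p i) by rewrite E mem_head.
  by rewrite mem_filter => /andP[].
have p1 : p i.+1 = del_node (p i) v by rewrite pD // /greedy E.
have I1 : Inv n (p i.+1) by rewrite p1; apply: Idel.
have [_ /(_ oi)] := W i.+1.
case=> [p2|[k [lk ap]]].
  apply: (IHc i.+2); rewrite ?negbK //= p2 // p1.
  by apply: leq_trans (weak_nodes_del wv) _.
have [n' ltn I2] := Irule _ _ _ _ I1 (mem_nth _ lk) ap.
by apply: (IHn n' ltn (size (weak_nodes (p i.+2))).+1 i.+2); rewrite /= ?negbK.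
Qed.

(** [K] is needed only where Destructor is to move. A positional strategy then suffices: [epsilon]
    picks an answer from the last network of the prefix. *)
Lemma winning_invariant (R : seq rule) (K : network -> Prop) :
  (forall G, K G -> connected G) ->
  (forall G G', K G -> dmove G G' ->
     connected G' /\ exists2 G'', cmove R G' G'' & K G'') ->
  forall G, K G -> constructor_wins_safety G R.
Proof.
move=> Kcon Kstep G KG.
pose good G' G'' := cmove R G' G'' /\ K G''.
pose sigma (h : seq network) : network :=
  epsilon (inhabits G) (good (last G h)).
exists sigma => p p0 pD pC.
have step i : ~~ odd i -> K (p i) ->
    connected (p i.+1) /\ good (p i.+1) (p i.+2).
  move=> oi Ki; have [c1 [G'' m k]] := Kstep _ _ Ki (pD _ oi); split=> //.
  rewrite (pC i.+1) // -[i.+2]addn1 iotaD map_cat /sigma last_cat /=.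
  by apply: epsilon_spec; exists G''.
have even i : K (p i.*2).
  elim: i => [|i IH]; first by rewrite p0.
  by have [_ []] := step _ (negbT (odd_double i)) IH.
move=> i; rewrite -(odd_double_half i); case: (odd i) => /=.
  by have [c [m _]] := step _ (negbT (odd_double _)) (even i./2); rewrite add1n.
by rewrite add0n; split; [apply: Kcon|rewrite odd_double].
Qed.

(** * The rules of the ladder game *)

(** A label codes a list whose head is a tag. This coding agrees with [pickle] on lists of naturals,
    so a counter machine can later compute labels and codes of games by the same arithmetic. *)
Definition lab (l : seq nat) : nat := CodeSeq.code l.
Arguments lab : simpl never.

Lemma lab_inj : injective lab.
Proof. exact: can_inj CodeSeq.codeK. Qed.

Definition ltag (n : nat) : nat := head 0 (CodeSeq.decode n).
Arguments ltag : simpl never.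

Lemma ltag_lab l : ltag (lab l) = head 0 l.
Proof. by rewrite /ltag /lab CodeSeq.codeK. Qed.

(* One endpoint per triple of colours: three strong cells with colours [x, y, z] leave
   the endpoint of [x, y, z] isolated, whereas cells of four different colours reach
   every endpoint. *)
Lemma triples_exist :
  {T : seq (seq nat) | all (fun t => size t == 3) T &
     forall x y z, x < 8 -> y < 8 -> z < 8 -> [:: x; y; z] \in T}.
Proof.
exists [seq [:: p.1.1; p.1.2; p.2] |
         p <- allpairs pair (allpairs pair (iota 0 8) (iota 0 8)) (iota 0 8)].
  by apply/allP=> _ /mapP[p _ ->].
move=> x y z hx hy hz; apply/mapP; exists ((x, y), z) => //.
by do !apply: allpairs_f; rewrite mem_iota.
Qed.

(** The list comes from a lemma closed by [Qed], so its 512 entries stay opaque and [nend] never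
    unfolds. *)
Definition triples : seq (seq nat) := s2val triples_exist.
Definition nend : nat := size triples.
Definition tri (i : nat) : seq nat := nth [::] triples i.
(** Nodes below [nst] are permanent and always strong: node 0 carries the state of the queue
    machine, node 1 is the hub, the others are the endpoints. *)
Definition nst : nat := nend.+2.

Lemma size_tri i : size (tri i) <= 3.
Proof.
rewrite /tri /triples; case: triples_exist => T /= + _.
have [lt|le] := ltnP i (size T); last by rewrite nth_default.
by move=> /allP/(_ _ (mem_nth [::] lt))/eqP->.
Qed.

Lemma tri_exists x y z : x < 8 -> y < 8 -> z < 8 ->
  exists2 i, i < nend & tri i = [:: x; y; z].
Proof.
move=> hx hy hz; have := s2valP' triples_exist _ _ _ hx hy hz.
by rewrite -/triples => /(nthP [::])[i lt <-]; exists i.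
Qed.

(** Tag 0 belongs to the state node, tags 1 to 4 to the hub, 5 to endpoints, 6 to connectors, which
    are joined to all endpoints. Cells have tags 7 to 11: without a letter, under a builder that
    still builds, lettered and free to be left or entered, under the reader, under the reader about
    to leave. [mu] is the layer modulo 3. *)
Notation Kap s := (lab (0 :: s)).
Notation READY := (lab [:: 1]).
Notation WR b s := (lab [:: 2; b; s]).
Notation GO b := (lab [:: 3; b]).
Notation RGO b := (lab [:: 4; b]).
Notation EE i := (lab [:: 5; i]).
Notation XX := (lab [:: 6]).
Notation FF mu := (lab [:: 7; mu]).
Notation NN a mu := (lab [:: 8; a; mu]).
Notation MM a mu := (lab [:: 9; a; mu]).
Notation RL a mu := (lab [:: 10; a; mu]).
Notation GG a mu := (lab [:: 11; a; mu]).

Definition ends : seq nat := [seq EE i | i <- iota 0 nend].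
Definition ends_of (k : nat) : seq nat := [seq EE i | i <- iota 0 nend & k \notin tri i].

(* Queue machines with two kinds of instructions: write a letter at the end, or delete
   the first letter and write one at the end. *)
Definition wentry := (seq nat * nat * seq nat)%type.
Definition rentry := (seq nat * nat * nat * seq nat)%type.
Definition conf := (seq nat * seq nat)%type.

Variant qstep (W : seq wentry) (Q : seq rentry) : conf -> conf -> Prop :=
  | QW s b s' w of (s, b, s') \in W : qstep W Q (s, w) (s', rcons w b)
  | QR s a b s' w of (s, a, b, s') \in Q : qstep W Q (s, a :: w) (s', rcons w b).

(** In all creation rules the endpoints form a common tail of both sides: they are listed to become
    neighbours of the new node and keep their labels. *)
Definition startw (e : wentry) : rule :=
  let: (s, b, s') := e in
  Create false ([:: READY; Kap s] ++ ends) XX ([:: WR b 0; Kap s'] ++ ends).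
Definition startr (e : rentry) (mu : nat) : rule :=
  let: (s, a, b, s') := e in
  Create false ([:: READY; Kap s; RL a mu] ++ ends) XX
    ([:: RGO b; Kap s'; GG a mu] ++ ends).
Definition rarrive b a mu : rule :=
  Create false ([:: RGO b; MM a mu] ++ ends) XX ([:: WR b 0; RL a mu] ++ ends).
(** The counter [s] admits three cells per letter. The third one turns the builders' labels into
    [MM], which unlocks their moves. Constructor chooses the colour [k] of the new cell by choosing
    the rule. *)
Definition cellr b s a mu k : rule :=
  Create false ([:: WR b s; NN a mu; NN a mu] ++ ends_of k) (FF (mu.+1 %% 3))
    ((if s < 2 then [:: WR b s.+1; NN a mu; NN a mu]
      else [:: GO b; MM a mu; MM a mu]) ++ ends_of k).
Definition arrive b mu : rule :=
  Create false ([:: GO b; FF mu; FF mu] ++ ends) XX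
    ([:: READY; NN b mu; NN b mu] ++ ends).
Definition moveb a mu : rule := Move (MM a mu) (FF (mu.+1 %% 3)).
Definition mover a a' mu : rule := Move (GG a mu) (MM a' (mu.+1 %% 3)).

Definition pairs (S T : Type) (s : seq S) (t : seq T) := allpairs pair s t.

Definition ladder_rules (B : nat) (Q : seq rentry) : seq rule :=
  let L := iota 0 B in
  let Mu := iota 0 3 in
  [seq startr p.1 p.2 | p <- pairs Q Mu] ++
  [seq rarrive p.1.1 p.1.2 p.2 | p <- pairs (pairs L L) Mu] ++
  [seq cellr p.1.1 p.1.2 p.2.1.1 p.2.1.2 p.2.2 |
     p <- pairs (pairs L Mu) (pairs (pairs L Mu) (iota 0 8))] ++
  [seq arrive p.1 p.2 | p <- pairs L Mu] ++
  [seq moveb p.1 p.2 | p <- pairs L Mu] ++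
  [seq mover p.1.1 p.1.2 p.2 | p <- pairs (pairs L L) Mu].

Definition game_rules (B : nat) (W : seq wentry) (Q : seq rentry) : seq rule :=
  [seq startw e | e <- W] ++ ladder_rules B Q.

Variant is_rule (B : nat) (W : seq wentry) (Q : seq rentry) : rule -> Prop :=
  | IsStartw e of e \in W : is_rule B W Q (startw e)
  | IsStartr e mu of e \in Q & mu < 3 : is_rule B W Q (startr e mu)
  | IsRarrive b a mu of b < B & a < B & mu < 3 : is_rule B W Q (rarrive b a mu)
  | IsCell b s a mu k of b < B & s < 3 & a < B & mu < 3 & k < 8 :
      is_rule B W Q (cellr b s a mu k)
  | IsArrive b mu of b < B & mu < 3 : is_rule B W Q (arrive b mu)
  | IsMoveb a mu of a < B & mu < 3 : is_rule B W Q (moveb a mu)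
  | IsMover a a' mu of a < B & a' < B & mu < 3 : is_rule B W Q (mover a a' mu).

Lemma mem_pairs (S T : eqType) (s : seq S) (t : seq T) p :
  (p \in pairs s t) = (p.1 \in s) && (p.2 \in t).
Proof.
apply/idP/idP=> [/allpairsP[[x y] [hx hy ->]]|]; first by rewrite hx hy.
by case: p => x y /andP[hx hy]; apply: allpairs_f.
Qed.

Lemma game_rulesP B W Q r : reflect (is_rule B W Q r) (r \in game_rules B W Q).
Proof.
apply: (iffP idP).
  rewrite !mem_cat.
  case/or4P=> [/mapP[x hx ->]|/mapP[[x mu]]|/mapP[[[b a] mu]]|].
  - exact: IsStartw.
  - by rewrite mem_pairs mem_iota => /andP[h1 h2] ->; apply: IsStartr.
  - by rewrite !mem_pairs !mem_iota => /andP[/andP[h1 h2] h3] ->; apply: IsRarrive.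
  case/or4P=> /mapP.
  - case=> [[[b s] [[a mu] k]]].
    rewrite !mem_pairs !mem_iota => /andP[/andP[h1 h2] /andP[/andP[h3 h4] h5]] ->.
    exact: IsCell.
  - by case=> [[b mu]]; rewrite mem_pairs !mem_iota => /andP[h1 h2] ->; apply: IsArrive.
  - by case=> [[b mu]]; rewrite mem_pairs !mem_iota => /andP[h1 h2] ->; apply: IsMoveb.
  case=> [[[b a] mu]]; rewrite !mem_pairs !mem_iota => /andP[/andP[h1 h2] h3] ->.
  exact: IsMover.
rewrite !mem_cat; case.
- by move=> e h; rewrite (map_f startw h).
- move=> e mu h1 h2; apply/orP; right; apply/orP; left.
  apply/mapP; exists (e, mu) => //; by rewrite mem_pairs mem_iota /= h1.
- move=> b a mu h1 h2 h3; apply/or3P; apply: Or33; apply/orP; left.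
  by apply/mapP; exists ((b, a), mu); rewrite // !mem_pairs !mem_iota /= h1 h2.
- move=> b s a mu k h1 h2 h3 h4 h5; apply/or4P; apply: Or44; apply/orP; left.
  apply/mapP; exists ((b, s), ((a, mu), k)); rewrite // !mem_pairs !mem_iota /=.
  by rewrite !add0n h1 h2 h3 h4 h5.
- move=> b mu h1 h2; apply/or4P; apply: Or44; apply/or3P; apply: Or32.
  by apply/mapP; exists (b, mu); rewrite // !mem_pairs !mem_iota /= h1.
- move=> a mu h1 h2; apply/or4P; apply: Or44; apply/or4P; apply: Or43.
  by apply/mapP; exists (a, mu); rewrite // !mem_pairs !mem_iota /= h1.
- move=> a a' mu h1 h2 h3; apply/or4P; apply: Or44; apply/or4P; apply: Or44.
  by apply/mapP; exists ((a, a'), mu); rewrite // !mem_pairs !mem_iota /= h1 h2.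
Qed.

Lemma ladder_rules_ok B W Q :
  all wf_rule (game_rules B W Q) && all restricted_rule (game_rules B W Q).
Proof.
rewrite -all_predI; apply/allP=> r /game_rulesP[].
- by case=> [[s b] s'] _ /=; rewrite eqxx.
- by case=> [[[s a] b] s'] mu _ _ /=; rewrite eqxx.
- by move=> b a mu _ _ _ /=; rewrite eqxx.
- by move=> b s a mu k _ _ _ _ _ /=; case: ifP => _; rewrite /= eqxx.
- by move=> b mu _ _ /=; rewrite eqxx.
- by [].
by [].
Qed.

(** * Structural invariant of the ladder *)

Lemma relabel_list_cat l us1 us2 p1 p2 : size us1 = size p1 ->
  relabel_list l (us1 ++ us2) (p1 ++ p2) =
  relabel_list (relabel_list l us1 p1) us2 p2.
Proof. by move=> E; rewrite /relabel_list zip_cat // foldl_cat. Qed.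

Lemma nth_relabel_notin l us p v : v \notin us ->
  nth 0 (relabel_list l us p) v = nth 0 l v.
Proof.
elim: us p l => [|u us IH] [|a p] l //=; rewrite inE negb_or => /andP[vu vus].
by rewrite /relabel_list /= -/(relabel_list _ us p) IH // nth_set_nth /= (negbTE vu).
Qed.

Lemma nth_relabel_same l us v : nth 0 (relabel_list l us (map (nth 0 l) us)) v = nth 0 l v.
Proof.
have H : forall us l l', nth 0 l =1 nth 0 l' ->
    nth 0 (relabel_list l us (map (nth 0 l') us)) =1 nth 0 l'.
  elim=> [|u us' IH] l1 l2 E //=; apply: IH => x; rewrite nth_set_nth /=.
  by case: eqP => [->|].
exact: H.
Qed.

Lemma size_relabel_list l us p : all (fun u => u < size l) us ->
  size (relabel_list l us p) = size l.
Proof.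
elim: us p l => [|u us IH] [|a p] l //= /andP[lu lus].
rewrite /relabel_list /= -/(relabel_list _ us p).
have E : size (set_nth 0 l u a) = size l by rewrite size_set_nth; apply/maxn_idPr.
by rewrite IH E.
Qed.

(** The letter shown by a cell is a function of its layer, so it does not matter which cell of a
    layer the reader enters. Cells beyond layer [J] show no letter. *)
Definition cell_label (lay lt : nat -> nat) (J v l : nat) : bool :=
  [|| l == XX, l == FF (lay v %% 3) |
      (lay v <= J) &&
      has (fun k => l == lab [:: k; lt (lay v); lay v %% 3]) [:: 8; 9; 10; 11]].

(* [lay v] is the layer of the cell [v], [lt j] the letter of layer [j], [s] the state of
   the queue machine, [h] the label of the hub, [T] the three strong cells, and [J] the
   last layer that carries a letter. *)
Record core (G : network) (lay lt : nat -> nat) (s : seq nat) (h : nat)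
    (T : seq nat) (J : nat) : Prop := Core {
  core_V : nst <= nV G;
  core_size : size (nlab G) = nV G;
  core_adj_lt : forall u v, adj G u v -> (u < nV G) && (v < nV G);
  core_S : forall u, (u \in nS G) = (u < nst) || (u \in T);
  core_SA : {subset nS G <= nA G};
  core_T : forall t, t \in T -> [&& nst <= t, t < nV G & label G t != XX];
  core_uniq : uniq T;
  core_size3 : size T = 3;
  core_end : forall i, i < nend -> label G i.+2 = EE i;
  core_kap : label G 0 = Kap s;
  core_hub : label G 1 = h;
  core_tag : 0 < ltag h < 5;
  core_cell : forall v, nst <= v < nV G -> cell_label lay lt J v (label G v);
  core_lay : forall u v, nst <= u -> nst <= v -> adj G u v ->
    label G u != XX -> label G v != XX -> lay u = (lay v).+1 \/ lay v = (lay u).+1;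
  core_col : forall v, nst <= v < nV G -> label G v != XX ->
    exists2 k, k < 8 & forall i, i < nend -> k \in tri i -> ~~ adj G v i.+2;
  core_stat : forall i v, i < nend -> v < nst -> ~~ adj G v i.+2 }.

Lemma adjC G u v : adj G u v = adj G v u.
Proof. by rewrite /adj orbC. Qed.

(** Only permanent nodes and the three tokens are active. Permanent nodes are not adjacent to
    endpoints, and the endpoint of the triple of token colours is adjacent to no token; so it is cut
    off from the hub. *)
Lemma core_stuck G lay lt s h T J : core G lay lt s h T J ->
  weak_nodes G = [::] -> ~ connected G.
Proof.
move=> C W con.
have act u : u \in nA G -> (u < nst) || (u \in T).
  move=> uA; rewrite -(core_S C); apply/negPn/negP=> uS.
  have: u \in weak_nodes G by rewrite mem_filter /is_weak uA uS.
  by rewrite W.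
have [k1 [k2 [k3 [l1 l2 l3 tk]]]] : exists k1 k2 k3, [/\ k1 < 8, k2 < 8, k3 < 8 &
    forall t, t \in T -> forall i, i < nend -> k1 \in tri i -> k2 \in tri i ->
      k3 \in tri i -> ~~ adj G t i.+2].
  have := core_size3 C; have := core_T C.
  case: {act} T C => [|t1 [|t2 [|t3 [|]]]] //= C cT _.
  have col t : t \in [:: t1; t2; t3] -> exists2 k, k < 8 &
      forall i, i < nend -> k \in tri i -> ~~ adj G t i.+2.
    move=> /cT/and3P[h1 h2 h3]; apply: (core_col C) => //; exact/andP.
  have [k1 h1 e1] := col t1 (mem_head _ _).
  have [k2 h2 e2] : exists2 k, k < 8 & forall i, i < nend -> k \in tri i -> ~~ adj G t2 i.+2.
    by apply: col; rewrite !inE eqxx orbT.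
  have [k3 h3 e3] : exists2 k, k < 8 & forall i, i < nend -> k \in tri i -> ~~ adj G t3 i.+2.
    by apply: col; rewrite !inE eqxx !orbT.
  exists k1, k2, k3; split=> // t; rewrite !inE => /or3P[] /eqP-> i li *;
    [exact: e1|exact: e2|exact: e3].
have [i li ti] := tri_exists l1 l2 l3.
have inA u : u < nst -> u \in nA G.
  by move=> lu; apply: (core_SA C); rewrite (core_S C) lu.
have [|| [|y p]] := con i.+2 1; rewrite ?inA //=.
move=> /andP[/andP[/andP[a /act]]] + _ _.
rewrite adjC in a; case/orP=> [ly|yT]; first by case/negP: (core_stat C li ly).
have /negP[] // : ~~ adj G y i.+2.
by apply: tk => //; rewrite ti !inE eqxx ?orbT.
Qed.

Lemma core_del G lay lt s h T J v : core G lay lt s h T J -> is_weak G v ->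
  core (del_node G v) lay lt s h T J.
Proof.
move=> C /andP[_ vS]; case: (C) => ? ? ? ? SA ? ? ? ? ? ? ? ? ? ? ?; split=> //= u uS.
by rewrite mem_filter /= SA // andbT; apply: contraNneq vS => <-.
Qed.

Lemma core_extend G lay lt s h T J J' lt' : core G lay lt s h T J -> J <= J' ->
  (forall j, j <= J -> lt' j = lt j) -> core G lay lt' s h T J'.
Proof.
move=> C leJ eqlt; case: (C) => ? ? ? ? ? ? ? ? ? ? ? ? cl ? ? ?; split=> // v lv.
have /or3P[] := cl v lv; rewrite /cell_label.
- by move=> ->.
- by move=> ->; rewrite orbT.
by case/andP=> le; rewrite eqlt // (leq_trans le leJ) => ->; rewrite !orbT.
Qed.

Definition add_node (G : network) (us L : seq nat) : network :=
  Network (nV G).+1 ([seq (nV G, u) | u <- us] ++ nE G) (nV G :: nA G) (nS G) L.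

Lemma adj_add_node G us L u v : adj (add_node G us L) u v =
  [|| (u == nV G) && (v \in us), (v == nV G) && (u \in us) | adj G u v].
Proof.
have H x y : ((x, y) \in [seq (nV G, u) | u <- us]) = (x == nV G) && (y \in us).
  apply/mapP/andP=> [[z hz [-> ->]]|[/eqP-> hy]]; first by rewrite eqxx.
  by exists y.
by rewrite /adj /= !mem_cat !H; do !case: (_ \in _); do !case: (_ == _).
Qed.

(** The label list is abstract and enters only pointwise. Relabelling must neither make nor unmake a
    connector, because the clauses on layers and colours exempt exactly the connectors. *)
Lemma core_create G lay lt s h T J us L s' h' j0 : core G lay lt s h T J ->
  size L = (nV G).+1 -> {subset us <= nS G} ->
  nth 0 L 0 = Kap s' -> nth 0 L 1 = h' -> 0 < ltag h' < 5 ->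
  (forall i, i < nend -> nth 0 L i.+2 = EE i) ->
  (forall v, nst <= v < nV G -> cell_label lay lt J v (nth 0 L v) /\
     (nth 0 L v == XX) = (label G v == XX)) ->
  (nth 0 L (nV G) = XX \/
   [/\ nth 0 L (nV G) = FF (j0 %% 3),
       forall u, u \in us -> nst <= u -> j0 = (lay u).+1 &
       exists2 k, k < 8 & forall i, i < nend -> k \in tri i -> i.+2 \notin us]) ->
  core (add_node G us L) (fun v => if v == nV G then j0 else lay v) lt s' h' T J.
Proof.
move=> C sL usS k0 h0 th e0 cl nw.
have usV u : u \in us -> u < nV G.
  move=> /usS; rewrite (core_S C) => /orP[/leq_trans->//|/(core_T C)/and3P[]//].
  exact: core_V C.
have wst : nst <= nV G := core_V C.
have neE i : i < nend -> (i.+2 == nV G) = false.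
  by move=> li; apply: ltn_eqF; apply: leq_trans wst; rewrite /nst !ltnS.
have adjw u : adj G (nV G) u = false.
  by apply/negP=> /(core_adj_lt C); rewrite ltnn.
have labw v : v < nV G -> nst <= v -> (label (add_node G us L) v != XX) = (label G v != XX).
  by move=> lv sv; have [_ ->] := cl v (introT andP (conj sv lv)).
split=> //=.
- exact: leqW.
- move=> u v; rewrite adj_add_node.
  by case/or3P=> [/andP[/eqP-> /usV]|/andP[/eqP-> /usV]|/(core_adj_lt C)]; lia.
- exact: core_S C.
- by move=> u /(core_SA C) uA; rewrite inE uA orbT.
- move=> t tT; have /and3P[h1 h2 h3] := core_T C tT.
  by rewrite h1 labw // h3 ltnW.
- exact: core_uniq C.
- exact: core_size3 C.
- move=> v /andP[sv]; rewrite ltnS leq_eqVlt => /orP[/eqP->|lv].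
    rewrite /cell_label eqxx /label /=; case: nw => [->|[-> _ _]]; rewrite eqxx ?orbT //.
  have [] := cl v (introT andP (conj sv lv)).
  by rewrite /cell_label (ltn_eqF lv) /label.
- move=> u v su sv; rewrite adj_add_node => /or3P[].
  + case/andP=> /eqP-> vus; rewrite eqxx (ltn_eqF (usV _ vus)) => lw _.
    case: nw lw => [|[_ H _] _]; first by rewrite /label => ->; rewrite eqxx.
    by left; apply: H.
  + case/andP=> /eqP-> uus; rewrite eqxx (ltn_eqF (usV _ uus)) => _ lw.
    case: nw lw => [|[_ H _] _]; first by rewrite /label => ->; rewrite eqxx.
    by right; apply: H.
  + move=> a; have /andP[lu lv] := core_adj_lt C a.
    by rewrite (ltn_eqF lu) (ltn_eqF lv) !labw //; apply: core_lay C _ _ _ _ _.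
- move=> v /andP[sv]; rewrite ltnS leq_eqVlt => /orP[/eqP->|lv].
    case: nw => [|[_ _ [k lk H]] _]; first by rewrite /label => ->; rewrite eqxx.
    by exists k => // i li ki; rewrite adj_add_node eqxx adjw neE // (negbTE (H _ li ki)).
  rewrite labw // => /(core_col C (introT andP (conj sv lv)))[k lk H].
  exists k => // i li ki.
  by rewrite adj_add_node (negbTE (H i li ki)) (ltn_eqF lv) neE.
- move=> i v li lv; rewrite adj_add_node (negbTE (core_stat C li lv)).
  by rewrite (ltn_eqF (leq_trans lv wst)) neE.
Qed.

Definition move_strong (G : network) (u v : nat) : network :=
  Network (nV G) (nE G) (v :: nA G) (v :: filter (predC1 u) (nS G)) (nlab G).

(** The token list is edited in place, so the roles by position (reader, then the two builders)
    survive the move. *)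
Lemma core_move G lay lt s h T J u v : core G lay lt s h T J ->
  u \in T -> v < nV G -> v \notin nS G -> label G v != XX ->
  core (move_strong G u v) lay lt s h [seq if t == u then v else t | t <- T] J.
Proof.
move=> C uT lv vS lX.
have vst : nst <= v by move: vS; rewrite (core_S C) negb_or -leqNgt => /andP[].
have vT : v \notin T by move: vS; rewrite (core_S C) negb_or => /andP[].
have ust : nst <= u by have /and3P[] := core_T C uT.
case: (C) => ? ? ? cS SA cT ? ? ? ? ? ? ? ? ? ?; split=> //=.
- move=> x; rewrite inE mem_filter cS /=.
  apply/idP/idP.
    case/predU1P=> [->|/andP[xu /orP[->//|xT]]]; apply/orP; right; apply/mapP.
      by exists u; rewrite ?eqxx.
    by exists x; rewrite ?(negbTE xu).
  case/orP=> [lx|/mapP[t tT ->]].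
    by rewrite lx /= andbT; apply/orP; right; rewrite neq_ltn (leq_trans lx ust).
  by have [_|tu] := eqVneq t u; rewrite ?eqxx // tT tu !orbT.
- move=> x; rewrite !inE mem_filter => /predU1P[->|/andP[_ /SA->]].
    by rewrite eqxx.
  by rewrite orbT.
- move=> t /mapP[t' /cT/and3P[h1 h2 h3] ->]; rewrite /label /=.
  by case: eqP => _; [rewrite vst lv|rewrite h1 h2].
- rewrite map_inj_in_uniq // => x y xT yT.
  case: eqP => [->|_]; case: eqP => [->|_] // E; first by rewrite E yT in vT.
  by rewrite -E xT in vT.
- by rewrite size_map.
Qed.

(** The nodes matched by the common tail [pe] are rewritten with their own labels, so pointwise only
    [us0] matters. Equality of the lists is not claimed. *)
Lemma apply_createP G lay lt s h T J pre0 pe c post0 G' : core G lay lt s h T J ->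
  apply_rule (Create false (pre0 ++ pe) c (post0 ++ pe)) G G' ->
  size pre0 = size post0 ->
  exists us0 ue L, [/\ uniq us0 /\ {subset us0 ++ ue <= nS G},
    map (label G) us0 = pre0, map (label G) ue = pe, size L = (nV G).+1 &
    G' = add_node G (us0 ++ ue) L /\
    nth 0 L =1 nth 0 (relabel_list (rcons (nlab G) c) us0 post0)].
Proof.
move=> C [us [_ un /allP st]] E -> sz.
have szu : size us = size pre0 + size pe by rewrite -size_cat -E size_map.
pose us0 := take (size pre0) us; pose ue := drop (size pre0) us.
have D : us0 ++ ue = us := cat_take_drop _ _.
have s0 : size us0 = size pre0 by rewrite size_take_min szu; apply/minn_idPl; lia.
have [E0 E1] : map (label G) us0 = pre0 /\ map (label G) ue = pe.
  move: E; rewrite -D map_cat => /eqP; rewrite eqseq_cat ?size_map //.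
  by case/andP=> /eqP-> /eqP->.
have stV u : u \in us -> u < nV G.
  move=> /st; rewrite /isstrong (core_S C) => /orP[/leq_trans->//|/(core_T C)/and3P[]//].
  exact: core_V C.
move: un; rewrite -{1}D cat_uniq => /and3P[un0 /hasPn dis un1].
exists us0, ue, (relabel_list (rcons (nlab G) c) us (post0 ++ pe)); split=> //.
- split=> // u; rewrite D; exact: st.
- rewrite size_relabel_list size_rcons (core_size C) //.
  by apply/allP=> u /stV/ltnW; rewrite ltnS.
split; first by rewrite D.
move=> v; rewrite -[in LHS]D relabel_list_cat ?s0 //.
rewrite -{1}E1; set l1 := relabel_list _ us0 _.
rewrite (_ : map (label G) ue = map (nth 0 l1) ue) ?nth_relabel_same //.
apply/eq_in_map=> u uue; rewrite /l1 nth_relabel_notin; last exact: dis.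
rewrite nth_rcons (core_size C) stV //.
by rewrite -D mem_cat uue orbT.
Qed.

(** * Destructor wins when the queue machine halts *)

Ltac lab_inv := repeat match goal with
  | H : lab _ = lab _ |- _ => apply lab_inj in H
  | H : _ :: _ = _ :: _ |- _ => injection H; clear H; intros
  | H : [::] = [::] |- _ => clear H
  | H : _ |- _ => discriminate H
  end.

(** The four kinds of strong nodes have disjoint tags. Hence the labels in a rule reveal which nodes
    it was applied to, whatever nodes Constructor meant to choose. *)
Lemma core_strongP G lay lt s h T J u : core G lay lt s h T J -> u \in nS G ->
  [\/ u = 0 /\ label G u = Kap s, u = 1 /\ label G u = h,
      exists i, [/\ i < nend, u = i.+2 & label G u = EE i]
    | u \in T /\ 6 < ltag (label G u) ].
Proof.
move=> C; rewrite (core_S C); case/orP=> [|uT].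
  case: u => [|[|i]] li; first by constructor 1; rewrite (core_kap C).
    by constructor 2; rewrite (core_hub C).
  by constructor 3; exists i; rewrite (core_end C).
constructor 4; split=> //; have /and3P[h1 h2 h3] := core_T C uT.
have /or3P[E|/eqP->|/andP[_ /hasP[k kin /eqP->]]] := core_cell C (introT andP (conj h1 h2)).
- by rewrite E in h3.
- by rewrite ltag_lab.
by rewrite ltag_lab /=; move: kin; rewrite !inE => /or4P[] /eqP->.
Qed.

Lemma core_hub_uniq G lay lt s h T J u : core G lay lt s h T J -> u \in nS G ->
  0 < ltag (label G u) < 5 -> u = 1 /\ label G u = h.
Proof.
move=> C /(core_strongP C)[[-> ->]|[-> ->]|[i [_ _ ->]]|[_ t]] //.
- by rewrite ltag_lab.
- by rewrite ltag_lab.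
by case/andP=> _ t'; have := ltn_trans t t'; rewrite ltnNge.
Qed.

Lemma core_kap_uniq G lay lt s h T J u s0 : core G lay lt s h T J -> u \in nS G ->
  label G u = Kap s0 -> u = 0 /\ s0 = s.
Proof.
move=> C /(core_strongP C)[[-> ->]|[-> E]|[i [_ _ ->]]|[_ t]] e.
- by lab_inv.
- by have := core_tag C; rewrite -E e ltag_lab.
- by lab_inv.
by rewrite e ltag_lab in t.
Qed.

Lemma core_tok_uniq G lay lt s h T J u l : core G lay lt s h T J -> u \in nS G ->
  label G u = lab l -> 6 < head 0 l -> u \in T.
Proof.
move=> C /(core_strongP C)[[-> ->]|[-> E]|[i [_ _ ->]]|[//]] e.
- by lab_inv; subst l.
- by have := core_tag C; rewrite -E e ltag_lab => /andP[_ a] b; lia.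
by lab_inv; subst l.
Qed.

(** Reduces [core_create] to conditions on the tokens: no other cell is relabelled, and strong nodes
    with labels [EE i] can only be the endpoints themselves. *)
Lemma core_create_rule G lay lt s h T J us0 ue L c post0 I s' h' j0 :
  core G lay lt s h T J -> size L = (nV G).+1 -> {subset us0 ++ ue <= nS G} ->
  nth 0 L =1 nth 0 (relabel_list (rcons (nlab G) c) us0 post0) ->
  {subset us0 <= [:: 0; 1] ++ T} -> map (label G) ue = [seq EE i | i <- I] ->
  nth 0 L 0 = Kap s' -> nth 0 L 1 = h' -> 0 < ltag h' < 5 ->
  (forall v, v \in T -> v \in us0 -> lay v <= J /\
     exists2 k, k \in [:: 8; 9; 10; 11] & nth 0 L v = lab [:: k; lt (lay v); lay v %% 3]) ->
  (c = XX \/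
   [/\ c = FF (j0 %% 3), forall v, v \in T -> v \in us0 -> j0 = (lay v).+1 &
       exists2 k, k < 8 & {in I, forall i, k \notin tri i}]) ->
  core (add_node G (us0 ++ ue) L) (fun v => if v == nV G then j0 else lay v) lt s' h' T J.
Proof.
move=> C sL uS EL us0s Eue k0 h0 th cl nw.
have nT v : v < nst -> v \notin T.
  by move=> lv; apply/negP=> /(core_T C)/and3P[]; rewrite leqNgt lv.
have same v : 1 < v -> v \notin T -> v < nV G -> nth 0 L v = label G v.
  move=> v1 vT lv; rewrite EL nth_relabel_notin ?nth_rcons ?(core_size C) ?lv //.
  apply/negP=> /us0s; rewrite !inE (negbTE vT) orbF => /orP[] /eqP E; by rewrite E in v1.
have st2 v : nst <= v -> 1 < v by apply: leq_trans.
apply: (core_create C sL uS k0 h0 th).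
- move=> i li; rewrite same ?(core_end C) ?nT //.
  by apply: leq_trans (core_V C).
- move=> v /andP[sv lv]; have cv := core_cell C (introT andP (conj sv lv)).
  have [vT|vT] := boolP (v \in T); last by rewrite same // st2.
  have [vu|vu] := boolP (v \in us0).
    have [le [k kin ->]] := cl v vT vu; split.
      rewrite /cell_label le; apply/or3P; apply: Or33; apply/hasP; by exists k.
    have /and3P[_ _ /negbTE->] := core_T C vT; apply/negbTE/eqP=> E.
    by lab_inv; subst k.
  have -> : nth 0 L v = label G v.
    by rewrite EL nth_relabel_notin ?nth_rcons ?(core_size C) ?lv.
  by [].
have Lw : nth 0 L (nV G) = c.
  rewrite EL nth_relabel_notin ?nth_rcons ?(core_size C) ?ltnn ?eqxx //.
  apply/negP=> /us0s; rewrite !inE => /or3P[/eqP E|/eqP E|/(core_T C)/and3P[_]].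
  - by have := core_V C; rewrite E.
  - by have := core_V C; rewrite E.
  by rewrite ltnn.
have ueE u : u \in ue -> exists i, [/\ i \in I, i < nend & u = i.+2].
  move=> uu; have uS' : u \in nS G by apply: uS; rewrite mem_cat uu orbT.
  have: label G u \in [seq EE i | i <- I] by rewrite -Eue map_f.
  case/mapP=> i iI E; exists i.
  case: (core_strongP C uS') => [[_ E1]|[_ E1]|[i' [li' e' E1]]|[_ E1]].
  - by rewrite E in E1; lab_inv.
  - by have := core_tag C; rewrite -E1 E ltag_lab.
  - by rewrite E1 in E; lab_inv; subst.
  - by rewrite E ltag_lab in E1.
rewrite Lw; case: nw => [|[-> H1 [k lk H2]]]; [by left|right; split=> //].
- move=> u; rewrite mem_cat => /orP[uu su|/ueE[i [_ li ->]]]; last first.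
    by rewrite /nst !ltnS leqNgt li.
  have := us0s u uu; rewrite !inE => /or3P[/eqP E|/eqP E|uT].
  - by rewrite E in su.
  - by rewrite E in su.
  exact: H1.
- exists k => // i li ki; rewrite mem_cat negb_or; apply/andP; split.
    apply/negP=> /us0s; rewrite !inE /= => uT.
    by have := nT i.+2; rewrite uT /nst !ltnS => /(_ li).
  apply/negP=> /ueE[i' [iI _ [E]]]; move: (H2 i' iI); by rewrite -E ki.
Qed.

(** All runs have to be bounded, not just one, since Constructor chooses among the applicable
    entries. *)
Fixpoint doomed (W : seq wentry) (Q : seq rentry) (t : nat) (c : conf) : Prop :=
  forall c', qstep W Q c c' -> if t is t'.+1 then doomed W Q t' c' else False.

Lemma doomed_step W Q t c c' : doomed W Q t c -> qstep W Q c c' ->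
  exists2 t', t = t'.+1 & doomed W Q t' c'.
Proof. by case: t => [|t] /= H st; [case: (H _ st)|exists t => //; apply: H]. Qed.

Definition word (lt : nat -> nat) (i J : nat) : seq nat := [seq lt j | j <- iota i (J.+1 - i)].

Lemma word_cons lt i J : i <= J -> word lt i J = lt i :: word lt i.+1 J.
Proof. by move=> le; rewrite /word subSn // subSS. Qed.

Lemma word_rcons lt lt' i J : i <= J -> (forall j, j <= J -> lt' j = lt j) ->
  word lt' i J.+1 = rcons (word lt i J) (lt' J.+1).
Proof.
move=> le E; rewrite /word subSn ?leqW // -addn1 iotaD map_cat cats1 /=.
have -> : i + (J.+1 - i) = J.+1 by lia.
congr rcons; apply/eq_in_map=> j; rewrite mem_iota => /andP[_ lj].
by apply: E; lia.
Qed.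

Lemma modS3 j : (j %% 3).+1 %% 3 = j.+1 %% 3.
Proof. by rewrite -addn1 modnDml addn1. Qed.

(** * Phases of the play and the count of remaining moves *)

Definition tok (k : nat) (lt : nat -> nat) (y l : nat) : Prop := l = lab [:: k; lt y; y %% 3].
Definition builder (lt : nat -> nat) (J y l : nat) : Prop := y = J /\ tok 8 lt y l.
(** The flag says that the builder has yet to move; read as a number it is the move still to be
    counted. *)
Definition going (lt : nat -> nat) (J : nat) (c : bool) (y l : nat) : Prop :=
  if c then y = J /\ tok 9 lt y l else y = J.+1 /\ l = FF (y %% 3).

(* The last argument bounds the number of moves that Constructor can still make. *)
Variant phase (W : seq wentry) (Q : seq rentry) (lt : nat -> nat) (s : seq nat)
    (J h yr lr y1 l1 y2 l2 : nat) : nat -> Prop :=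
  | PReady t of h = READY & yr <= J & tok 10 lt yr lr &
      builder lt J y1 l1 & builder lt J y2 l2 & doomed W Q t (s, word lt yr J) :
      phase W Q lt s J h yr lr y1 l1 y2 l2 (9 * t)
  | PWrite b k t of h = WR b k & k < 3 & yr <= J & tok 10 lt yr lr &
      builder lt J y1 l1 & builder lt J y2 l2 & doomed W Q t (s, rcons (word lt yr J) b) :
      phase W Q lt s J h yr lr y1 l1 y2 l2 (9 * t + (6 - k))
  | PGo b (c1 c2 : bool) t of h = GO b & yr <= J & tok 10 lt yr lr &
      going lt J c1 y1 l1 & going lt J c2 y2 l2 & doomed W Q t (s, rcons (word lt yr J) b) :
      phase W Q lt s J h yr lr y1 l1 y2 l2 (9 * t + 1 + c1 + c2)
  | PRead b t of h = RGO b & yr <= J & tok 11 lt yr lr &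
      builder lt J y1 l1 & builder lt J y2 l2 & doomed W Q t (s, rcons (word lt yr.+1 J) b) :
      phase W Q lt s J h yr lr y1 l1 y2 l2 (9 * t + 8)
  | PReadDone b t of h = RGO b & yr <= J & tok 9 lt yr lr &
      builder lt J y1 l1 & builder lt J y2 l2 & doomed W Q t (s, rcons (word lt yr J) b) :
      phase W Q lt s J h yr lr y1 l1 y2 l2 (9 * t + 7)
  | PStuck b of h = RGO b & lr = FF (yr %% 3) & builder lt J y1 l1 & builder lt J y2 l2 :
      phase W Q lt s J h yr lr y1 l1 y2 l2 0.

Definition losing (W : seq wentry) (Q : seq rentry) (n : nat) (G : network) : Prop :=
  exists lay lt s h r b1 b2 J, core G lay lt s h [:: r; b1; b2] J /\
    phase W Q lt s J h (lay r) (label G r) (lay b1) (label G b1) (lay b2) (label G b2) n.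

Lemma losing_del W Q n G v : losing W Q n G -> is_weak G v -> losing W Q n (del_node G v).
Proof.
case=> lay [lt [s [h [r [b1 [b2 [J [C ph]]]]]]]] wv.
by exists lay, lt, s, h, r, b1, b2, J; split=> //; apply: core_del.
Qed.

Section RuleCases.
Variables (W : seq wentry) (Q : seq rentry) (G G' : network) (lay lt : nat -> nat).
Variables (s : seq nat) (h r b1 b2 J n : nat).
Hypothesis C : core G lay lt s h [:: r; b1; b2] J.
Hypothesis ph :
  phase W Q lt s J h (lay r) (label G r) (lay b1) (label G b1) (lay b2) (label G b2) n.

Let layw j0 t : t \in [:: r; b1; b2] -> (if t == nV G then j0 else lay t) = lay t.
Proof. by move=> /(core_T C)/and3P[_ lt_t _]; rewrite (ltn_eqF lt_t). Qed.

Let tok_ne t u : t \in [:: r; b1; b2] -> u < 2 -> (t == u) = false.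
Proof.
by move=> /(core_T C)/and3P[+ _ _] lu; rewrite /nst => st; apply/eqP; lia.
Qed.

Let ne01 t : t \in [:: r; b1; b2] -> ((t == 0) = false) * ((t == 1) = false).
Proof. by move=> tT; rewrite !tok_ne. Qed.

Let keep L c us0 post0 t : nth 0 L =1 nth 0 (relabel_list (rcons (nlab G) c) us0 post0) ->
  t \in [:: r; b1; b2] -> t \notin us0 -> nth 0 L t = label G t.
Proof.
move=> EL /(core_T C)/and3P[_ lt_t _] tu.
by rewrite EL nth_relabel_notin // nth_rcons (core_size C) lt_t.
Qed.

Let rT : r \in [:: r; b1; b2]. Proof. by rewrite !inE eqxx. Qed.
Let b1T : b1 \in [:: r; b1; b2]. Proof. by rewrite !inE eqxx orbT. Qed.
Let b2T : b2 \in [:: r; b1; b2]. Proof. by rewrite !inE eqxx !orbT. Qed.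
Let rb1 : (r == b1) = false.
Proof. by have := core_uniq C; rewrite /= !inE negb_or -!andbA => /and3P[/negbTE]. Qed.
Let rb2 : (r == b2) = false.
Proof. by have := core_uniq C; rewrite /= !inE negb_or -!andbA => /and3P[_ /negbTE]. Qed.
Let b12 : (b1 == b2) = false.
Proof. by have := core_uniq C; rewrite /= !inE negb_or -!andbA => /and3P[_ _ /andP[/negbTE]]. Qed.

(** The pattern of all the creation cases: tags identify the nodes used, the hub label identifies
    the phase, and [lab_inv] refutes the other phases. *)
Lemma losing_startw e : e \in W -> apply_rule (startw e) G G' ->
  exists2 n', n' < n & losing W Q n' G'.
Proof.
case: e => [[s0 b] s'] eW /(apply_createP C)/(_ erefl)
  [[|u1 [|u2 [|u3 us0]]] [ue [L [[un sub] // [e1 e2] E1 sL [-> EL]]]]].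
have u1S : u1 \in nS G by apply: sub; rewrite mem_head.
have [] := core_hub_uniq C u1S; rewrite e1 ?ltag_lab // => ? hE; subst u1.
have u2S : u2 \in nS G by apply: sub; rewrite !inE eqxx orbT.
have [? ?] := core_kap_uniq C u2S e2; subst u2 s0.
case: ph => [t E le tr t1 t2 dm|b' k t E|b' c1 c2 t E|b' t E|b' t E|b' E];
  rewrite -?hE in E; lab_inv.
have [t' -> {}dm] := doomed_step dm (QW Q _ eW).
(* Six rules remain before the next start: three cells, two builder moves and an arrival. The two
   reader rules of a read step are saved. *)
exists (9 * t' + (6 - 0)); first by clear; lia.
have kp v : v \in [:: r; b1; b2] -> nth 0 L v = label G v.
  by move=> vT; apply: (keep EL) => //; rewrite !inE !(ne01 vT).
exists (fun v => if v == nV G then 0 else lay v), lt, s', (WR b 0), r, b1, b2, J; split.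
  apply: (core_create_rule C sL sub EL _ E1); rewrite ?ltag_lab //; last by left.
  - by move=> x; rewrite mem_cat !inE => /orP[] ->; rewrite ?orbT.
  - by rewrite EL /relabel_list /= !nth_set_nth /= ?nth_set_nth.
  - by rewrite EL /relabel_list /= !nth_set_nth /= ?nth_set_nth.
  by move=> v vT; rewrite !inE !(ne01 vT).
rewrite !layw // /label /= !kp //; exact: PWrite.
Qed.

Lemma losing_startr e mu : e \in Q -> apply_rule (startr e mu) G G' ->
  exists2 n', n' < n & losing W Q n' G'.
Proof.
case: e => [[[s0 a] b] s'] eQ /(apply_createP C)/(_ erefl)
  [[|u1 [|u2 [|u3 [|u4 us0]]]] [ue [L [[un sub] // [e1 e2 e3] E1 sL [-> EL]]]]].
have u1S : u1 \in nS G by apply: sub; rewrite mem_head.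
have [] := core_hub_uniq C u1S; rewrite e1 ?ltag_lab // => ? hE; subst u1.
have u2S : u2 \in nS G by apply: sub; rewrite !inE eqxx orbT.
have [? ?] := core_kap_uniq C u2S e2; subst u2 s0.
have u3S : u3 \in nS G by apply: sub; rewrite !inE eqxx !orbT.
have u3T := core_tok_uniq C u3S e3 erefl.
case: ph => [t E le tr [t1 t1'] [t2 t2'] dm|b' k t E|b' c1 c2 t E|b' t E|b' t E|b' E];
  rewrite -?hE in E; lab_inv.
have ? : u3 = r.
  move: u3T e3; rewrite !inE => /or3P[] /eqP-> //; rewrite ?t1' ?t2' => E0; lab_inv.
subst u3; rewrite tr in e3; lab_inv; subst a mu.
rewrite word_cons // in dm.
have [t' -> {}dm] := doomed_step dm (QR W _ eQ).
exists (9 * t' + 8); first by clear; lia.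
have kp v : v \in [:: r; b1; b2] -> v != r -> nth 0 L v = label G v.
  by move=> vT vr; apply: (keep EL) => //; rewrite !inE !(ne01 vT) //= (negbTE vr).
have Lr : nth 0 L r = GG (lt (lay r)) (lay r %% 3).
  by rewrite EL /relabel_list /= !nth_set_nth /= eqxx.
exists (fun v => if v == nV G then 0 else lay v), lt, s', (RGO b), r, b1, b2, J; split.
  apply: (core_create_rule C sL sub EL _ E1); rewrite ?ltag_lab //; last by left.
  - by move=> x; rewrite mem_cat !inE => /or3P[] ->; rewrite ?orbT.
  - by rewrite EL /relabel_list /= !nth_set_nth /= ?nth_set_nth /= eq_sym tok_ne ?nth_set_nth.
  - by rewrite EL /relabel_list /= !nth_set_nth /= ?nth_set_nth /= eq_sym tok_ne ?nth_set_nth.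
  move=> v vT; rewrite !inE !(ne01 vT) //= => /eqP->; split=> //.
  by exists 11.
rewrite !layw // /label /= Lr !kp // 1?eq_sym ?rb1 ?rb2 //; exact: PRead.
Qed.

Lemma losing_rarrive b a mu : apply_rule (rarrive b a mu) G G' ->
  exists2 n', n' < n & losing W Q n' G'.
Proof.
case/(apply_createP C)/(_ erefl) =>
  [[|u1 [|u3 [|u4 us0]]] [ue [L [[un sub] // [e1 e3] E1 sL [-> EL]]]]].
have u1S : u1 \in nS G by apply: sub; rewrite mem_head.
have [] := core_hub_uniq C u1S; rewrite e1 ?ltag_lab // => ? hE; subst u1.
have u3S : u3 \in nS G by apply: sub; rewrite !inE eqxx !orbT.
have u3T := core_tok_uniq C u3S e3 erefl.
case: ph => [t E|b' k t E|b' c1 c2 t E|b' t E le tr [t1 t1'] [t2 t2'] dm|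
   b' t E le tr [t1 t1'] [t2 t2'] dm|b' E tr [t1 t1'] [t2 t2']];
  rewrite -?hE in E; lab_inv.
- by move: u3T e3; rewrite !inE => /or3P[] /eqP->; rewrite ?t1' ?t2' ?tr => E0; lab_inv.
- have ? : u3 = r.
    move: u3T e3; rewrite !inE => /or3P[] /eqP-> //; rewrite ?t1' ?t2' => E0; lab_inv.
  subst u3 b'; rewrite tr in e3; lab_inv; subst a mu.
  exists (9 * t + (6 - 0)); first by clear; lia.
  have kp v : v \in [:: r; b1; b2] -> v != r -> nth 0 L v = label G v.
    by move=> vT vr; apply: (keep EL) => //; rewrite !inE !(ne01 vT) //= (negbTE vr).
  have Lr : nth 0 L r = RL (lt (lay r)) (lay r %% 3).
    by rewrite EL /relabel_list /= !nth_set_nth /= eqxx.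
  exists (fun v => if v == nV G then 0 else lay v), lt, s, (WR b 0), r, b1, b2, J; split.
    apply: (core_create_rule C sL sub EL _ E1); rewrite ?ltag_lab //; last by left.
    + by move=> x; rewrite mem_cat !inE => /orP[] ->; rewrite ?orbT.
    + rewrite EL nth_relabel_notin ?nth_rcons ?(core_size C) ?(leq_trans _ (core_V C)) //.
        exact: core_kap C.
      by rewrite !inE /= eq_sym tok_ne.
    + by rewrite EL /relabel_list /= !nth_set_nth /= ?nth_set_nth /= eq_sym tok_ne ?nth_set_nth.
    move=> v vT; rewrite !inE !(ne01 vT) //= => /eqP->; split=> //.
    by exists 10.
  rewrite !layw // /label /= Lr !kp // 1?eq_sym ?rb1 ?rb2 //; exact: PWrite.
by move: u3T e3; rewrite !inE => /or3P[] /eqP->; rewrite ?t1' ?t2' ?tr => E0; lab_inv.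
Qed.

Let pair_cases u2 u3 l : u2 \in [:: r; b1; b2] -> u3 \in [:: r; b1; b2] ->
  u2 != u3 -> label G u2 = l -> label G u3 = l -> label G r <> l ->
  [/\ label G b1 = l, label G b2 = l &
      (u2 = b1 /\ u3 = b2) \/ (u2 = b2 /\ u3 = b1)].
Proof.
rewrite !inE => /or3P[] /eqP-> /or3P[] /eqP->; rewrite ?eqxx // => _ e1 e2 e3;
  try by case: e3.
- by split=> //; left.
by split=> //; right.
Qed.

Lemma losing_cell b k a mu c : k < 3 -> c < 8 -> apply_rule (cellr b k a mu c) G G' ->
  exists2 n', n' < n & losing W Q n' G'.
Proof.
move=> k3 c8.
(* The hub label [h'] and the tag [p] are kept abstract, so that the third cell is treated together
   with the first two until the count of moves is needed. *)
have [h' [p [E Eh]]] : exists h' p,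
    (if k < 2 then [:: WR b k.+1; NN a mu; NN a mu] else [:: GO b; MM a mu; MM a mu])
      = [:: h'; lab [:: p; a; mu]; lab [:: p; a; mu]] /\
    (if k < 2 then h' = WR b k.+1 /\ p = 8 else h' = GO b /\ p = 9).
  by case: ifP => _; [exists (WR b k.+1), 8|exists (GO b), 9].
rewrite /cellr E => /(apply_createP C)/(_ erefl)
  [[|u1 [|u2 [|u3 [|u4 us0]]]] [ue [L [[un sub] // [e1 e2 e3] E1 sL [-> EL]]]]].
have u1S : u1 \in nS G by apply: sub; rewrite mem_head.
have [] := core_hub_uniq C u1S; rewrite e1 ?ltag_lab // => ? hE; subst u1.
have u2S : u2 \in nS G by apply: sub; rewrite !inE eqxx orbT.
have u3S : u3 \in nS G by apply: sub; rewrite !inE eqxx !orbT.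
have u2T := core_tok_uniq C u2S e2 erefl.
have u3T := core_tok_uniq C u3S e3 erefl.
have u23 : u2 != u3 by move: un; rewrite /= !inE => /and3P[].
case: ph => [t E0|b' k' t E0 kk le tr [t1 t1'] [t2 t2'] dm|b' c1 c2 t E0|b' t E0|b' t E0|b' E0];
  rewrite -?hE in E0; lab_inv.
subst b' k'.
have [|lb1 lb2 u23E] := pair_cases u2T u3T u23 e2 e3.
  by rewrite tr => E0; lab_inv.
have vu v : v \in [:: r; b1; b2] -> (v \in [:: 1; u2; u3]) = (v != r).
  rewrite !inE => /or3P[] /eqP->; rewrite !(ne01 rT, ne01 b1T, ne01 b2T);
    case: u23E => -[-> ->]; rewrite ?eqxx ?rb1 ?rb2 // 1?eq_sym ?rb1 ?rb2 ?b12 ?orbT //;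
    by rewrite eq_sym ?rb1 ?rb2 ?orbT.
have Lr : nth 0 L r = label G r by apply: (keep EL) => //; rewrite vu ?eqxx.
have Lb v : v \in [:: r; b1; b2] -> v != r -> nth 0 L v = lab [:: p; a; mu].
  move=> vT vr; have := vu v vT; rewrite vr !inE (ne01 vT) /= => /orP[] /eqP->.
    by rewrite EL /relabel_list /= !nth_set_nth /= nth_set_nth /= eqxx; case: ifP.
  by rewrite EL /relabel_list /= !nth_set_nth /= eqxx.
have b1r : b1 != r by rewrite eq_sym rb1.
have b2r : b2 != r by rewrite eq_sym rb2.
rewrite t1' t1 in lb1; lab_inv; subst a mu.
have layb v : v \in [:: r; b1; b2] -> v != r -> lay v = J.
  by rewrite !inE => /or3P[] /eqP->; rewrite ?eqxx.
have h'T : 0 < ltag h' < 5.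
  by move: Eh; case: ifP => _ [-> _]; rewrite ltag_lab.
have p811 : p \in [:: 8; 9; 10; 11] by move: Eh; case: ifP => _ [_ ->].
have C' : core (add_node G ([:: 1; u2; u3] ++ ue) L)
    (fun v => if v == nV G then J.+1 else lay v) lt s h' [:: r; b1; b2] J.
  apply: (core_create_rule C sL sub EL _ E1) => //.
  - move=> x; rewrite mem_cat !inE => /or3P[/eqP->|/eqP->|/eqP->]; rewrite ?orbT //.
      by move: u2T; rewrite !inE => ->; rewrite orbT.
    by move: u3T; rewrite !inE => ->; rewrite orbT.
  - rewrite EL nth_relabel_notin ?nth_rcons ?(core_size C) ?(leq_trans _ (core_V C)) //.
      exact: core_kap C.
    by rewrite !inE /= eq_sym tok_ne // eq_sym tok_ne.
  - rewrite EL /relabel_list /= !nth_set_nth /= nth_set_nth /= nth_set_nth /=.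
    by rewrite eq_sym tok_ne // eq_sym tok_ne.
  - move=> v vT; rewrite vu // => vr; rewrite layb //; split=> //.
    by exists p; rewrite // Lb.
  - right; split; first by rewrite modS3.
      by move=> v vT; rewrite vu // => vr; rewrite layb.
    by exists c => // i; rewrite mem_filter => /andP[].
have tr' : tok 10 lt (lay r) (nth 0 L r) by rewrite Lr.
move: Eh; case: ifP => k2 [? ?]; subst h' p.
  exists (9 * t + (6 - k.+1)); first by clear -k3; lia.
  exists (fun v => if v == nV G then J.+1 else lay v), lt, s, (WR b k.+1), r, b1, b2, J.
  split=> //; rewrite !layw // /label /=.
  by apply: PWrite => //; split; rewrite ?Lb // layb.
exists (9 * t + 1 + true + true); first by clear -k3; lia.
exists (fun v => if v == nV G then J.+1 else lay v), lt, s, (GO b), r, b1, b2, J.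
split=> //; rewrite !layw // /label /=.
by apply: (@PGo _ _ _ _ _ _ _ _ _ _ _ _ b true true) => //; split; rewrite ?Lb // layb.
Qed.

(** Only here does the queue grow. Both builders must have moved, as one still on layer [J] has tag
    9 and not the label [FF mu]. So layer [J.+1] receives a single letter, and [lt] may be redefined
    there because no lettered cell lies beyond [J]. *)
Lemma losing_arrive b mu : apply_rule (arrive b mu) G G' ->
  exists2 n', n' < n & losing W Q n' G'.
Proof.
case/(apply_createP C)/(_ erefl) =>
  [[|u1 [|u2 [|u3 [|u4 us0]]]] [ue [L [[un sub] // [e1 e2 e3] E1 sL [-> EL]]]]].
have u1S : u1 \in nS G by apply: sub; rewrite mem_head.
have [] := core_hub_uniq C u1S; rewrite e1 ?ltag_lab // => ? hE; subst u1.
have u2S : u2 \in nS G by apply: sub; rewrite !inE eqxx orbT.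
have u3S : u3 \in nS G by apply: sub; rewrite !inE eqxx !orbT.
have u2T := core_tok_uniq C u2S e2 erefl.
have u3T := core_tok_uniq C u3S e3 erefl.
have u23 : u2 != u3 by move: un; rewrite /= !inE => /and3P[].
case: ph => [t E0|b' k' t E0|b' c1 c2 t E0 le tr t1 t2 dm|b' t E0|b' t E0|b' E0];
  rewrite -?hE in E0; lab_inv.
subst b'.
have [|lb1 lb2 u23E] := pair_cases u2T u3T u23 e2 e3.
  by rewrite tr => E0; lab_inv.
have [y1 E1'] : lay b1 = J.+1 /\ label G b1 = FF (lay b1 %% 3).
  by case: c1 t1 => [[_ t1]|//]; rewrite t1 in lb1; lab_inv.
have [y2 E2'] : lay b2 = J.+1 /\ label G b2 = FF (lay b2 %% 3).
  by case: c2 t2 => [[_ t2]|//]; rewrite t2 in lb2; lab_inv.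
have vu v : v \in [:: r; b1; b2] -> (v \in [:: 1; u2; u3]) = (v != r).
  rewrite !inE => /or3P[] /eqP->; rewrite !(ne01 rT, ne01 b1T, ne01 b2T);
    case: u23E => -[-> ->]; rewrite ?eqxx ?rb1 ?rb2 // 1?eq_sym ?rb1 ?rb2 ?b12 ?orbT //;
    by rewrite eq_sym ?rb1 ?rb2 ?orbT.
have Lr : nth 0 L r = label G r by apply: (keep EL) => //; rewrite vu ?eqxx.
have Lb v : v \in [:: r; b1; b2] -> v != r -> nth 0 L v = NN b mu.
  move=> vT vr; have := vu v vT; rewrite vr !inE (ne01 vT) /= => /orP[] /eqP->.
    by rewrite EL /relabel_list /= !nth_set_nth /= nth_set_nth /= eqxx; case: ifP.
  by rewrite EL /relabel_list /= !nth_set_nth /= eqxx.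
have b1r : b1 != r by rewrite eq_sym rb1.
have b2r : b2 != r by rewrite eq_sym rb2.
rewrite E1' y1 in lb1; lab_inv; subst mu.
have layb v : v \in [:: r; b1; b2] -> v != r -> lay v = J.+1.
  by rewrite !inE => /or3P[] /eqP->; rewrite ?eqxx.
pose lt' j := if j == J.+1 then b else lt j.
have ltE j : j <= J -> lt' j = lt j by move=> lj; rewrite /lt' (ltn_eqF _).
have ltJ : lt' J.+1 = b by rewrite /lt' eqxx.
have C1 := core_extend C (leqnSn J) ltE.
exists (9 * t); first by clear; lia.
exists (fun v => if v == nV G then 0 else lay v), lt', s, READY, r, b1, b2, J.+1; split.
  apply: (core_create_rule C1 sL sub EL _ E1); rewrite ?ltag_lab //; last by left.
  - move=> x; rewrite mem_cat !inE => /or3P[/eqP->|/eqP->|/eqP->]; rewrite ?orbT //.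
      by move: u2T; rewrite !inE => ->; rewrite orbT.
    by move: u3T; rewrite !inE => ->; rewrite orbT.
  - rewrite EL nth_relabel_notin ?nth_rcons ?(core_size C) ?(leq_trans _ (core_V C)) //.
      exact: core_kap C.
    by rewrite !inE /= eq_sym tok_ne // eq_sym tok_ne.
  - rewrite EL /relabel_list /= !nth_set_nth /= nth_set_nth /= nth_set_nth /=.
    by rewrite eq_sym tok_ne // eq_sym tok_ne.
  move=> v vT; rewrite vu // => vr; rewrite layb //; split=> //.
  by exists 8; rewrite // Lb // ltJ.
rewrite !layw // /label /=; apply: PReady => //.
- exact: leqW.
- by rewrite Lr /tok ltE.
- by split; rewrite ?layb // /tok Lb // ltJ.
- by split; rewrite ?layb // /tok Lb // ltJ.
by rewrite (word_rcons le ltE) ltJ.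
Qed.

Let tok_cases u : u \in [:: r; b1; b2] -> [\/ u = r, u = b1 | u = b2].
Proof.
by rewrite !inE => /or3P[] /eqP->; [constructor 1|constructor 2|constructor 3].
Qed.

(** Apart from builders, the rule can catch the reader between its move and its arrival, when its
    cell still has tag 9. The reader then lands on a letterless cell and no rule applies any more:
    this is [PStuck], with bound 0. *)
Lemma losing_moveb a mu : apply_rule (moveb a mu) G G' ->
  exists2 n', n' < n & losing W Q n' G'.
Proof.
case=> u [v [[uS lu] [lv Lv] vS uv ->]].
have uT := core_tok_uniq C uS lu erefl.
have vX : label G v != XX by rewrite Lv; apply/eqP=> E; lab_inv.
have uX : label G u != XX by rewrite lu; apply/eqP=> E; lab_inv.
have C' := core_move C uT lv vS vX.
have ust : nst <= u by have /and3P[] := core_T C uT.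
have vst : nst <= v by move: vS; rewrite /isstrong (core_S C) negb_or -leqNgt => /andP[].
have layv : label G u = lab [:: 9; lt (lay u); lay u %% 3] ->
    lay v = (lay u).+1 /\ label G v = FF (lay v %% 3).
  rewrite lu => E; lab_inv.
  have := core_cell C (introT andP (conj vst lv)); rewrite /cell_label (negbTE vX) /=.
  case/orP=> [/eqP E|/andP[_ E]]; last first.
    by move: E; rewrite orbF => /or4P[] /eqP E; rewrite Lv in E; lab_inv.
  split=> //; rewrite Lv in E; lab_inv; subst mu.
  (* Adjacency leaves the layers just above and just below that of [u]; their residues modulo 3
     differ, and the label of [v] selects the one above. *)
  have := core_lay C ust vst uv uX vX; lia.
have cases := tok_cases uT.
case: ph => [t E0 le tr [_ t1] [_ t2] _|b' k' t E0 _ le tr [_ t1] [_ t2] _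
  |b' c1 c2 t E0 le tr t1 t2 dm
  |b' t E0 _ tr [_ t1] [_ t2] _|b' t E0 le tr t1 t2 dm|b' E0 tr [_ t1] [_ t2]].
- by case: cases => ?; subst u; rewrite lu in tr t1 t2; unfold tok in *; lab_inv.
- by case: cases => ?; subst u; rewrite lu in tr t1 t2; unfold tok in *; lab_inv.
- case: cases => ?; subst u.
  + by rewrite lu in tr; unfold tok in *; lab_inv.
  + rewrite /= eqxx rb1 [b2 == b1]eq_sym b12 in C'.
    case: c1 t1 => [[y1 t1]|[y1 t1]]; last by rewrite lu in t1; lab_inv.
    have [yv lv'] := layv t1.
    exists (9 * t + 1 + false + c2); first by clear; lia.
    exists lay, lt, s, h, r, v, b2, J; split=> //.
    by apply: (@PGo _ _ _ _ _ _ _ _ _ _ _ _ b' false c2) => //; split=> //; rewrite yv y1.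
  + rewrite /= eqxx rb2 b12 in C'.
    case: c2 t2 => [[y2 t2]|[y2 t2]]; last by rewrite lu in t2; lab_inv.
    have [yv lv'] := layv t2.
    exists (9 * t + 1 + c1 + false); first by clear; lia.
    exists lay, lt, s, h, r, b1, v, J; split=> //.
    by apply: (@PGo _ _ _ _ _ _ _ _ _ _ _ _ b' c1 false) => //; split=> //; rewrite yv y2.
- by case: cases => ?; subst u; rewrite lu in tr t1 t2; unfold tok in *; lab_inv.
- case: cases => ?; subst u; last 2 first.
  + by case: t1 => _ t1; rewrite lu in t1; unfold tok in *; lab_inv.
  + by case: t2 => _ t2; rewrite lu in t2; unfold tok in *; lab_inv.
  rewrite /= eqxx [b1 == r]eq_sym [b2 == r]eq_sym rb1 rb2 in C'.
  have [yv lv'] := layv tr.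
  exists 0; first by lia.
  by exists lay, lt, s, h, v, b1, b2, J; split=> //; apply: (@PStuck _ _ _ _ _ _ _ _ _ _ _ _ b').
by case: cases => ?; subst u; rewrite lu in tr t1 t2; unfold tok in *; lab_inv.
Qed.

(** The entered cell shows a letter, so [cell_label] puts it at a layer at most [J]: the reader
    cannot overtake the builders. The residue makes it the next layer, so exactly one letter is
    consumed. *)
Lemma losing_mover a a' mu : apply_rule (mover a a' mu) G G' ->
  exists2 n', n' < n & losing W Q n' G'.
Proof.
case=> u [v [[uS lu] [lv Lv] vS uv ->]].
have uT := core_tok_uniq C uS lu erefl.
have vX : label G v != XX by rewrite Lv; apply/eqP=> E; lab_inv.
have uX : label G u != XX by rewrite lu; apply/eqP=> E; lab_inv.
have C' := core_move C uT lv vS vX.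
have ust : nst <= u by have /and3P[] := core_T C uT.
have vst : nst <= v by move: vS; rewrite /isstrong (core_S C) negb_or -leqNgt => /andP[].
have cases := tok_cases uT.
case: ph => [t E0 le tr [_ t1] [_ t2] _|b' k' t E0 _ le tr [_ t1] [_ t2] _
  |b' c1 c2 t E0 le tr t1 t2 dm
  |b' t E0 le tr t1 t2 dm|b' t E0 le tr [_ t1] [_ t2] dm|b' E0 tr [_ t1] [_ t2]].
- by case: cases => ?; subst u; rewrite lu in tr t1 t2; unfold tok in *; lab_inv.
- by case: cases => ?; subst u; rewrite lu in tr t1 t2; unfold tok in *; lab_inv.
- case: cases => ?; subst u.
  + by rewrite lu in tr; unfold tok in *; lab_inv.
  + by case: c1 t1 => [] [_]; rewrite lu /tok => E1; lab_inv.
  + by case: c2 t2 => [] [_]; rewrite lu /tok => E1; lab_inv.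
- case: cases => ?; subst u; last 2 first.
  + by case: t1 => _ t1; rewrite lu in t1; unfold tok in *; lab_inv.
  + by case: t2 => _ t2; rewrite lu in t2; unfold tok in *; lab_inv.
  rewrite /= eqxx [b1 == r]eq_sym [b2 == r]eq_sym rb1 rb2 in C'.
  rewrite /tok lu in tr; lab_inv; subst a mu.
  have := core_cell C (introT andP (conj vst lv)); rewrite /cell_label (negbTE vX) /= orbF.
  case/orP=> [/eqP E|/andP[leJ E]]; first by rewrite Lv in E; lab_inv.
  have Ev : label G v = lab [:: 9; lt (lay v); lay v %% 3].
    by move: E => /or4P[] /eqP E //; rewrite Lv in E; lab_inv.
  have yv : lay v = (lay r).+1.
    move: (Ev); rewrite Lv => E1; lab_inv.
    have := core_lay C ust vst uv uX vX; lia.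
  exists (9 * t + 7); first by clear; lia.
  exists lay, lt, s, h, v, b1, b2, J; split=> //.
  by apply: (@PReadDone _ _ _ _ _ _ _ _ _ _ _ _ b') => //; rewrite yv.
- by case: cases => ?; subst u; rewrite lu in tr t1 t2; unfold tok in *; lab_inv.
by case: cases => ?; subst u; rewrite lu in tr t1 t2; unfold tok in *; lab_inv.
Qed.
End RuleCases.

Lemma losing_rule B W Q n G G' ru : losing W Q n G -> ru \in game_rules B W Q ->
  apply_rule ru G G' -> exists2 n', n' < n & losing W Q n' G'.
Proof.
case=> lay [lt [s [h [r [b1 [b2 [J [C ph]]]]]]]] /game_rulesP[].
- by move=> e he; apply: losing_startw C ph _ he.
- by move=> e mu he _; apply: losing_startr C ph _ _ he.
- by move=> b a mu _ _ _; apply: losing_rarrive C ph _ _ _.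
- by move=> b k a mu c _ h1 _ _ h2; apply: losing_cell C ph _ _ _ _ _ h1 h2.
- by move=> b mu _ _; apply: losing_arrive C ph _ _.
- by move=> a mu _ _; apply: losing_moveb C ph _ _.
by move=> a a' mu _ _ _; apply: losing_mover C ph _ _ _.
Qed.

Lemma destructor_wins B W Q n G : losing W Q n G ->
  ~ constructor_wins_safety G (game_rules B W Q).
Proof.
apply: losing_invariant.
- exact: losing_del.
- by move=> {}n {}G G' ru; apply: losing_rule.
move=> {}n {}G [lay [lt [s [h [r [b1 [b2 [J [C _]]]]]]]]]; exact: core_stuck C.
Qed.

(** * Constructor wins when the queue machine runs forever *)

(** Edges that must be present, whereas [core] records edges that must be absent: the former serve
    Constructor, the latter Destructor. *)
Record web (G : network) (col : nat -> nat) : Prop := Web {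
  web_active : forall v, v \in nA G -> v < nV G;
  web_kap : adj G 0 1;
  web_hub : forall v, nst <= v < nV G -> adj G v 1;
  web_end : forall v i, nst <= v < nV G -> i < nend -> col v \notin tri i -> adj G v i.+2 }.

Lemma web_connected G lay lt s h T J col y : core G lay lt s h T J -> web G col ->
  uniq (map col T) -> y \in nA G -> nst <= y -> col y \notin map col T -> connected G.
Proof.
move=> C Wb un yA sy cy.
have inA u : u \in T -> u \in nA G.
  by move=> uT; apply: (core_SA C); rewrite (core_S C) uT orbT.
have h1 : 1 \in nA G by apply: (core_SA C); rewrite (core_S C).
have nend_cell i : i < nend ->
    exists t, [/\ t \in nA G, nst <= t < nV G & adj G t i.+2].
  move=> li; have [t tin ti] : exists2 t, t \in y :: T & col t \notin tri i.
    (* Otherwise four distinct colours would all lie in a triple, which has at most three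
       entries. *)
    apply/hasP; apply: contraT => /hasPn al.
    have sub : {subset map col (y :: T) <= tri i}.
      by move=> _ /mapP[t tin ->]; have := al t tin; rewrite negbK.
    have un' : uniq (map col (y :: T)) by rewrite /= cy.
    have := leq_trans (uniq_leq_size un' sub) (size_tri i).
    by rewrite size_map /= (core_size3 C).
  have [tA tst] : t \in nA G /\ nst <= t.
    move: tin; rewrite inE => /predU1P[->//|tT].
    by have /and3P[] := core_T C tT; split; rewrite ?inA.
  have tr : nst <= t < nV G by rewrite tst (web_active Wb).
  by exists t; split=> //; apply: (web_end Wb).
pose e x y := adj G x y && (y \in nA G).
have to1 u : u \in nA G -> exists p, path e u p && (last u p == 1).
  move=> uA; have uV := web_active Wb uA.
  have [su|] := leqP nst u.
    by exists [:: 1]; rewrite /= /e (web_hub Wb) ?su ?h1.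
  case: u uA uV => [|[|i]] uA uV lu.
  - by exists [:: 1]; rewrite /= /e (web_kap Wb) h1.
  - by exists [::].
  have [t [tA tr ti]] := nend_cell i lu.
  by exists [:: t; 1]; rewrite /= /e adjC ti tA (web_hub Wb) // h1.
have from1 u : u \in nA G -> exists p, path e 1 p && (last 1 p == u).
  move=> uA; have uV := web_active Wb uA.
  have [su|] := leqP nst u.
    by exists [:: u]; rewrite /= /e adjC (web_hub Wb) ?su ?uA /=.
  case: u uA uV => [|[|i]] uA uV lu.
  - by exists [:: 0]; rewrite /= /e adjC (web_kap Wb) uA.
  - by exists [::].
  have [t [tA tr ti]] := nend_cell i lu.
  by exists [:: t; i.+2]; rewrite /= /e [adj G 1 t]adjC (web_hub Wb) // tA ti uA /=.
move=> u v /to1[p /andP[pp /eqP lp]] /from1[q /andP[pq lq]].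
by exists (p ++ q); rewrite cat_path last_cat lp pp pq.
Qed.

Record ext (G : network) (lay col : nat -> nat) (G' : network) (lay' col' : nat -> nat) :
    Prop := Ext {
  ext_V : nV G <= nV G';
  ext_lay : forall v, v < nV G -> lay' v = lay v;
  ext_col : forall v, v < nV G -> col' v = col v;
  ext_adj : forall u v, adj G u v -> adj G' u v }.

Lemma ext_refl G G' lay col : nV G = nV G' -> nE G = nE G' -> ext G lay col G' lay col.
Proof. by move=> eqV eqE; split; rewrite ?eqV //; move=> u v; rewrite /adj eqE. Qed.

Lemma nth_relabel_in l us p : uniq us -> size us = size p ->
  map (nth 0 (relabel_list l us p)) us = p.
Proof.
elim: us p l => [|u us IH] [|a p] l //= /andP[uus un] [sz].
rewrite /relabel_list /= -/(relabel_list _ us p) nth_relabel_notin // nth_set_nth /= eqxx.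
by congr cons; apply: IH.
Qed.

Lemma create_exists G lay lt s h T J us0 I pre0 post0 c :
  core G lay lt s h T J -> {subset us0 <= [:: 0; 1] ++ T} -> uniq us0 ->
  map (label G) us0 = pre0 -> size pre0 = size post0 ->
  uniq I -> {in I, forall i, i < nend} ->
  exists L, [/\ apply_rule (Create false (pre0 ++ [seq EE i | i <- I]) c
                  (post0 ++ [seq EE i | i <- I])) G
                  (add_node G (us0 ++ [seq i.+2 | i <- I]) L),
    size L = (nV G).+1, {subset us0 ++ [seq i.+2 | i <- I] <= nS G},
    map (label G) [seq i.+2 | i <- I] = [seq EE i | i <- I] &
    nth 0 L =1 nth 0 (relabel_list (rcons (nlab G) c) us0 post0)].
Proof.
move=> C sub un E0 sz uI nI; set ue := [seq i.+2 | i <- I].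
have E1 : map (label G) ue = [seq EE i | i <- I].
  by rewrite -map_comp; apply/eq_in_map=> i /nI /= li; rewrite (core_end C).
have sS : {subset us0 ++ ue <= nS G}.
  move=> u; rewrite mem_cat (core_S C) => /orP[/sub|/mapP[i /nI li ->]].
    by rewrite !inE => /or3P[/eqP->|/eqP->|->] //; rewrite orbT.
  by rewrite /nst !ltnS li.
have sV u : u \in nS G -> u < nV G.
  rewrite (core_S C) => /orP[/leq_trans->//|/(core_T C)/and3P[]//]; exact: core_V C.
have dis : ~~ has (mem us0) ue.
  apply/hasPn=> _ /mapP[i /nI li ->]; apply/negP=> /sub; rewrite !inE /=.
  by move=> /(core_T C)/and3P[]; rewrite /nst !ltnS leqNgt li.
have uu : uniq (us0 ++ ue).
  by rewrite cat_uniq un dis map_inj_uniq // => x y [].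
exists (relabel_list (rcons (nlab G) c) (us0 ++ ue) (post0 ++ [seq EE i | i <- I])); split=> //.
- exists (us0 ++ ue); split=> //.
  + by rewrite !size_cat sz.
  + by apply/allP=> u /sS.
  + by rewrite map_cat E0 E1.
- rewrite size_relabel_list size_rcons (core_size C) //.
  by apply/allP=> u /sS/sV/ltnW; rewrite ltnS.
move=> v; rewrite relabel_list_cat; last by rewrite -sz -E0 size_map.
rewrite -E1; set l1 := relabel_list _ us0 _.
rewrite (_ : map (label G) ue = map (nth 0 l1) ue) ?nth_relabel_same //.
apply/eq_in_map=> u uue; rewrite /l1 nth_relabel_notin; last exact: (hasPn dis).
by rewrite nth_rcons (core_size C) sV // sS // mem_cat uue orbT.
Qed.

(* [cw] is the colour of the new node. *)
Lemma constructor_create G lay lt s h T J col us1 I hl pre1 post1 c s' h' j0 cw :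
  core G lay lt s h T J -> web G col ->
  {subset us1 <= 0 :: T} -> uniq us1 -> map (label G) (1 :: us1) = hl :: pre1 ->
  size pre1 = size post1 -> uniq I -> {in I, forall i, i < nend} ->
  (forall i, i < nend -> cw \notin tri i -> i \in I) -> 0 < ltag h' < 5 ->
  (forall L, map L us1 = post1 -> (forall v, v < nV G -> v \notin 1 :: us1 -> L v = label G v) ->
     L 0 = Kap s' /\
     forall v, v \in T -> v \in us1 -> lay v <= J /\
       exists2 k, k \in [:: 8; 9; 10; 11] & L v = lab [:: k; lt (lay v); lay v %% 3]) ->
  (c = XX \/
   [/\ c = FF (j0 %% 3), forall v, v \in T -> v \in us1 -> j0 = (lay v).+1 &
       exists2 k, k < 8 & {in I, forall i, k \notin tri i}]) ->
  exists G', let lay' v := if v == nV G then j0 else lay v in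
    let col' v := if v == nV G then cw else col v in
   [/\ apply_rule (Create false ((hl :: pre1) ++ [seq EE i | i <- I]) c
                  ((h' :: post1) ++ [seq EE i | i <- I])) G G',
       core G' lay' lt s' h' T J /\ web G' col', ext G lay col G' lay' col',
       [/\ map (label G') us1 = post1,
           forall v, v < nV G -> v \notin 1 :: us1 -> label G' v = label G v,
           label G' (nV G) = c & forall u, u \in us1 -> adj G' (nV G) u]
     & [/\ nV G' = (nV G).+1, nA G' = nV G :: nA G & nS G' = nS G]].
Proof.
move=> C Wb sub1 un1 E0 sz uI nI cwI th LH cH.
have T1 : 1 \notin 0 :: T.
  by rewrite inE /=; apply/negP=> /(core_T C)/and3P[].
have un : uniq (1 :: us1) by rewrite /= un1 andbT; apply: contra T1 => /sub1.
have sub : {subset 1 :: us1 <= [:: 0; 1] ++ T}.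
  move=> u; rewrite inE => /predU1P[->|/sub1]; first by rewrite !inE eqxx orbT.
  by rewrite !inE => /orP[->|->]; rewrite ?orbT.
have sz0 : size (hl :: pre1) = size (h' :: post1) by rewrite /= sz.
have [L [ap sL sS E1 EL]] := create_exists c C sub un E0 sz0 uI nI.
have wV : nV G \notin 1 :: us1.
  apply/negP=> /sub; rewrite !inE; have := core_V C; rewrite /nst.
  by move=> h1 /or3P[/eqP|/eqP|/(core_T C)/and3P[_]]; lia.
have Lmap : map (nth 0 L) (1 :: us1) = h' :: post1.
  rewrite (eq_map EL); apply: nth_relabel_in => //.
  by rewrite -sz0 -E0 size_map.
have [L1 Lm] : nth 0 L 1 = h' /\ map (nth 0 L) us1 = post1 by case: Lmap.
have Lk v : v < nV G -> v \notin 1 :: us1 -> nth 0 L v = label G v.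
  by move=> lv vu; rewrite EL nth_relabel_notin // nth_rcons (core_size C) lv.
have Lw : nth 0 L (nV G) = c.
  by rewrite EL nth_relabel_notin // nth_rcons (core_size C) ltnn eqxx.
have [L0 LT] := LH _ Lm Lk.
have Tne v : v \in T -> v \in 1 :: us1 -> v \in us1.
  by rewrite inE => vT /predU1P[E|//]; case/negP: T1; rewrite -E inE vT orbT.
exists (add_node G ((1 :: us1) ++ [seq i.+2 | i <- I]) L); split=> //.
- split.
    apply: (core_create_rule C sL sS EL sub E1) => //.
    + by move=> v vT /(Tne _ vT); apply: LT.
    case: cH => [->|[-> H1 H2]]; [by left|right; split=> //].
    by move=> v vT /(Tne _ vT); apply: H1.
  split.
  + by move=> v; rewrite inE /= => /predU1P[->//|/(web_active Wb)/ltnW].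
  + by rewrite adj_add_node (web_kap Wb) !orbT.
  + move=> v /andP[sv /=]; rewrite ltnS leq_eqVlt => /predU1P[->|lv].
      by rewrite adj_add_node eqxx !inE.
    by rewrite adj_add_node (web_hub Wb) ?sv ?lv ?orbT.
  + move=> v i /andP[sv /=]; rewrite ltnS leq_eqVlt => /predU1P[->|lv] li.
      rewrite eqxx => /(cwI _ li) iI.
      by rewrite adj_add_node eqxx inE mem_cat (map_f _ iI) !orbT.
    rewrite (ltn_eqF lv) => vi.
    by rewrite adj_add_node (web_end Wb) ?sv ?lv ?orbT.
- split=> //= [v lv|v lv|u v a]; rewrite ?(ltn_eqF lv) //.
  by rewrite adj_add_node a !orbT.
split=> // u uu; rewrite adj_add_node eqxx mem_cat inE uu /=.
by rewrite orbT.
Qed.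

(** In contrast to [doomed], one run is enough, since Constructor selects the entries. *)
Definition forever (W : seq wentry) (Q : seq rentry) (c : conf) : Prop :=
  exists f : nat -> conf, f 0 = c /\ forall n, qstep W Q (f n) (f n.+1).

Lemma forever_step W Q c : forever W Q c -> exists2 c', qstep W Q c c' & forever W Q c'.
Proof.
case=> f [<- st]; exists (f 1); first exact: st.
by exists (fun n => f n.+1).
Qed.

(* [mn false l] and [mn true l] are the two cells of layer [l] on which the builders stood.
   The second one gives the reader the choice that she needs to avoid the colour of the
   weak node that Destructor left over. *)
Record ladder (G : network) (lay lt col : nat -> nat) (mn : bool -> nat -> nat) (i J : nat) :
    Prop := Ladder {
  ladder_cell : forall a l, i <= l <= J ->
    [/\ nst <= mn a l, mn a l < nV G, lay (mn a l) = l & col (mn a l) < 8];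
  ladder_label : forall a l, i < l < J -> label G (mn a l) = MM (lt l) (l %% 3);
  ladder_col : forall l, i <= l <= J -> col (mn false l) != col (mn true l);
  ladder_adj : forall a b l, i <= l < J ->
    adj G (mn a l) (mn b l.+1) /\ col (mn a l) != col (mn b l.+1) }.

Lemma ladder_ext G lay lt col mn i J G' lay' lt' col' : ladder G lay lt col mn i J ->
  ext G lay col G' lay' col' ->
  (forall a l, i < l < J -> label G' (mn a l) = label G (mn a l)) ->
  (forall l, l < J -> lt' l = lt l) -> ladder G' lay' lt' col' mn i J.
Proof.
move=> Ld [eV el ec ea] eqL eqlt.
have rng a l : i <= l <= J -> mn a l < nV G by move=> /(ladder_cell Ld a)[].
split.
- move=> a l il; have [h1 h2 h3 h4] := ladder_cell Ld a il.
  by rewrite el // ec //; split=> //; apply: leq_trans eV.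
- by move=> a l il; rewrite eqL // (ladder_label Ld) // eqlt //; case/andP: il.
- by move=> l il; rewrite !ec ?rng //; apply: ladder_col Ld _ _.
move=> a b l il; have [h1 h2] := ladder_adj Ld a b il.
by split; [apply: ea|rewrite !ec ?rng //; lia].
Qed.

(** The part of the invariant common to all phases of the strategy. A builder may stand on layer [J]
    or already beyond it, and letters stay below [B] because rules exist only for these. *)
Record board (G : network) (lay lt col : nat -> nat) (mn : bool -> nat -> nat)
    (s : seq nat) (h r b1 b2 J B : nat) : Prop := Board {
  board_core : core G lay lt s h [:: r; b1; b2] J;
  board_web : web G col;
  board_ladder : ladder G lay lt col mn (lay r) J;
  board_reader : exists a, r = mn a (lay r);
  board_col : uniq [:: col r; col b1; col b2];
  board_col8 : {in [:: col r; col b1; col b2], forall c, c < 8};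
  board_builders : J <= lay b1 /\ J <= lay b2;
  board_lt : forall l, lt l < B;
  board_lay : lay r < J }.

(** A spare: its colour is the fourth one that [web_connected] asks for. *)
Definition good (G : network) (col : nat -> nat) (T : seq nat) (y : nat) : Prop :=
  [/\ y \in nA G, y \notin nS G, nst <= y & col y \notin map col T].

(** The created node is weak, and with a colour [cw] different from those of the tokens it is a
    second spare next to [y]. *)
Lemma strategy_create G lay lt col mn s h r b1 b2 J B y us1 I hl pre1 post1 c s' h' j0 cw :
  board G lay lt col mn s h r b1 b2 J B -> good G col [:: r; b1; b2] y ->
  {subset us1 <= [:: 0; r; b1; b2]} -> uniq us1 -> map (label G) (1 :: us1) = hl :: pre1 ->
  size pre1 = size post1 -> uniq I -> {in I, forall i, i < nend} ->
  (forall i, i < nend -> cw \notin tri i -> i \in I) -> 0 < ltag h' < 5 ->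
  (forall L, map L us1 = post1 -> (forall v, v < nV G -> v \notin 1 :: us1 -> L v = label G v) ->
     L 0 = Kap s' /\
     forall v, v \in [:: r; b1; b2] -> v \in us1 -> lay v <= J /\
       exists2 k, k \in [:: 8; 9; 10; 11] & L v = lab [:: k; lt (lay v); lay v %% 3]) ->
  (c = XX \/
   [/\ c = FF (j0 %% 3), forall v, v \in [:: r; b1; b2] -> v \in us1 -> j0 = (lay v).+1 &
       exists2 k, k < 8 & {in I, forall i, k \notin tri i}]) ->
  cw \notin [:: col r; col b1; col b2] ->
  exists G' lay' col',
   [/\ apply_rule (Create false ((hl :: pre1) ++ [seq EE i | i <- I]) c
                  ((h' :: post1) ++ [seq EE i | i <- I])) G G',
       board G' lay' lt col' mn s' h' r b1 b2 J B, ext G lay col G' lay' col',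
       [/\ map (label G') us1 = post1,
           forall v, v < nV G -> v \notin 1 :: us1 -> label G' v = label G v,
           label G' (nV G) = c, forall u, u \in us1 -> adj G' (nV G) u & nV G' = (nV G).+1]
     & [/\ lay' (nV G) = j0, col' (nV G) = cw, good G' col' [:: r; b1; b2] y,
           good G' col' [:: r; b1; b2] (nV G) & y != nV G]].
Proof.
move=> [C Wb Ld rd cu c8 bl ltB lr] [yA yS yst yc] sub un E0 sz uI nI cwI th LH cH cwT.
have [G' /= [ap [C' Wb'] ex [Lm Lk Lw Ladj] [eV eA eS]]] :=
  constructor_create C Wb sub un E0 sz uI nI cwI th LH cH.
have TV t : t \in [:: r; b1; b2] -> t < nV G by move=> /(core_T C)/and3P[].
have [rV b1V b2V] : [/\ r < nV G, b1 < nV G & b2 < nV G].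
  by split; apply: TV; rewrite !inE eqxx ?orbT.
have yV : y < nV G := web_active Wb yA.
exists G', (fun v => if v == nV G then j0 else lay v), (fun v => if v == nV G then cw else col v).
split=> //.
- split=> //; rewrite ?(ltn_eqF rV) ?(ltn_eqF b1V) ?(ltn_eqF b2V) //.
  apply: (ladder_ext Ld ex) => // a l il.
  have [h1 h2 h3 h4] := ladder_cell Ld a (introT andP (conj (ltnW (andP il).1) (ltnW (andP il).2))).
  apply: Lk => //; rewrite inE negb_or; apply/andP; split.
    by apply: contraTneq h1 => ->.
  apply/negP=> /sub; rewrite inE => /predU1P[E|]; first by rewrite E in h1.
  case: bl => bl1 bl2; case/andP: il => il1 il2.
  by rewrite !inE => /or3P[] /eqP E; rewrite E in h3; lia.
split; rewrite ?eqxx //.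
- split=> //; [by rewrite eA inE yA orbT|by rewrite eS|].
  by rewrite /= (ltn_eqF yV) (ltn_eqF rV) (ltn_eqF b1V) (ltn_eqF b2V).
- split; first by rewrite eA mem_head.
  + by rewrite eS; apply/negP=> /(core_SA C)/(web_active Wb); rewrite ltnn.
  + exact: core_V C.
  by rewrite /= eqxx (ltn_eqF rV) (ltn_eqF b1V) (ltn_eqF b2V).
by rewrite neq_ltn yV.
Qed.

(** A move gains a spare as well: the vacated cell [u] becomes weak, and no token has its colour any
    more. The old spare survives provided that the target avoids its colour. *)
Lemma good_move G col T u v y : u \in nA G -> good G col T y -> u \in T -> nst <= u ->
  col v != col u -> col y != col v ->
  {in T, forall t, t != u -> col t != col u} ->
  let T' := [seq if t == u then v else t | t <- T] in
  [/\ good (move_strong G u v) col T' y, good (move_strong G u v) col T' u & y != u].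
Proof.
move=> uA [yA yS yst yc] uT ust vu yv Tu T'; split.
- split=> //=; first by rewrite inE yA orbT.
    rewrite inE negb_or mem_filter (negbTE yS) andbF andbT.
    by apply: contraNneq yv => ->.
  apply/negP=> /mapP[_ /mapP[t tT ->]]; case: eqP => [_ /eqP|_ E]; first by rewrite (negbTE yv).
  by case/negP: yc; rewrite E map_f.
- split=> //=; first by rewrite inE uA orbT.
    rewrite inE negb_or mem_filter /= eqxx andbT.
    by apply: contraNneq vu => ->.
  apply/negP=> /mapP[_ /mapP[t tT ->]]; have [_ /eqP|tu /eqP] := eqVneq t u.
    by rewrite eq_sym (negbTE vu).
  by rewrite eq_sym (negbTE (Tu t tT tu)).
by apply: contraNneq yc => ->; apply: map_f.
Qed.

Definition builders_at (k : nat) (G : network) (lt : nat -> nat) (mn : bool -> nat -> nat)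
    (b1 b2 J : nat) : Prop :=
  [/\ b1 = mn false J, b2 = mn true J, label G b1 = lab [:: k; lt J; J %% 3] &
      label G b2 = lab [:: k; lt J; J %% 3]].

(** The first three colours keep the tokens distinct, make vacated builder cells useful and separate
    consecutive layers. The last two, from the layer after the reader, give [apart] once the
    builders stand on new cells. *)
Definition avoided (col : nat -> nat) (mn : bool -> nat -> nat) (r i J : nat) : seq nat :=
  [:: col r; col (mn false J); col (mn true J); col (mn false i.+1); col (mn true i.+1)].

Definition candidates (G : network) (lay col : nat -> nat) (mn : bool -> nat -> nat)
    (r J : nat) (cs : seq nat) : Prop :=
  uniq (map col cs) /\
  forall c, c \in cs -> [/\ nst <= c < nV G, label G c = FF (J.+1 %% 3), lay c = J.+1,
    col c < 8 /\ (forall a, adj G c (mn a J)) & col c \notin avoided col mn r (lay r) J].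

Definition apart (col : nat -> nat) (mn : bool -> nat -> nat) (i b1 b2 : nat) : Prop :=
  forall a, (col (mn a i.+1) != col b1) && (col (mn a i.+1) != col b2).

(** Constructor always moves [b1] before [b2], so fewer situations arise than in [phase]. The list
    [cs] collects the cells built for layer [J.+1]. *)
Variant strategy_phase (W : seq wentry) (Q : seq rentry) (B : nat) (G : network)
    (lay lt col : nat -> nat) (mn : bool -> nat -> nat) (s : seq nat) (h r b1 b2 J : nat) :
    Prop :=
  | CReady of h = READY & tok 10 lt (lay r) (label G r) &
      builders_at 8 G lt mn b1 b2 J & (lay r).+1 < J & apart col mn (lay r) b1 b2 &
      forever W Q (s, word lt (lay r) J)
  | CRead b of h = RGO b & b < B & tok 11 lt (lay r) (label G r) &
      builders_at 8 G lt mn b1 b2 J & (lay r).+1 < J & apart col mn (lay r) b1 b2 &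
      forever W Q (s, rcons (word lt (lay r).+1 J) b)
  | CReadDone b of h = RGO b & b < B & tok 9 lt (lay r) (label G r) &
      builders_at 8 G lt mn b1 b2 J & forever W Q (s, rcons (word lt (lay r) J) b)
  | CWrite b cs of h = WR b (size cs) & b < B & size cs < 3 &
      tok 10 lt (lay r) (label G r) & builders_at 8 G lt mn b1 b2 J &
      candidates G lay col mn r J cs & forever W Q (s, rcons (word lt (lay r) J) b)
  | CGo0 b cs of h = GO b & b < B & size cs = 3 &
      tok 10 lt (lay r) (label G r) & builders_at 9 G lt mn b1 b2 J &
      candidates G lay col mn r J cs & forever W Q (s, rcons (word lt (lay r) J) b)
  | CGo1 b cs of h = GO b & b < B & size cs = 3 &
      tok 10 lt (lay r) (label G r) & b1 \in cs & b2 = mn true J &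
      (forall a, label G (mn a J) = MM (lt J) (J %% 3)) &
      candidates G lay col mn r J cs & forever W Q (s, rcons (word lt (lay r) J) b)
  | CGo2 b cs of h = GO b & b < B &
      tok 10 lt (lay r) (label G r) & b1 \in cs & b2 \in cs &
      (forall a, label G (mn a J) = MM (lt J) (J %% 3)) &
      candidates G lay col mn r J cs & forever W Q (s, rcons (word lt (lay r) J) b).

Definition winning (W : seq wentry) (Q : seq rentry) (B : nat) (G : network) : Prop :=
  exists lay lt col mn s h r b1 b2 J y y',
    [/\ board G lay lt col mn s h r b1 b2 J B,
        strategy_phase W Q B G lay lt col mn s h r b1 b2 J &
        [/\ good G col [:: r; b1; b2] y, good G col [:: r; b1; b2] y' & y != y']].

Lemma candidates_ext G lay lt col mn s h r b1 b2 J B G' lay' col' cs :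
  board G lay lt col mn s h r b1 b2 J B -> candidates G lay col mn r J cs ->
  ext G lay col G' lay' col' -> (forall c, c \in cs -> label G' c = label G c) ->
  candidates G' lay' col' mn r J cs.
Proof.
move=> Bd [un cH] [eV el ec ea] eqL.
have Ld := board_ladder Bd; have lr := board_lay Bd.
have rV : r < nV G by have /and3P[] := core_T (board_core Bd) (mem_head _ _).
have mV a l : lay r <= l <= J -> mn a l < nV G by move=> /(ladder_cell Ld a)[].
split.
  rewrite (_ : map col' cs = map col cs) //; apply/eq_in_map=> c /cH[/andP[_ lc] _ _ _ _].
  exact: ec.
move=> c cin; have [/andP[sc lc] L1 L2 [c8 ca] av] := cH c cin.
rewrite sc (leq_trans lc eV) eqL // el // ec // /avoided el //.
by rewrite !ec ?mV //; try lia; split=> //; split=> // a; apply: ea.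
Qed.

Lemma free_colour (s : seq nat) : size s < 8 -> exists2 k, k < 8 & k \notin s.
Proof.
move=> sz; have [k kin ks] : exists2 k, k \in iota 0 8 & k \notin s.
  apply/hasP; apply: contraT => /hasPn al.
  have := uniq_leq_size (iota_uniq 0 8) (fun k kin => negbNE (al k kin)).
  by rewrite size_iota leqNgt sz.
by exists k => //; move: kin; rewrite mem_iota.
Qed.

Lemma free_candidate (col : nat -> nat) (cs : seq nat) (av : seq nat) :
  uniq (map col cs) -> size av < size cs -> exists2 c, c \in cs & col c \notin av.
Proof.
move=> un sz; apply/hasP; apply: contraT => /hasPn al.
have sub : {subset map col cs <= av} by move=> _ /mapP[c cin ->]; apply/negbNE/al.
by have := uniq_leq_size un sub; rewrite size_map leqNgt sz.
Qed.

Lemma strategy_create_connector G lay lt col mn s h r b1 b2 J B y us1 hl pre1 post1 s' h' :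
  board G lay lt col mn s h r b1 b2 J B -> good G col [:: r; b1; b2] y ->
  {subset us1 <= [:: 0; r; b1; b2]} -> uniq us1 -> map (label G) (1 :: us1) = hl :: pre1 ->
  0 < ltag h' < 5 ->
  (forall L, map L us1 = post1 -> (forall v, v < nV G -> v \notin 1 :: us1 -> L v = label G v) ->
     L 0 = Kap s' /\
     forall v, v \in [:: r; b1; b2] -> v \in us1 -> lay v <= J /\
       exists2 k, k \in [:: 8; 9; 10; 11] & L v = lab [:: k; lt (lay v); lay v %% 3]) ->
  size pre1 = size post1 ->
  exists G' lay' col',
   [/\ apply_rule (Create false ((hl :: pre1) ++ ends) XX ((h' :: post1) ++ ends)) G G',
       board G' lay' lt col' mn s' h' r b1 b2 J B, ext G lay col G' lay' col',
       map (label G') us1 = post1 /\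
         (forall v, v < nV G -> v \notin 1 :: us1 -> label G' v = label G v)
     & exists y', [/\ good G' col' [:: r; b1; b2] y, good G' col' [:: r; b1; b2] y' & y != y']].
Proof.
move=> Bd gy sub un E0 th LH sz.
(* Colour 8 is reserved for connectors: token colours are below 8, and a connector is joined to
   every endpoint anyway. *)
have cov i : i < nend -> 8 \notin tri i -> i \in iota 0 nend by rewrite mem_iota.
have rng : {in iota 0 nend, forall i, i < nend} by move=> i; rewrite mem_iota.
have c8 : 8 \notin [:: col r; col b1; col b2] by apply/negP=> /(board_col8 Bd).
have [G' [lay' [col' [ap Bd' ex [Lm Lk _ _ _] [_ _ g1 g2 ne]]]]] :=
  strategy_create (j0 := 0) Bd gy sub un E0 sz (iota_uniq _ _) rng cov th LH (or_introl erefl) c8.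
by exists G', lay', col'; split=> //; exists (nV G).
Qed.

Lemma qstep_inv W Q s w c : qstep W Q (s, w) c ->
  (exists b s', (s, b, s') \in W /\ c = (s', rcons w b)) \/
  (exists a b s' w', [/\ w = a :: w', (s, a, b, s') \in Q & c = (s', rcons w' b)]).
Proof.
move E: (s, w) => c0 st; case: st E => [s0 b s' w0 h|s0 a b s' w0 h] [-> ->].
  by left; exists b, s'.
by right; exists a, b, s', w0.
Qed.

Section Strategy.
Variables (W : seq wentry) (Q : seq rentry) (B : nat).
Hypothesis WB : forall s b s', (s, b, s') \in W -> b < B.
Hypothesis QB : forall s a b s', (s, a, b, s') \in Q -> b < B.

Definition wins_next (G : network) : Prop :=
  exists2 G', cmove (game_rules B W Q) G G' & winning W Q B G'.

Lemma cmove_rule ru G G' : is_rule B W Q ru -> apply_rule ru G G' ->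
  cmove (game_rules B W Q) G G'.
Proof.
move=> /game_rulesP/(nthP (Relabel [::]))[i li E] ap.
by right; exists i; rewrite E.
Qed.

Section Step.
Variables (G : network) (lay lt col : nat -> nat) (mn : bool -> nat -> nat) (s : seq nat).
Variables (h r b1 b2 J y : nat).
Hypothesis Bd : board G lay lt col mn s h r b1 b2 J B.
Hypothesis gy : good G col [:: r; b1; b2] y.

Let C : core G lay lt s h [:: r; b1; b2] J. Proof. exact: board_core Bd. Qed.
Let Ld : ladder G lay lt col mn (lay r) J. Proof. exact: board_ladder Bd. Qed.
Let rT : r \in [:: r; b1; b2]. Proof. by rewrite !inE eqxx. Qed.
Let b1T : b1 \in [:: r; b1; b2]. Proof. by rewrite !inE eqxx orbT. Qed.
Let b2T : b2 \in [:: r; b1; b2]. Proof. by rewrite !inE eqxx !orbT. Qed.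
Let TV t : t \in [:: r; b1; b2] -> t < nV G. Proof. by move=> /(core_T C)/and3P[]. Qed.
Let rV : r < nV G. Proof. exact: TV. Qed.
Let b1V : b1 < nV G. Proof. exact: TV. Qed.
Let b2V : b2 < nV G. Proof. exact: TV. Qed.
Let ne01 t : t \in [:: r; b1; b2] -> ((t == 0) = false) * ((t == 1) = false).
Proof.
by move=> /(core_T C)/and3P[+ _ _]; rewrite /nst => st; split; apply/eqP; lia.
Qed.
Let rb1 : (r == b1) = false.
Proof. by have := core_uniq C; rewrite /= !inE negb_or -!andbA => /and3P[/negbTE]. Qed.
Let rb2 : (r == b2) = false.
Proof. by have := core_uniq C; rewrite /= !inE negb_or -!andbA => /and3P[_ /negbTE]. Qed.
Let b12 : (b1 == b2) = false.
Proof. by have := core_uniq C; rewrite /= !inE negb_or -!andbA => /and3P[_ _ /andP[/negbTE]]. Qed.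
Let mu3 j : j %% 3 < 3. Proof. by rewrite ltn_pmod. Qed.
Let V01 : (0 < nV G) /\ (1 < nV G).
Proof. by have := core_V C; rewrite /nst; lia. Qed.

Lemma step_ready : h = READY -> tok 10 lt (lay r) (label G r) ->
  builders_at 8 G lt mn b1 b2 J -> (lay r).+1 < J -> apart col mn (lay r) b1 b2 ->
  forever W Q (s, word lt (lay r) J) -> wins_next G.
Proof.
move=> hE tr [m1 m2 l1 l2] lJ ap fo.
have lrJ : lay r <= J by apply: ltnW; apply: board_lay Bd.
(* Constructor follows an infinite run; its next step dictates [startw] or [startr]. *)
have [c' /qstep_inv[[b [s' [eW ->]]]|[a [b [s' [w' [Ew eQ ->]]]]]] fo'] := forever_step fo.
- have sub : {subset [:: 0] <= [:: 0; r; b1; b2]} by move=> x; rewrite !inE => ->.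
  have E0 : map (label G) [:: 1; 0] = [:: READY; Kap s].
    by rewrite /= (core_hub C) (core_kap C) hE.
  have LH L : map L [:: 0] = [:: Kap s'] ->
      (forall v, v < nV G -> v \notin [:: 1; 0] -> L v = label G v) ->
     L 0 = Kap s' /\
     forall v, v \in [:: r; b1; b2] -> v \in [:: 0] -> lay v <= J /\
       exists2 k, k \in [:: 8; 9; 10; 11] & L v = lab [:: k; lt (lay v); lay v %% 3].
    by case=> E _; split=> // v vT; rewrite inE (ne01 vT).
  have th : 0 < ltag (WR b 0) < 5 by rewrite ltag_lab.
  have [G' [lay' [col' [apl Bd' ex [Lm Lk] [y' gs]]]]] :=
    strategy_create_connector Bd gy sub erefl E0 th LH erefl.
  exists G'; first exact: (cmove_rule (IsStartw _ _ eW) apl).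
  have Lk' v : v \in [:: r; b1; b2] -> label G' v = label G v.
    by move=> vT; apply: Lk; rewrite ?TV // !inE !(ne01 vT).
  exists lay', lt, col', mn, s', (WR b 0), r, b1, b2, J, y, y'; split=> //.
  apply: (@CWrite _ _ _ _ _ _ _ _ _ _ _ _ _ _ b [::]); rewrite ?(ext_lay ex) ?Lk' //.
  + exact: WB eW.
  + by split; rewrite ?Lk'.
have sub : {subset [:: 0; r] <= [:: 0; r; b1; b2]}.
  by move=> x; rewrite !inE => /orP[] ->; rewrite ?orbT.
have un : uniq [:: 0; r] by rewrite /= inE eq_sym (ne01 rT).
have E0 : map (label G) [:: 1; 0; r] = [:: READY; Kap s; RL (lt (lay r)) (lay r %% 3)].
  by rewrite /= (core_hub C) (core_kap C) hE tr.
have LH L : map L [:: 0; r] = [:: Kap s'; GG (lt (lay r)) (lay r %% 3)] ->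
    (forall v, v < nV G -> v \notin [:: 1; 0; r] -> L v = label G v) ->
   L 0 = Kap s' /\
   forall v, v \in [:: r; b1; b2] -> v \in [:: 0; r] -> lay v <= J /\
     exists2 k, k \in [:: 8; 9; 10; 11] & L v = lab [:: k; lt (lay v); lay v %% 3].
  case=> E E' _; split=> // v vT; rewrite !inE !(ne01 vT) => /eqP->; split=> //.
  by exists 11.
have th : 0 < ltag (RGO b) < 5 by rewrite ltag_lab.
have [G' [lay' [col' [apl Bd' ex [Lm Lk] [y' gs]]]]] :=
  strategy_create_connector Bd gy sub un E0 th LH erefl.
rewrite word_cons // in Ew; case: Ew => ? Ew; subst a.
exists G'; first exact: (cmove_rule (IsStartr _ _ eQ (mu3 _)) apl).
have Lk' v : v \in [:: r; b1; b2] -> v != r -> label G' v = label G v.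
  by move=> vT vr; apply: Lk; rewrite ?TV // !inE !(ne01 vT) (negbTE vr).
exists lay', lt, col', mn, s', (RGO b), r, b1, b2, J, y, y'; split=> //.
have iJ : lay r <= (lay r).+1 <= J by rewrite leqnSn ltnW.
have mV0 a : mn a (lay r).+1 < nV G by have [] := ladder_cell Ld a iJ.
apply: (@CRead _ _ _ _ _ _ _ _ _ _ _ _ _ _ b); rewrite ?(ext_lay ex) //.
- exact: QB eQ.
- by case: Lm => _ ->.
- by split; rewrite ?Lk' // eq_sym ?rb1 ?rb2.
- by move=> a'; rewrite !(ext_col ex) // (ext_lay ex) // mV0.
- by rewrite Ew.
Qed.

Lemma step_read_done b : h = RGO b -> b < B -> tok 9 lt (lay r) (label G r) ->
  builders_at 8 G lt mn b1 b2 J -> forever W Q (s, rcons (word lt (lay r) J) b) ->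
  wins_next G.
Proof.
move=> hE bB tr [m1 m2 l1 l2] fo.
have lrJ : lay r <= J by apply: ltnW; apply: board_lay Bd.
have sub : {subset [:: r] <= [:: 0; r; b1; b2]}.
  by move=> x; rewrite !inE => ->; rewrite ?orbT.
have E0 : map (label G) [:: 1; r] = [:: RGO b; MM (lt (lay r)) (lay r %% 3)].
  by rewrite /= (core_hub C) hE tr.
have LH L : map L [:: r] = [:: RL (lt (lay r)) (lay r %% 3)] ->
    (forall v, v < nV G -> v \notin [:: 1; r] -> L v = label G v) ->
   L 0 = Kap s /\
   forall v, v \in [:: r; b1; b2] -> v \in [:: r] -> lay v <= J /\
     exists2 k, k \in [:: 8; 9; 10; 11] & L v = lab [:: k; lt (lay v); lay v %% 3].
  case=> E Lk; split.
    by rewrite Lk ?(core_kap C) ?(V01.1) // !inE /= eq_sym (ne01 rT).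
  move=> v vT; rewrite !inE => /eqP->; split=> //.
  by exists 10.
have th : 0 < ltag (WR b 0) < 5 by rewrite ltag_lab.
have [G' [lay' [col' [apl Bd' ex [Lm Lk] [y' gs]]]]] :=
  strategy_create_connector Bd gy sub erefl E0 th LH erefl.
exists G'; first exact: (cmove_rule (IsRarrive _ _ bB (board_lt Bd (lay r)) (mu3 _)) apl).
have Lk' v : v \in [:: r; b1; b2] -> v != r -> label G' v = label G v.
  by move=> vT vr; apply: Lk; rewrite ?TV // !inE !(ne01 vT) (negbTE vr).
exists lay', lt, col', mn, s, (WR b 0), r, b1, b2, J, y, y'; split=> //.
apply: (@CWrite _ _ _ _ _ _ _ _ _ _ _ _ _ _ b [::]); rewrite ?(ext_lay ex) //.
- by case: Lm => ->.
- by split; rewrite ?Lk' // eq_sym ?rb1 ?rb2.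
Qed.

Lemma step_write b cs : h = WR b (size cs) -> b < B -> size cs < 3 ->
  tok 10 lt (lay r) (label G r) -> builders_at 8 G lt mn b1 b2 J ->
  candidates G lay col mn r J cs -> forever W Q (s, rcons (word lt (lay r) J) b) ->
  wins_next G.
Proof.
move=> hE bB sz tr [m1 m2 l1 l2] [cun cc] fo.
have lrJ : lay r < J := board_lay Bd.
(* Five avoided colours and at most two earlier candidates leave one of the eight. *)
have [k k8 kav] : exists2 k, k < 8 & k \notin avoided col mn r (lay r) J ++ map col cs.
  by apply: free_colour; rewrite size_cat size_map /=; lia.
rewrite mem_cat negb_or in kav; case/andP: kav => kav kcs.
pose I := [seq i <- iota 0 nend | k \notin tri i].
have uI : uniq I by rewrite filter_uniq ?iota_uniq.
have nI : {in I, forall i, i < nend} by move=> i; rewrite mem_filter mem_iota => /andP[_].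
have cov i : i < nend -> k \notin tri i -> i \in I.
  by move=> li ki; rewrite mem_filter ki mem_iota.
have layb v : v \in [:: r; b1; b2] -> v \in [:: b1; b2] -> lay v = J.
  have JJ : lay r <= J <= J by rewrite leqnn andbT ltnW.
  move=> _; rewrite !inE => /orP[] /eqP->.
    by rewrite m1; have [] := ladder_cell Ld false JJ.
  by rewrite m2; have [] := ladder_cell Ld true JJ.
have sub : {subset [:: b1; b2] <= [:: 0; r; b1; b2]}.
  by move=> x; rewrite !inE => /orP[] ->; rewrite ?orbT.
have un : uniq [:: b1; b2] by rewrite /= inE b12.
have E0 : map (label G) [:: 1; b1; b2] =
    [:: WR b (size cs); NN (lt J) (J %% 3); NN (lt J) (J %% 3)].
  by rewrite /= (core_hub C) hE l1 l2.
have kT : k \notin [:: col r; col b1; col b2].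
  by move: kav; rewrite !inE !negb_or m1 m2 => /and5P[-> -> ->].
have [h' [p [E Eh]]] : exists h' p,
    (if size cs < 2 then [:: WR b (size cs).+1; NN (lt J) (J %% 3); NN (lt J) (J %% 3)]
     else [:: GO b; MM (lt J) (J %% 3); MM (lt J) (J %% 3)])
      = [:: h'; lab [:: p; lt J; J %% 3]; lab [:: p; lt J; J %% 3]] /\
    (if size cs < 2 then h' = WR b (size cs).+1 /\ p = 8 else h' = GO b /\ p = 9).
  by case: ifP => _; [exists (WR b (size cs).+1), 8|exists (GO b), 9].
have p811 : p \in [:: 8; 9; 10; 11] by move: Eh; case: ifP => _ [_ ->].
have LH L : map L [:: b1; b2] = [:: lab [:: p; lt J; J %% 3]; lab [:: p; lt J; J %% 3]] ->
    (forall v, v < nV G -> v \notin [:: 1; b1; b2] -> L v = label G v) ->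
   L 0 = Kap s /\
   forall v, v \in [:: r; b1; b2] -> v \in [:: b1; b2] -> lay v <= J /\
     exists2 k, k \in [:: 8; 9; 10; 11] & L v = lab [:: k; lt (lay v); lay v %% 3].
  case=> E1 E2 Lk; split.
    rewrite Lk ?(core_kap C) ?(V01.1) // !inE /=.
    by rewrite eq_sym (ne01 b1T) eq_sym (ne01 b2T).
  move=> v vT vb; rewrite layb //; split=> //; exists p => //.
  by move: vb; rewrite !inE => /orP[] /eqP->.
have th : 0 < ltag h' < 5 by move: Eh; case: ifP => _ [-> _]; rewrite ltag_lab.
have cH : FF ((J %% 3).+1 %% 3) = XX \/
   [/\ FF ((J %% 3).+1 %% 3) = FF (J.+1 %% 3),
       forall v, v \in [:: r; b1; b2] -> v \in [:: b1; b2] -> J.+1 = (lay v).+1 &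
       exists2 k, k < 8 & {in I, forall i, k \notin tri i}].
  right; split; rewrite ?modS3 //; first by move=> v vT vb; rewrite layb.
  by exists k => // i; rewrite mem_filter => /andP[].
have [G' [lay' [col' [apl Bd' ex [Lm Lk Lw Ladj eV] [lw cw g1 g2 ne]]]]] :=
  strategy_create (post1 := [:: lab [:: p; lt J; J %% 3]; lab [:: p; lt J; J %% 3]])
    Bd gy sub un E0 erefl uI nI cov th LH cH kT.
have ap : apply_rule (cellr b (size cs) (lt J) (J %% 3) k) G G' by rewrite /cellr E.
exists G'; first exact: (cmove_rule (IsCell _ _ bB sz (board_lt Bd J) (mu3 _) k8) ap).
have cT c : c \in cs -> c \notin [:: 1; b1; b2].
  move=> /cc[/andP[sc _] _ lc _ _]; rewrite !inE !negb_or.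
  rewrite (_ : c != 1); last by apply: contraTneq sc => ->.
  apply/andP; split=> //; apply/andP; split; apply/eqP=> E1; move: lc; rewrite E1.
    by rewrite layb ?inE ?eqxx ?orbT // => /n_Sn.
  by rewrite layb ?inE ?eqxx ?orbT // => /n_Sn.
have [cun' cc'] : candidates G' lay' col' mn r J cs.
  apply: (candidates_ext Bd (conj cun cc) ex) => c cin; apply: Lk; last exact: cT.
  by have [/andP[]] := cc c cin.
have mV a l : lay r <= l <= J -> mn a l < nV G by move=> /(ladder_cell Ld a)[].
have cd : candidates G' lay' col' mn r J (nV G :: cs).
  split.
    rewrite /= cun' andbT cw (_ : map col' cs = map col cs) //.
    by apply/eq_in_map=> c /cc[/andP[_ lc] _ _ _ _]; apply: (ext_col ex).
  move=> c; rewrite inE => /predU1P[->|]; last exact: cc'.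
  rewrite eV (core_V C) leqnn Lw lw cw modS3; split=> //.
    split=> // a; case: a; first by rewrite -m2; apply: Ladj; rewrite !inE eqxx orbT.
    by rewrite -m1; apply: Ladj; rewrite !inE eqxx.
  have JJ : lay r <= J <= J by rewrite leqnn andbT ltnW.
  have iJ : lay r <= (lay r).+1 <= J by rewrite leqnSn.
  by rewrite /avoided (ext_lay ex) // !(ext_col ex) ?mV.
have Lr : label G' r = label G r by apply: Lk; rewrite // !inE (ne01 rT) rb1 rb2.
have tr' : tok 10 lt (lay' r) (label G' r) by rewrite Lr (ext_lay ex).
have fo' : forever W Q (s, rcons (word lt (lay' r) J) b) by rewrite (ext_lay ex).
exists lay', lt, col', mn, s, h', r, b1, b2, J, y, (nV G); split=> //.
case: Lm => Lb1 Lb2.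
move: Eh; case: ifP => s2 [? ?]; subst h' p.
  exact: (@CWrite _ _ _ _ _ _ _ _ _ _ _ _ _ _ b (nV G :: cs)).
apply: (@CGo0 _ _ _ _ _ _ _ _ _ _ _ _ _ _ b (nV G :: cs)) => //=.
by move: sz s2; case: (size cs) => [|[|[|]]].
Qed.

Let web_move u v : v < nV G -> web (move_strong G u v) col.
Proof.
move=> lv; have [w1 w2 w3 w4] := board_web Bd; split=> // x.
by rewrite inE => /predU1P[->//|/w1].
Qed.

Let TA t : t \in [:: r; b1; b2] -> t \in nA G.
Proof. by move=> tT; apply: (core_SA C); rewrite (core_S C) tT orbT. Qed.
Let Tst t : t \in [:: r; b1; b2] -> nst <= t.
Proof. by move=> /(core_T C)/and3P[]. Qed.
Let Tcol : [/\ col r != col b1, col r != col b2 & col b1 != col b2].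
Proof. by have := board_col Bd; rewrite /= !inE negb_or andbT => /andP[/andP[-> ->] ->]. Qed.
Let notS v : nst <= v -> v \notin [:: r; b1; b2] -> v \notin nS G.
Proof. by move=> sv vT; rewrite (core_S C) ltnNge sv. Qed.
Let ladder_move u v : ladder (move_strong G u v) lay lt col mn (lay r) J.
Proof. by apply: (ladder_ext Ld) => //; apply: ext_refl. Qed.
Let br : (b1 == r = false) * (b2 == r = false) * (b2 == b1 = false).
Proof. by rewrite ![_ == r]eq_sym [b2 == _]eq_sym rb1 rb2 b12. Qed.

(** Whichever cell of the next layer is taken, [apart] keeps its colour away from those of the
    builders, so only the colour of [y] restricts the choice. *)
Lemma step_read b : h = RGO b -> b < B -> tok 11 lt (lay r) (label G r) ->
  builders_at 8 G lt mn b1 b2 J -> (lay r).+1 < J -> apart col mn (lay r) b1 b2 ->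
  forever W Q (s, rcons (word lt (lay r).+1 J) b) -> wins_next G.
Proof.
move=> hE bB tr [m1 m2 l1 l2] lJ apt fo.
have lrJ : lay r < J := board_lay Bd.
have i1 : lay r <= (lay r).+1 <= J by lia.
have [a ya] : exists a, col y != col (mn a (lay r).+1).
  have [E|ne] := eqVneq (col y) (col (mn false (lay r).+1)); last by exists false.
  by exists true; rewrite E; apply: ladder_col Ld _ _.
have [vst vV vlay v8] := ladder_cell Ld a i1.
have vlab : label G (mn a (lay r).+1) = MM (lt (lay r).+1) ((lay r).+1 %% 3).
  by apply: (ladder_label Ld); lia.
set v := mn a (lay r).+1 in ya vst vV vlay v8 vlab.
have [a0 ra0] := board_reader Bd.
have [rv crv] : adj G r v /\ col r != col v.
  by have := ladder_adj Ld a0 a (l := lay r); rewrite -ra0 leqnn lrJ; apply.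
have [bl1 bl2] := board_builders Bd.
have vT : v \notin [:: r; b1; b2].
  by rewrite !inE !negb_or; apply/and3P; split; apply/eqP=> E; rewrite E in vlay; lia.
have vX : label G v != XX by rewrite vlab; apply/eqP=> E; lab_inv.
have vS := notS vst vT.
have C' := core_move C rT vV vS vX; rewrite /= eqxx !br in C'.
have [c1 c2 c3] := Tcol.
have Tu : {in [:: r; b1; b2], forall t, t != r -> col t != col r}.
  by move=> t; rewrite !inE => /or3P[] /eqP->; rewrite ?eqxx // => _; rewrite 1?eq_sym.
have cvr : col v != col r by rewrite eq_sym.
have := good_move (TA rT) gy rT (Tst rT) cvr ya Tu; rewrite /= eqxx !br => gs.
exists (move_strong G r v).
  apply: (cmove_rule (IsMover _ _ (board_lt Bd (lay r)) (board_lt Bd (lay r).+1) (mu3 (lay r)))).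
  exists r, v; rewrite modS3; split=> //; split=> //.
  by rewrite /isstrong (core_S C) rT orbT.
have /andP[cv1 cv2] := apt a.
exists lay, lt, col, mn, s, h, v, b1, b2, J, y, r; split=> //.
  split=> //.
  - exact: web_move.
  - have [L1 L2 L3 L4] := ladder_move r v; rewrite vlay; split=> *;
      [apply: L1|apply: L2|apply: L3|apply: L4]; lia.
  - by exists a; rewrite vlay.
  - by rewrite /= !inE negb_or cv1 cv2 c3.
  - move=> c; rewrite inE => /predU1P[->//|cin]; apply: (board_col8 Bd).
    by rewrite inE cin orbT.
  - exact: board_lt Bd.
  - by rewrite vlay.
by apply: (@CReadDone _ _ _ _ _ _ _ _ _ _ _ _ _ _ b) => //; rewrite /tok vlay.
Qed.

Let cand_not_token cs c : candidates G lay col mn r J cs -> c \in cs ->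
  label G b1 = MM (lt J) (J %% 3) \/ col c != col b1 ->
  label G b2 = MM (lt J) (J %% 3) -> tok 10 lt (lay r) (label G r) ->
  [/\ c < nV G, c \notin nS G & label G c != XX].
Proof.
move=> [_ cc] cin h1 h2 tr; have [/andP[cst cV] cl _ _ _] := cc c cin; split=> //.
  apply: notS => //; rewrite !inE !negb_or; apply/and3P; split; apply/eqP=> E.
  - by rewrite E tr in cl; lab_inv.
  - case: h1 => [h1|]; last by rewrite E eqxx.
    by rewrite E h1 in cl; lab_inv.
  - by rewrite E h2 in cl; lab_inv.
by rewrite cl; apply/eqP=> E; lab_inv.
Qed.

Lemma step_go0 b cs : h = GO b -> b < B -> size cs = 3 ->
  tok 10 lt (lay r) (label G r) -> builders_at 9 G lt mn b1 b2 J ->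
  candidates G lay col mn r J cs -> forever W Q (s, rcons (word lt (lay r) J) b) ->
  wins_next G.
Proof.
move=> hE bB sz tr [m1 m2 l1 l2] cd fo.
have [|v vin vy] := free_candidate (av := [:: col y]) cd.1; first by rewrite sz.
have [vV vS vX] := cand_not_token cd vin (or_introl l1) l2 tr.
have [/andP[vst _] vlab vlay [v8 vadj] vav] := cd.2 v vin.
move: vav; rewrite /avoided -m1 -m2 !inE !negb_or => /and5P[cvr cv1 cv2 _ _].
have C' := core_move C b1T vV vS vX; rewrite /= eqxx rb1 !br in C'.
have [c1 c2 c3] := Tcol; have [bl1 bl2] := board_builders Bd.
have Tu : {in [:: r; b1; b2], forall t, t != b1 -> col t != col b1}.
  by move=> t; rewrite !inE => /or3P[] /eqP->; rewrite ?eqxx // => _; rewrite 1?eq_sym.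
have yv : col y != col v by move: vy; rewrite inE eq_sym.
have := good_move (TA b1T) gy b1T (Tst b1T) cv1 yv Tu; rewrite /= eqxx rb1 !br => gs.
exists (move_strong G b1 v).
  apply: (cmove_rule (IsMoveb _ _ (board_lt Bd J) (mu3 J))).
  exists b1, v; rewrite modS3; split=> //; last by rewrite adjC m1.
  by rewrite /isstrong (core_S C) b1T orbT.
exists lay, lt, col, mn, s, h, r, v, b2, J, y, b1; split=> //.
  split=> //.
  - exact: web_move.
  - exact: board_reader Bd.
  - by rewrite /= !inE negb_or [col r == _]eq_sym cvr c2 cv2.
  - move=> c; rewrite !inE => /or3P[/eqP->|/eqP->//|/eqP->]; apply: (board_col8 Bd);
      by rewrite !inE eqxx ?orbT.
  - by rewrite vlay; split; first exact: leqnSn.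
  - exact: board_lt Bd.
  - exact: board_lay Bd.
apply: (@CGo1 _ _ _ _ _ _ _ _ _ _ _ _ _ _ b cs) => //.
by case; rewrite -?m1 -?m2.
Qed.

Lemma step_go1 b cs : h = GO b -> b < B -> size cs = 3 ->
  tok 10 lt (lay r) (label G r) -> b1 \in cs -> b2 = mn true J ->
  (forall a, label G (mn a J) = MM (lt J) (J %% 3)) ->
  candidates G lay col mn r J cs -> forever W Q (s, rcons (word lt (lay r) J) b) ->
  wins_next G.
Proof.
move=> hE bB sz tr b1c m2 lm cd fo.
(* Two colours are excluded here, that of the spare and that of the cell just taken by [b1]; this is
   why three candidates were built. *)
have [|v vin] := free_candidate (av := [:: col y; col b1]) cd.1; first by rewrite sz.
rewrite !inE negb_or => /andP[vy vb1].
have l2 : label G b2 = MM (lt J) (J %% 3) by rewrite m2.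
have [vV vS vX] := cand_not_token cd vin (or_intror vb1) l2 tr.
have [/andP[vst _] vlab vlay [v8 vadj] vav] := cd.2 v vin.
move: vav; rewrite /avoided -m2 !inE !negb_or => /and5P[cvr _ cv2 _ _].
have C' := core_move C b2T vV vS vX; rewrite /= eqxx rb2 b12 in C'.
have [c1 c2 c3] := Tcol; have [bl1 bl2] := board_builders Bd.
have Tu : {in [:: r; b1; b2], forall t, t != b2 -> col t != col b2}.
  by move=> t; rewrite !inE => /or3P[] /eqP->; rewrite ?eqxx.
have yv : col y != col v by rewrite eq_sym.
have := good_move (TA b2T) gy b2T (Tst b2T) cv2 yv Tu; rewrite /= eqxx rb2 b12 => gs.
exists (move_strong G b2 v).
  apply: (cmove_rule (IsMoveb _ _ (board_lt Bd J) (mu3 J))).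
  exists b2, v; rewrite modS3; split=> //; last by rewrite adjC m2.
  by rewrite /isstrong (core_S C) b2T orbT.
exists lay, lt, col, mn, s, h, r, b1, v, J, y, b2; split=> //.
  split=> //.
  - exact: web_move.
  - exact: board_reader Bd.
  - by rewrite /= !inE negb_or [col r == col v]eq_sym cvr c1 eq_sym vb1.
  - move=> c; rewrite !inE => /or3P[/eqP->|/eqP->|/eqP->//]; apply: (board_col8 Bd);
      by rewrite !inE eqxx ?orbT.
  - by rewrite vlay; split; last exact: leqnSn.
  - exact: board_lt Bd.
  - exact: board_lay Bd.
exact: (@CGo2 _ _ _ _ _ _ _ _ _ _ _ _ _ _ b cs).
Qed.

Lemma step_go2 b cs : h = GO b -> b < B ->
  tok 10 lt (lay r) (label G r) -> b1 \in cs -> b2 \in cs ->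
  (forall a, label G (mn a J) = MM (lt J) (J %% 3)) ->
  candidates G lay col mn r J cs -> forever W Q (s, rcons (word lt (lay r) J) b) ->
  wins_next G.
Proof.
move=> hE bB tr b1c b2c lm [_ cc] fo.
have lrJ : lay r < J := board_lay Bd.
have [/andP[st1 V1] lab1 lay1 [c81 adj1] av1] := cc b1 b1c.
have [/andP[st2 V2] lab2 lay2 [c82 adj2] av2] := cc b2 b2c.
have [c1 c2 c3] := Tcol.
pose lt' j := if j == J.+1 then b else lt j.
have ltE j : j <= J -> lt' j = lt j by move=> lj; rewrite /lt' (ltn_eqF _).
have ltJ : lt' J.+1 = b by rewrite /lt' eqxx.
have C1 := core_extend C (leqnSn J) ltE.
pose mn' (a : bool) l := if l == J.+1 then (if a then b2 else b1) else mn a l.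
have mnE a l : l <= J -> mn' a l = mn a l by move=> lj; rewrite /mn' (ltn_eqF _).
have mnJ a : mn' a J.+1 = if a then b2 else b1 by rewrite /mn' eqxx.
(* The network is unchanged: the new layer enters the bookkeeping first, and the arrival rule is
   then an ordinary creation of a connector on the longer ladder. *)
have Bd1 : board G lay lt' col mn' s h r b1 b2 J.+1 B.
  split=> //.
  - exact: board_web Bd.
  - split.
    + move=> a l; case/andP=> il; rewrite leq_eqVlt => /predU1P[->|lJ].
        by rewrite mnJ; case: a.
      by rewrite mnE //; apply: (ladder_cell Ld); rewrite il.
    + move=> a l /andP[il]; rewrite ltnS => lJ; rewrite mnE // ltE //.
      move: lJ; rewrite leq_eqVlt => /predU1P[->//|lJ].
      by apply: (ladder_label Ld); rewrite il.
    + move=> l /andP[il]; rewrite leq_eqVlt => /predU1P[->|lJ]; first by rewrite !mnJ.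
      by rewrite !mnE //; apply: (ladder_col Ld); rewrite il.
    + move=> a a' l /andP[il]; rewrite ltnS => lJ; rewrite mnE //.
      move: lJ; rewrite leq_eqVlt => /predU1P[->|lJ]; last first.
        by rewrite mnE //; apply: (ladder_adj Ld); rewrite il.
      rewrite mnJ adjC; move: av1 av2; rewrite !inE !negb_or.
      move=> /and5P[_ e1 e2 _ _] /and5P[_ e3 e4 _ _].
      by case: a' a => [] []; rewrite ?adj1 ?adj2 eq_sym.
  - by have [a ra] := board_reader Bd; exists a; rewrite mnE // ltnW.
  - exact: board_col Bd.
  - exact: board_col8 Bd.
  - by rewrite lay1 lay2.
  - by move=> l; rewrite /lt'; case: ifP => // _; apply: board_lt Bd _.
  - exact: leqW.
have sub : {subset [:: b1; b2] <= [:: 0; r; b1; b2]}.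
  by move=> x; rewrite !inE => /orP[] ->; rewrite ?orbT.
have un : uniq [:: b1; b2] by rewrite /= inE b12.
have E0 : map (label G) [:: 1; b1; b2] = [:: GO b; FF (J.+1 %% 3); FF (J.+1 %% 3)].
  by rewrite /= (core_hub C) hE lab1 lab2.
have LH L : map L [:: b1; b2] = [:: NN b (J.+1 %% 3); NN b (J.+1 %% 3)] ->
    (forall v, v < nV G -> v \notin [:: 1; b1; b2] -> L v = label G v) ->
   L 0 = Kap s /\
   forall v, v \in [:: r; b1; b2] -> v \in [:: b1; b2] -> lay v <= J.+1 /\
     exists2 k, k \in [:: 8; 9; 10; 11] & L v = lab [:: k; lt' (lay v); lay v %% 3].
  case=> E1 E2 Lk; split.
    rewrite Lk ?(core_kap C) ?(V01.1) // !inE /=.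
    by rewrite eq_sym (ne01 b1T) eq_sym (ne01 b2T).
  move=> v _; rewrite !inE => /orP[] /eqP->; rewrite ?lay1 ?lay2 ltJ; split=> //; by exists 8.
have th : 0 < ltag READY < 5 by rewrite ltag_lab.
have [G' [lay' [col' [apl Bd' ex [Lm Lk] [y' gs]]]]] :=
  strategy_create_connector Bd1 gy sub un E0 th LH erefl.
exists G'; first exact: (cmove_rule (IsArrive _ _ bB (mu3 _)) apl).
have Lr : label G' r = label G r by apply: Lk; rewrite // !inE (ne01 rT) rb1 rb2.
case: Lm => Lb1 Lb2.
exists lay', lt', col', mn', s, READY, r, b1, b2, J.+1, y, y'; split=> //.
have iJ : lay r <= (lay r).+1 <= J by rewrite leqnSn.
have mV a : mn a (lay r).+1 < nV G by have [] := ladder_cell Ld a iJ.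
apply: CReady => //; rewrite ?(ext_lay ex) //.
- by rewrite /tok Lr ltE // ltnW.
- by split; rewrite ?mnJ // ?Lb1 ?Lb2 ltJ.
- move=> a; rewrite ?(ext_lay ex) // mnE // !(ext_col ex) //.
  move: av1 av2; rewrite !inE !negb_or => /and5P[_ _ _ e1 e2] /and5P[_ _ _ e3 e4].
  by rewrite ![_ == col b1]eq_sym ![_ == col b2]eq_sym; case: a; rewrite ?e1 ?e2 ?e3 ?e4.
by rewrite (word_rcons _ ltE) ?ltJ // ltnW.
Qed.
End Step.

(** Neither the ladder nor the candidates are required to be active, so a deletion can damage
    nothing but one of the two spares. *)
Lemma winning_step G G' : winning W Q B G -> dmove G G' ->
  connected G' /\ wins_next G'.
Proof.
case=> lay [lt [col [mn [s [h [r [b1 [b2 [J [y [y' [Bd ph [g1 g2 ne]]]]]]]]]]]]] dm.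
have [Bd' ph' [z gz]] : [/\ board G' lay lt col mn s h r b1 b2 J B,
    strategy_phase W Q B G' lay lt col mn s h r b1 b2 J &
    exists z, good G' col [:: r; b1; b2] z].
  case: dm => [->|[v [vA vS ->]]]; first by split=> //; exists y.
  split.
  - case: Bd => C [w1 w2 w3 w4] Ld *; split=> //.
    + by apply: (core_del C); rewrite /is_weak vA vS.
    + by split=> // x; rewrite mem_filter => /andP[_ /w1].
    by case: Ld => *; split.
  - by case: ph => *; [apply: CReady|apply: CRead|apply: CReadDone|apply: CWrite|
      apply: CGo0|apply: CGo1|apply: CGo2]; eassumption.
  have H x : good G col [:: r; b1; b2] x -> x != v ->
      good (del_node G v) col [:: r; b1; b2] x.
    by move=> [xA xS xst xc] xv; split=> //=; rewrite mem_filter /= xv.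
  have [E|yv] := eqVneq y v; last by exists y; apply: H.
  by exists y'; apply: H => //; rewrite -E eq_sym.
split.
  case: gz => zA _ zst zc; have un := board_col Bd'.
  exact: (web_connected (board_core Bd') (board_web Bd') un zA zst zc).
case: ph' => [e1 e2 e3 e4 e5 e6|b e1 e2 e3 e4 e5 e6 e7|b e1 e2 e3 e4 e5|
   b cs e1 e2 e3 e4 e5 e6 e7|b cs e1 e2 e3 e4 e5 e6 e7|b cs e1 e2 e3 e4 e5 e6 e7 e8 e9|
   b cs e1 e2 e3 e4 e5 e6 e7 e8].
- exact: (step_ready Bd' gz e1 e2 e3 e4 e5 e6).
- exact: (step_read Bd' gz e1 e2 e3 e4 e5 e6 e7).
- exact: (step_read_done Bd' gz e1 e2 e3 e4 e5).
- exact: (step_write Bd' gz e1 e2 e3 e4 e5 e6 e7).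
- exact: (step_go0 Bd' gz e1 e2 e3 e4 e5 e6 e7).
- exact: (step_go1 Bd' gz e1 e2 e3 e4 e5 e6 e7 e8 e9).
exact: (step_go2 Bd' gz e1 e2 e3 e4 e5 e6 e7 e8).
Qed.

Lemma winning_connected G : winning W Q B G -> connected G.
Proof. by move=> w; have [] := winning_step w (or_introl erefl). Qed.

Lemma constructor_wins G : winning W Q B G ->
  constructor_wins_safety G (game_rules B W Q).
Proof.
apply: winning_invariant.
- exact: winning_connected.
- by move=> {}G G'; apply: winning_step.
Qed.
End Strategy.

(** * The initial network *)

(* Three layers of two cells with colours 0, ..., 5, followed by two universal connectors;
   the reader is on the first cell and the builders are on the last two. *)
Definition start_edge (u v : nat) : bool :=
  [|| (u == 0) && (v == 1), (nst <= u) && (v == 1),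
      [&& nst <= u, 1 < v < nst & (5 < u - nst) || (u - nst \notin tri v.-2)] |
      [&& nst <= u, nst <= v, v - nst < 6 & (v - nst)./2 == ((u - nst)./2).+1]].

(** The initial queue is the end marker followed by two blanks. The blanks place the builders two
    layers ahead of the reader, as [CReady] demands. *)
Definition start_cells : seq nat :=
  [:: RL 1 0; MM 1 0; MM 0 1; MM 0 1; NN 0 2; NN 0 2; XX; XX].

Definition start_nodes : seq nat := iota 0 (nst + 8).
Definition start_edges : seq (nat * nat) :=
  [seq e <- pairs start_nodes start_nodes | start_edge e.1 e.2].
Definition start_strong : seq nat := iota 0 nst ++ [:: nst; nst + 4; nst + 5].

Definition start (s : seq nat) : network :=
  Network (nst + 8) start_edges start_nodes start_strong
    (Kap s :: READY :: ends ++ start_cells).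

Definition start_lay (v : nat) : nat := (v - nst)./2.
Definition start_lt (l : nat) : nat := (l == 0).
Definition start_col (v : nat) : nat := if v - nst < 6 then v - nst else 8.
Definition start_mn (a : bool) (l : nat) : nat := nst + (l.*2 + a).

Lemma start_adj s u v : adj (start s) u v =
  [&& u < nst + 8, v < nst + 8 & start_edge u v || start_edge v u].
Proof.
rewrite /adj !mem_filter !mem_pairs !mem_iota !add0n /fst /snd.
by case: (u < _); case: (v < _); rewrite ?andbF ?andbT.
Qed.

Lemma start_label_cell s k : label (start s) (nst + k) = nth 0 start_cells k.
Proof.
rewrite /label (_ : nst + k = (nend + k).+2) //.
by rewrite -[LHS]/(nth 0 (ends ++ _) _) nth_cat size_map size_iota ltnNge leq_addr addKn.
Qed.

Lemma start_label_end s i : i < nend -> label (start s) i.+2 = EE i.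
Proof.
move=> li; rewrite /label -[LHS]/(nth 0 (ends ++ _) _) nth_cat size_map size_iota li.
by rewrite (nth_map 0) ?size_iota // nth_iota.
Qed.

Lemma start_cellP v : nst <= v < nst + 8 -> exists2 k, k < 8 & v = nst + k.
Proof. by move=> h; exists (v - nst); lia. Qed.

Lemma start_core s : core (start s) start_lay start_lt s READY
  [:: nst; nst + 4; nst + 5] 2.
Proof.
have st2 : 1 < nst by [].
split=> //.
- by rewrite /= leq_addr.
- by rewrite /= size_cat size_map size_iota /nst /=; lia.
- by move=> u v; rewrite start_adj => /and3P[-> ->].
- by move=> u; rewrite mem_cat mem_iota.
- move=> u; rewrite mem_cat !mem_iota !inE => /orP[|/or3P[] /eqP->]; lia.
- move=> t; have H k : k \in [:: 0; 4; 5] ->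
     [&& nst <= nst + k, nst + k < nV (start s) & label (start s) (nst + k) != XX].
    rewrite start_label_cell leq_addr /= ltn_add2l.
    by rewrite !inE => /or3P[] /eqP->; rewrite (inj_eq lab_inj).
  by rewrite !inE => /or3P[] /eqP->; [have := H 0; rewrite addn0; apply|apply: H|apply: H].
- by rewrite /= !inE; lia.
- exact: start_label_end.
- move=> _ /start_cellP[k lk ->]; rewrite start_label_cell /cell_label /start_lay addKn.
  by case: k lk => [|[|[|[|[|[|[|[|]]]]]]]] //= _; rewrite eqxx ?orbT.
- move=> u v su sv; rewrite start_adj => /and3P[_ _ e] _ _.
  have H x z : nst <= x -> nst <= z -> start_edge x z -> start_lay z = (start_lay x).+1.
    move=> sx sz /or4P[/andP[_ /eqP E]|/andP[_ /eqP E]|/and3P[_ /andP[_ l] _]|/and4P[_ _ _ /eqP]] //;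
    lia.
  by case/orP: e => /H E; [right|left]; apply: E.
- move=> _ /start_cellP[k lk ->]; rewrite start_label_cell => kX.
  have k6 : k < 6 by case: k lk kX => [|[|[|[|[|[|[|[|]]]]]]]] //= _; rewrite eqxx.
  exists k => [|i li ki]; first by lia.
  rewrite start_adj /start_edge addKn /= ki /= [_ < nst]ltnNge leq_addr /=.
  rewrite (_ : (5 < k) = false); last by lia.
  rewrite (_ : (nst <= i.+2) = false); last by rewrite /nst; lia.
  by rewrite /= !andbF /=.
- move=> i v li lv; rewrite start_adj /start_edge.
  rewrite (_ : (nst <= i.+2) = false); last by rewrite /nst; lia.
  rewrite (_ : (nst <= v) = false); last by lia.
  by rewrite /= !andbF.
Qed.

Lemma start_web s : web (start s) start_col.
Proof.
split.
- by move=> v; rewrite mem_iota.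
- by rewrite start_adj /start_edge /=; lia.
- by move=> v /andP[sv lv]; rewrite start_adj /start_edge sv /=; rewrite /= in lv; lia.
move=> _ i /start_cellP[k lk ->] li; rewrite start_adj /start_edge /start_col addKn => ki.
rewrite ltn_add2l lk /= leq_addr /= ?addKn.
rewrite (_ : i.+2 < nst + 8); last by rewrite /nst; lia.
rewrite (_ : i.+2 < nst) /=; last by rewrite /nst; lia.
by move: ki; case: ifP => k6 ki; rewrite ?ki ?orbT //= (_ : 5 < k) ?orbT //; lia.
Qed.

Lemma start_ladder s : ladder (start s) start_lay start_lt start_col start_mn 0 2.
Proof.
split.
- move=> a l ll; rewrite /start_mn /start_lay /start_col !addKn leq_addr /= ltn_add2l.
  by case: l ll => [|[|[|]]] //; case: a.
- by move=> a [|[|]] // _; rewrite /start_mn start_label_cell; case: a.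
- by move=> [|[|[|]]] // _; rewrite /start_mn /start_col !addKn.
move=> a b l ll; rewrite start_adj /start_edge /start_mn /start_col !addKn !leq_addr !ltn_add2l /=.
by case: l ll => [|[|]] //; case: a; case: b; rewrite ?orbT.
Qed.

Lemma start_wins W Q B s :
  (forall s b s', (s, b, s') \in W -> b < B) ->
  (forall s a b s', (s, a, b, s') \in Q -> b < B) -> 1 < B ->
  forever W Q (s, [:: 1; 0; 0]) ->
  constructor_wins_safety (start s) (game_rules B W Q).
Proof.
move=> WB QB B1 fo; apply: (constructor_wins WB QB).
have L0 : start_lay nst = 0 by rewrite /start_lay subnn.
exists start_lay, start_lt, start_col, start_mn, s, READY, nst, (nst + 4), (nst + 5), 2.
exists (nst + 6), (nst + 7).
have gd k : 5 < k < 8 -> good (start s) start_col [:: nst; nst + 4; nst + 5] (nst + k).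
  move=> k5; split.
  - by rewrite mem_iota /=; lia.
  - by rewrite mem_cat mem_iota !inE; lia.
  - by rewrite leq_addr.
  by rewrite /= /start_col !addKn subnn !inE (_ : k < 6 = false) //; lia.
split.
- split.
  + exact: start_core.
  + exact: start_web.
  + by rewrite L0; apply: start_ladder.
  + by exists false; rewrite L0 /start_mn addn0.
  + by rewrite /start_col !addKn subnn.
  + by move=> c; rewrite /start_col !addKn subnn !inE => /or3P[] /eqP->.
  + by rewrite /start_lay !addKn.
  + by move=> l; rewrite /start_lt; case: (l == 0) => //; lia.
  + by rewrite L0.
- apply: CReady => //.
  + by rewrite /tok L0 -[nst in label _ nst]addn0 start_label_cell.
  + by split; rewrite ?start_label_cell.
  + by rewrite L0.
  + by move=> a; rewrite L0 /start_col /start_mn !addKn; case: a.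
  + by rewrite L0.
split; [exact: gd|exact: gd|lia].
Qed.

Lemma start_loses W Q B s t : doomed W Q t (s, [:: 1; 0; 0]) ->
  ~ constructor_wins_safety (start s) (game_rules B W Q).
Proof.
move=> dm; apply: (@destructor_wins B W Q (9 * t)).
have L0 : start_lay nst = 0 by rewrite /start_lay subnn.
exists start_lay, start_lt, s, READY, nst, (nst + 4), (nst + 5), 2; split.
  exact: start_core.
apply: PReady; rewrite // ?L0 //.
- by rewrite /tok -[nst]addn0 start_label_cell.
- by rewrite start_label_cell /start_lay addKn.
- by rewrite start_label_cell /start_lay addKn.
Qed.

Lemma start_instance W Q B s : restricted_safety_instance (start s) (game_rules B W Q).
Proof.
have /andP[wf rs] := ladder_rules_ok B W Q.
have C := start_core s.
split=> //.
- apply/and4P; split; last by rewrite (core_size C).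
  + by apply/allP=> u /(web_active (start_web s)).
  + by apply/allP=> u /(core_SA C).
  apply/allP=> [[u v]]; rewrite mem_filter mem_pairs !mem_iota /= => /andP[e /andP[-> ->]] /=.
  apply/eqP=> E; subst v; move: e; rewrite /start_edge.
  have st1 : 1 < nst by [].
  by case/or4P=> [||/and3P[? /andP[_ ?] _]|/and4P[_ _ _]]; lia.
apply: (web_connected C (start_web s) (y := nst + 6)).
- by rewrite /= /start_col !addKn subnn.
- by rewrite mem_iota /=; lia.
- by rewrite leq_addr.
by rewrite /= /start_col !addKn subnn.
Qed.

(** * Counter machines as queue machines *)

(* The value of register [r] is the number of letters [r.+2] in the queue; [1] is an end
   marker that occurs once and [0] is a blank.  State [[:: pc; ph]] executes the instruction
   [pc]; a decrement rotates the queue until it finds its letter or has seen the marker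
   twice ([ph] counts).  State [[:: i]] still has to write [i] letters of input. *)

Definition reg_of (i : instr) : nat := match i with INC r => r | DEC r _ => r end.
(** The sum is a crude bound on every register index; adding 3 leaves room for the letters 0, 1 and
    2 even when the sum is zero. *)
Definition letters (D : seq instr) : nat := sumn (map reg_of D) + 3.

Definition inc_entries (pc : nat) (i : instr) : seq wentry :=
  if i is INC r then [:: ([:: pc; 0], r.+2, [:: pc.+1; 0])] else [::].
Definition dec_entry (pc r j ph a : nat) : rentry :=
  if a == r.+2 then ([:: pc; ph], a, 0, [:: pc.+1; 0])
  else if a == 1 then ([:: pc; ph], a, 1, if ph == 0 then [:: pc; 1] else [:: j; 0])
  else ([:: pc; ph], a, a, [:: pc; ph]).
Definition dec_entries (B pc : nat) (i : instr) : seq rentry :=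
  if i is DEC r j then [seq dec_entry pc r j p.1 p.2 | p <- pairs [:: 0; 1] (iota 0 B)]
  else [::].

Definition prog_w (D : seq instr) : seq wentry :=
  ([:: 0], 0, [:: 0; 0]) ::
  flatten [seq inc_entries pc (nth (INC 0) D pc) | pc <- iota 0 (size D)].
(** Supplying the input by entries makes the initial network depend on [m] only through the label of
    node 0, and the rules only through these entries. The letter 2 stands for register 0. *)
Definition input_entry (i : nat) : wentry := ([:: i.+1], 2, [:: i]).
(** The reversal puts the entry of larger index in front, so that increasing [m] by one is a single
    cons. *)
Definition input_w (m : nat) : seq wentry := [seq input_entry i | i <- rev (iota 0 m)].
Definition machine_w (m : nat) (D : seq instr) : seq wentry := input_w m ++ prog_w D.
Definition machine_q (D : seq instr) : seq rentry :=
  flatten [seq dec_entries (letters D) pc (nth (INC 0) D pc) | pc <- iota 0 (size D)].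

Lemma machine_wP m D e : e \in machine_w m D ->
  [\/ exists2 i, i < m & e = input_entry i, e = ([:: 0], 0, [:: 0; 0]) |
      exists pc r, [/\ pc < size D, nth (INC 0) D pc = INC r &
                       e = ([:: pc; 0], r.+2, [:: pc.+1; 0])]].
Proof.
rewrite mem_cat inE => /or3P[/mapP[i hi ->]|/eqP->|/flatten_mapP[pc hpc]].
- by constructor 1; exists i => //; move: hi; rewrite mem_rev mem_iota.
- by constructor 2.
rewrite mem_iota in hpc; case E: (nth _ D pc) => [r|//].
by rewrite inE => /eqP->; constructor 3; exists pc, r.
Qed.

Lemma machine_qP D e : e \in machine_q D ->
  exists pc r j ph a, [/\ pc < size D, nth (INC 0) D pc = DEC r j, a < letters D &
                       e = dec_entry pc r j ph a].
Proof.
case/flatten_mapP=> pc; rewrite mem_iota => hpc; case E: (nth _ D pc) => [|r j] //.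
case/mapP=> [[ph a]]; rewrite mem_pairs mem_iota => /andP[_ ha] ->.
by exists pc, r, j, ph, a.
Qed.

Lemma reg_letters D pc : pc < size D -> (reg_of (nth (INC 0) D pc)).+2 < letters D.
Proof.
rewrite /letters => lpc; suff : reg_of (nth (INC 0) D pc) <= sumn (map reg_of D) by lia.
elim: D pc lpc => //= i D IH [|pc] /= lpc; first exact: leq_addr.
by apply: leq_trans (IH _ lpc) _; apply: leq_addl.
Qed.

Lemma machine_w_letters m D s b s' : (s, b, s') \in machine_w m D -> b < letters D.
Proof.
case/machine_wP=> [[i _ [_ -> _]]|[_ -> _]|[pc [r [lpc E [_ -> _]]]]].
- by rewrite /letters; lia.
- by rewrite /letters; lia.
by have := reg_letters lpc; rewrite E.
Qed.

Lemma machine_q_letters D s a b s' : (s, a, b, s') \in machine_q D -> b < letters D.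
Proof.
case/machine_qP=> pc [r [j [ph [a' [_ _ la]]]]]; rewrite /dec_entry.
by case: ifP => _; [|case: ifP => _]; case=> _ _ -> _ //; rewrite /letters; lia.
Qed.

Definition machine_next (D : seq instr) (c : conf) : conf :=
  match c with
  | ([:: i], w) => if i is i'.+1 then ([:: i'], rcons w 2) else ([:: 0; 0], rcons w 0)
  | ([:: pc; ph], w) =>
      match nth (INC 0) D pc, w with
      | INC r, _ => ([:: pc.+1; 0], rcons w r.+2)
      | DEC r j, a :: w' => let e := dec_entry pc r j ph a in (e.2, rcons w' e.1.2)
      | _, _ => c
      end
  | _ => c
  end.

Lemma dec_entryE pc r j ph a : (dec_entry pc r j ph a).1.1 = ([:: pc; ph], a).
Proof. by rewrite /dec_entry; case: ifP => // _; case: ifP. Qed.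

Lemma qstep_next m D c c' : qstep (machine_w m D) (machine_q D) c c' -> c' = machine_next D c.
Proof.
case=> [s b s' w /machine_wP[[i _ [-> -> ->]]|[-> -> ->]|[pc [r [lpc E [-> -> ->]]]]] //|].
  by rewrite /= E.
move=> s a b s' w /machine_qP[pc [r [j [ph [a' [_ E _ Ee]]]]]].
have := dec_entryE pc r j ph a'; rewrite -Ee /= => -[-> ?]; subst a'.
by rewrite /= E -Ee.
Qed.

Lemma qstep_halted m D pc w : size D <= pc ->
  ~ exists c, qstep (machine_w m D) (machine_q D) ([:: pc; 0], w) c.
Proof.
move=> le [c /qstep_inv[[b [s' [/machine_wP[[i _ []//]|[]//|[pc' [r [lpc _ [E _ _]]]]] _]]]|]].
  by rewrite E in le; rewrite ltnNge le in lpc.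
case=> a [b [s' [w' [_ /machine_qP[pc' [r [j [ph [a' [lpc _ _ E]]]]]] _]]]].
have := dec_entryE pc' r j ph a'; rewrite -E => -[? _ _]; subst pc'.
by rewrite ltnNge le in lpc.
Qed.

Fixpoint runs (W : seq wentry) (Q : seq rentry) (n : nat) (c c' : conf) : Prop :=
  if n is n'.+1 then exists2 c1, qstep W Q c c1 & runs W Q n' c1 c' else c = c'.

Lemma runs_trans W Q n n' c c' c'' : runs W Q n c c' -> runs W Q n' c' c'' ->
  runs W Q (n + n') c c''.
Proof.
elim: n c => [|n IH] c /=; first by move=> ->.
by case=> c1 st r1 r2; exists c1 => //; apply: IH r2.
Qed.

(** The machine is deterministic by [qstep_next], so one halting run bounds all runs. *)
Lemma runs_doomed m D n c c' : runs (machine_w m D) (machine_q D) n c c' ->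
  ~ (exists c'', qstep (machine_w m D) (machine_q D) c' c'') ->
  doomed (machine_w m D) (machine_q D) n c.
Proof.
elim: n c => [|n IH] c /=; first by move=> -> st c2 s; apply: st; exists c2.
case=> c1 st r nst c2 /qstep_next->; rewrite -(qstep_next st); exact: IH.
Qed.

Lemma forever_of_progress W Q (P : conf -> Prop) :
  (forall c, P c -> exists2 c', qstep W Q c c' & P c') -> forall c, P c -> forever W Q c.
Proof.
move=> H c Pc; pose nx c := epsilon (inhabits c) (fun c' => qstep W Q c c' /\ P c').
have nxP c1 : P c1 -> qstep W Q c1 (nx c1) /\ P (nx c1).
  move=> /H[c' st p].
  by apply: (epsilon_spec (inhabits c1) (fun c' => qstep W Q c1 c' /\ P c')); exists c'.
have it n : P (iter n nx c) by elim: n => //= n /nxP[].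
by exists (fun n => iter n nx c); split=> // n; case: (nxP _ (it n)).
Qed.

Section Simulation.
Variables (m : nat) (D : seq instr).
Let W := machine_w m D.
Let Q := machine_q D.
Let B := letters D.

(** Only the numbers of letters count, so every rotation of the queue represents the same
    registers. *)
Definition simulates (c : cm_config) (q : conf) : Prop :=
  [/\ q.1 = [:: c.1; 0], count_mem 1 q.2 = 1,
      forall r, r.+2 < B -> count_mem r.+2 q.2 = nth 0 c.2 r & all (fun a => a < B) q.2].

Lemma dec_step pc r j ph a w : pc < size D -> nth (INC 0) D pc = DEC r j -> ph < 2 -> a < B ->
  let e := dec_entry pc r j ph a in
  qstep W Q ([:: pc; ph], a :: w) (e.2, rcons w e.1.2).
Proof.
move=> lpc E lph la e; apply: QR; have := dec_entryE pc r j ph a; rewrite -/e.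
case Ee : e => [[[s a'] b] s'] /= [<- <-]; rewrite -Ee.
apply/flatten_mapP; exists pc; rewrite ?mem_iota // E.
apply/mapP; exists (ph, a) => //; rewrite mem_pairs mem_iota la.
by case: ph lph {e Ee} => [|[|]].
Qed.

Lemma dec_rotate pc r j ph u v : pc < size D -> nth (INC 0) D pc = DEC r j -> ph < 2 ->
  all (fun a => [&& a < B, a != 1 & a != r.+2]) u ->
  runs W Q (size u) ([:: pc; ph], u ++ v) ([:: pc; ph], v ++ u).
Proof.
move=> lpc E lph; elim: u v => [|a u IH] v /=; first by rewrite cats0.
case/andP=> /and3P[la a1 ar] au; have r1 v' := IH v' au.
exists ([:: pc; ph], rcons (u ++ v) a).
  by have := dec_step (u ++ v) lpc E lph la; rewrite /dec_entry (negbTE a1) (negbTE ar).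
by have := r1 (v ++ [:: a]); rewrite catA cats1 -catA.
Qed.

Lemma dec_found pc r j ph u v : pc < size D -> nth (INC 0) D pc = DEC r j -> ph < 2 ->
  all (fun a => [&& a < B, a != 1 & a != r.+2]) u ->
  exists n, runs W Q n.+1 ([:: pc; ph], u ++ r.+2 :: v) ([:: pc.+1; 0], v ++ u ++ [:: 0]).
Proof.
move=> lpc E lph au; exists (size u); rewrite -addn1.
apply: runs_trans (dec_rotate _ lpc E lph au) _.
have lr : r.+2 < B by have := reg_letters lpc; rewrite E.
have := dec_step (v ++ u) lpc E lph lr; rewrite /dec_entry eqxx /= => st.
by exists ([:: pc.+1; 0], v ++ u ++ [:: 0]); rewrite // catA cats1.
Qed.

Lemma dec_marker pc r j ph u v : pc < size D -> nth (INC 0) D pc = DEC r j -> ph < 2 ->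
  all (fun a => [&& a < B, a != 1 & a != r.+2]) u ->
  exists n, runs W Q n.+1 ([:: pc; ph], u ++ 1 :: v)
    (if ph == 0 then [:: pc; 1] else [:: j; 0], v ++ u ++ [:: 1]).
Proof.
move=> lpc E lph au; exists (size u); rewrite -addn1.
apply: runs_trans (dec_rotate _ lpc E lph au) _.
have lr : 1 < B by rewrite /B /letters; lia.
have := dec_step (v ++ u) lpc E lph lr; rewrite /dec_entry /= => st.
by exists (if ph == 0 then [:: pc; 1] else [:: j; 0], v ++ u ++ [:: 1]); rewrite // catA cats1.
Qed.

Lemma split_first (p : pred nat) w : has p w ->
  exists u x v, [/\ w = u ++ x :: v, p x & all (predC p) u].
Proof.
elim: w => //= a w IH; case pa: (p a) => /=.
  by exists [::], a, w.
by case/IH=> u [x [v [-> px au]]]; exists (a :: u), x, v; rewrite /= pa.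
Qed.

(** A zero test needs two sightings of the marker, since the marker may be anywhere in the queue and
    only between two sightings is the whole queue inspected. At least one queue step is made, so an
    endless computation yields an endless run. *)
Lemma simulate_step c q : simulates c q -> c.1 < size D ->
  exists n q', runs W Q n.+1 q q' /\ simulates (cm_step D c) q'.
Proof.
case: c => pc regs; case: q => _ w [/= -> c1 cr al] lpc.
rewrite lpc; case E: (nth (INC 0) D pc) => [r|r j].
  have lr : r.+2 < B by have := reg_letters lpc; rewrite E.
  exists 0, ([:: pc.+1; 0], rcons w r.+2); split.
    exists ([:: pc.+1; 0], rcons w r.+2) => //; apply: QW.
    rewrite mem_cat inE; apply/orP; right; apply/orP; right.
    by apply/flatten_mapP; exists pc; rewrite ?mem_iota // E inE.
  split=> //=; rewrite -cats1 ?count_cat ?c1 ?all_cat ?al //= ?lr //.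
  move=> r' lr'; rewrite count_cat cr //= nth_set_nth /= addn0 !eqSS.
  by rewrite eq_sym; case: eqP => [->|_]; rewrite ?addn1 ?addn0.
have lr : r.+2 < B by have := reg_letters lpc; rewrite E.
have /split_first[u [x [v [Ew px au]]]] : has (pred2 1 r.+2) w.
  by apply/hasP; exists 1; rewrite //= -has_pred1 has_count c1.
have au' : all (fun a => [&& a < B, a != 1 & a != r.+2]) u.
  apply/allP=> a au1; have := allP au a au1; rewrite /= negb_or => ->.
  by rewrite (allP al) // Ew mem_cat au1.
have found ph u1 v1 : ph < 2 -> all (fun a => [&& a < B, a != 1 & a != r.+2]) u1 ->
    perm_eq w (u1 ++ r.+2 :: v1) -> exists n q',
    runs W Q n.+1 ([:: pc; ph], u1 ++ r.+2 :: v1) q' /\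
    simulates match nth 0 regs r with 0 => (j, regs) | k.+1 => (pc.+1, set_nth 0 regs r k) end q'.
  move=> lph au1 pw; have [n rn] := dec_found v1 lpc E lph au1.
  exists n, ([:: pc.+1; 0], v1 ++ u1 ++ [:: 0]); split=> //.
  have cnt a : count_mem a w = count_mem a u1 + ((r.+2 == a) + count_mem a v1).
    by move/permP: pw => ->; rewrite count_cat.
  have := cnt r.+2; rewrite cr // eqxx.
  case Er : (nth 0 regs r) => [|k] ck; first by lia.
  split=> //=.
  - by have := cnt 1; rewrite c1 !count_cat /=; lia.
  - move=> r' lr'; rewrite nth_set_nth /= !count_cat /=.
    have [E'|ne] := eqVneq r' r; first by move: ck; rewrite E' add1n addnS !addn0 addnC => -[].
    by have := cnt r'.+2; rewrite cr // !eqSS eq_sym (negbTE ne) add0n !addn0 addnC.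
  have := al; rewrite (perm_all _ pw) !all_cat /= => /and3P[-> _ ->].
  by rewrite /B /letters; lia.
case/orP: px => /eqP Ex; subst x; last first.
  by have [||n [q' [rn sm]]] := found 0 u v _ au'; rewrite ?Ew //; exists n, q'.
(* The marker came first. It now sits at the end of [v ++ u ++ [:: 1]], so the second search passes
   over all other letters. *)
have [n1 r1] := dec_marker v lpc E (isT : 0 < 2) au'.
have n1u : 1 \notin v ++ u.
  rewrite -has_pred1 has_count -leqNgt leqn0 count_cat.
  by move: c1; rewrite Ew count_cat /=; lia.
have pw : perm_eq w (v ++ u ++ [:: 1]).
  by rewrite Ew catA cats1 perm_sym perm_rcons -cat_cons perm_catC.
have [hr|hr] := boolP (r.+2 \in v ++ u).
  have /split_first[u1 [x [v1 [Ew1 /eqP Ex au1]]]] : has (pred1 r.+2) (v ++ u).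
    by rewrite has_pred1.
  subst x.
  have au1' : all (fun a => [&& a < B, a != 1 & a != r.+2]) u1.
    apply/allP=> a aa; have := allP au1 a aa; rewrite /= => ->; rewrite andbT.
    have ain : a \in v ++ u by rewrite Ew1 mem_cat aa.
    apply/andP; split; last by apply: contraNneq n1u => <-.
    by apply: (allP al); rewrite (perm_mem pw) catA mem_cat ain.
  have Ez : v ++ u ++ [:: 1] = u1 ++ r.+2 :: (v1 ++ [:: 1]) by rewrite catA Ew1 -catA.
  have [||n2 [q' [r2 sm]]] := found 1 u1 (v1 ++ [:: 1]) _ au1'; rewrite -?Ez //.
  rewrite -Ez in r2; exists (n1 + n2.+1), q'; split=> //; rewrite Ew; exact (runs_trans r1 r2).
have avu : all (fun a => [&& a < B, a != 1 & a != r.+2]) (v ++ u).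
  apply/allP=> a aa; apply/and3P; split.
  - by apply: (allP al); rewrite (perm_mem pw) catA mem_cat aa.
  - by apply: contraNneq n1u => <-.
  by apply: contraNneq hr => <-.
have [n2 r2] := dec_marker [::] lpc E (isT : 1 < 2) avu.
have reg0 : nth 0 regs r = 0.
  rewrite -cr //; move/permP: pw => ->; rewrite catA count_cat /= !addn0.
  by apply/eqP; rewrite -leqn0 leqNgt -has_count has_pred1.
rewrite reg0; exists (n1 + n2.+1), ([:: j; 0], [::] ++ (v ++ u) ++ [:: 1]); split.
  by rewrite -catA in r2; rewrite Ew -catA; exact (runs_trans r1 r2).
have pw' : perm_eq w ((v ++ u) ++ [:: 1]) by rewrite -catA.
split=> //=.
- by rewrite -[RHS]c1; move/permP: pw' => ->.
- by move=> r' lr'; rewrite -cr //; move/permP: pw' => ->.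
by rewrite -(perm_all _ pw').
Qed.

Lemma input_runs : exists n w,
  runs W Q n ([:: m], [:: 1; 0; 0]) ([:: 0; 0], w) /\ simulates (0, [:: m]) ([:: 0; 0], w).
Proof.
have H i w : i <= m -> runs W Q i ([:: i], w) ([:: 0], w ++ nseq i 2).
  elim: i w => [|i IH] w lim; first by rewrite cats0.
  exists ([:: i], rcons w 2).
    apply: QW; rewrite mem_cat; apply/orP; left; apply/mapP; exists i => //.
    by rewrite mem_rev mem_iota.
  have := IH (rcons w 2) (ltnW lim).
  by rewrite -cats1 -catA /=.
exists (m + 1), ([:: 1; 0; 0] ++ nseq m 2 ++ [:: 0]); split.
  apply: runs_trans (H m _ (leqnn m)) _; exists ([:: 0; 0], rcons ([:: 1; 0; 0] ++ nseq m 2) 0).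
    by apply: QW; rewrite mem_cat inE eqxx orbT.
  by rewrite /= cats1.
have B2 : 2 < B by rewrite /B /letters; lia.
split=> //=.
- by rewrite !count_cat count_nseq.
- move=> r lr; rewrite !count_cat count_nseq /= !add0n !addn0 !eqSS.
  by case: r lr => [|[|r]] _; rewrite /= ?mul1n.
by rewrite all_cat all_nseq /= B2 orbT /= (ltn_trans _ B2) // (ltn_trans _ B2).
Qed.

Lemma simulate_halt : (exists k, cm_halted D (cm_run D k (0, [:: m]))) ->
  exists t, doomed W Q t ([:: m], [:: 1; 0; 0]).
Proof.
case=> k hk; have [n0 [w0 [r0 s0]]] := input_runs.
have H : forall k c q, simulates c q -> cm_halted D (cm_run D k c) ->
    exists n q', [/\ runs W Q n q q' & ~ exists q'', qstep W Q q' q''].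
  elim=> [|k' IH] c q sm hl.
    exists 0, q; split=> //; case: q sm => s w [/= -> _ _ _].
    by apply: qstep_halted.
  have [hc|nc] := leqP (size D) c.1.
    exists 0, q; split=> //; case: q sm => s w [/= -> _ _ _].
    by apply: qstep_halted.
  have [n1 [q1 [r1 s1]]] := simulate_step sm nc.
  have [|n2 [q2 [r2 st]]] := IH _ _ s1; first by rewrite /cm_run -iterSr.
  by exists (n1.+1 + n2), q2; split=> //; apply: runs_trans r1 r2.
have [n1 [q1 [r1 st]]] := H _ _ _ s0 hk.
by exists (n0 + n1); apply: runs_doomed (runs_trans r0 r1) st.
Qed.

Lemma simulate_loop : ~ (exists k, cm_halted D (cm_run D k (0, [:: m]))) ->
  forever W Q ([:: m], [:: 1; 0; 0]).
Proof.
move=> nh; have [n0 [w0 [r0 s0]]] := input_runs.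
(* Progress is needed also inside a simulated instruction, so [P] only asks for a simulating
   configuration ahead. Once it is reached, [simulate_step] offers the next one. *)
pose P q := exists n q' k, runs W Q n q q' /\ simulates (cm_run D k (0, [:: m])) q'.
apply: (@forever_of_progress _ _ P); last by exists n0, ([:: 0; 0], w0), 0.
move=> q [[|n] [q' [k [rn sm]]]]; last first.
  by case: rn => q1 st r1; exists q1 => //; exists n, q', k.
have nk : (cm_run D k (0, [:: m])).1 < size D.
  by rewrite ltnNge; apply/negP=> hk; apply: nh; exists k.
have [n1 [q1 [[q2 st r2] s1]]] := simulate_step sm nk.
rewrite rn; exists q2 => //; exists n1, q1, k.+1; split=> //.
Qed.
End Simulation.

(** * Loop programs on counter machines *)

Definition upd (f : nat -> nat) (r x : nat) : nat -> nat := fun i => if i == r then x else f i.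

Lemma updE f r x i : upd f r x i = if i == r then x else f i.
Proof. by []. Qed.

(** Register lists are compared as functions, since lists that differ by trailing zeros describe the
    same state. *)
Definition reach (D : seq instr) (pc : nat) (f : nat -> nat) (pc' : nat) (f' : nat -> nat) :
    Prop :=
  forall regs, nth 0 regs =1 f ->
  exists k regs', cm_run D k (pc, regs) = (pc', regs') /\ nth 0 regs' =1 f'.

Lemma reach_refl D pc f f' : f =1 f' -> reach D pc f pc f'.
Proof. by move=> E regs Er; exists 0, regs; split=> // i; rewrite Er. Qed.

Lemma reach_trans D pc1 f1 pc2 f2 pc3 f3 :
  reach D pc1 f1 pc2 f2 -> reach D pc2 f2 pc3 f3 -> reach D pc1 f1 pc3 f3.
Proof.
move=> r1 r2 regs /r1[k1 [regs1 [E1 /r2[k2 [regs2 [E2 e2]]]]]].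
by exists (k2 + k1), regs2; rewrite /cm_run iterD -/(cm_run D k1 _) E1.
Qed.

Lemma reach_ext D pc f1 f2 pc' f1' f2' : f2 =1 f1 -> f1' =1 f2' ->
  reach D pc f1 pc' f1' -> reach D pc f2 pc' f2'.
Proof.
move=> e1 e2 r regs er; have [|k [regs' [E e]]] := r regs; first by move=> i; rewrite er e1.
by exists k, regs'; split=> // i; rewrite e e2.
Qed.

Lemma reach_inc D pc f r : pc < size D -> nth (INC 0) D pc = INC r ->
  reach D pc f pc.+1 (upd f r (f r).+1).
Proof.
move=> lpc E regs er; exists 1, (set_nth 0 regs r (nth 0 regs r).+1).
split; first by rewrite /= lpc E.
by move=> i; rewrite nth_set_nth /= /upd !er.
Qed.

Lemma reach_dec0 D pc f r j : pc < size D -> nth (INC 0) D pc = DEC r j -> f r = 0 ->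
  reach D pc f j f.
Proof.
by move=> lpc E f0 regs er; exists 1, regs; split=> //=; rewrite lpc E er f0.
Qed.

Lemma reach_dec D pc f r j k : pc < size D -> nth (INC 0) D pc = DEC r j -> f r = k.+1 ->
  reach D pc f pc.+1 (upd f r k).
Proof.
move=> lpc E fk regs er; exists 1, (set_nth 0 regs r k).
split; first by rewrite /= lpc E er fk.
by move=> i; rewrite nth_set_nth /= /upd er.
Qed.

Inductive prog :=
  | PSkip
  | PInc of nat
  | PSeq of prog & prog
  | PLoop of nat & prog.

Fixpoint psize (p : prog) : nat :=
  match p with
  | PSkip => 0
  | PInc _ => 1
  | PSeq p q => psize p + psize q
  | PLoop _ p => (psize p).+2
  end.

(* Register [1] is kept at [0], so that [DEC 1] is an unconditional jump. *)
Fixpoint compile (o : nat) (p : prog) : seq instr :=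
  match p with
  | PSkip => [::]
  | PInc r => [:: INC r]
  | PSeq p q => compile o p ++ compile (o + psize p) q
  | PLoop r p => DEC r (o + (psize p).+2) :: rcons (compile o.+1 p) (DEC 1 o)
  end.

Lemma size_compile o p : size (compile o p) = psize p.
Proof.
elim: p o => //= [p IHp q IHq|r p IHp] o; first by rewrite size_cat IHp IHq.
by rewrite size_rcons IHp.
Qed.

Definition located (D : seq instr) (o : nat) (c : seq instr) : Prop :=
  forall i, i < size c -> o + i < size D /\ nth (INC 0) D (o + i) = nth (INC 0) c i.

Lemma located_cat D o c1 c2 : located D o (c1 ++ c2) ->
  located D o c1 /\ located D (o + size c1) c2.
Proof.
move=> H; split=> i li.
  by have [|h1 h2] := H i; rewrite ?size_cat ?ltn_addr // h2 nth_cat li.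
have [|h1 h2] := H (size c1 + i); first by rewrite size_cat ltn_add2l.
by rewrite -addnA; split=> //; rewrite h2 nth_cat ltnNge leq_addr addKn.
Qed.

Definition computes (p : prog) (f f' : nat -> nat) : Prop :=
  forall D o, located D o (compile o p) -> reach D o f (o + psize p) f'.

Lemma computes_ext p f1 f2 f1' f2' : f2 =1 f1 -> f1' =1 f2' ->
  computes p f1 f1' -> computes p f2 f2'.
Proof. by move=> e1 e2 c D o l; apply: reach_ext e1 e2 (c D o l). Qed.

Lemma computes_eq p f1 f2 f1' f2' : computes p f1 f1' -> f2 =1 f1 -> f1' =1 f2' ->
  computes p f2 f2'.
Proof. by move=> c e1 e2; apply: computes_ext e1 e2 c. Qed.

Lemma computes_skip f : computes PSkip f f.
Proof. by move=> D o _; rewrite addn0; apply: reach_refl. Qed.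

Lemma computes_inc f r : computes (PInc r) f (upd f r (f r).+1).
Proof.
move=> D o l; have [//|h1 h2] := l 0; rewrite addn0 in h1 h2.
by rewrite addn1; apply: reach_inc.
Qed.

Lemma computes_seq p q f1 f2 f3 : computes p f1 f2 -> computes q f2 f3 ->
  computes (PSeq p q) f1 f3.
Proof.
move=> c1 c2 D o /= /located_cat[l1 l2]; rewrite size_compile in l2.
by rewrite addnA; apply: reach_trans (c1 _ _ l1) (c2 _ _ l2).
Qed.

(** [F k] is the state after [k] rounds; the body starts from it with the counter already
    decremented. Register 1 must be 0 after each round for the jump back. *)
Lemma computes_loop r p n (F : nat -> nat -> nat) :
  (forall k, k <= n -> F k r = n - k) -> (forall k, k <= n -> F k 1 = 0) ->
  (forall k, k < n -> computes p (upd (F k) r (n - k.+1)) (F k.+1)) ->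
  computes (PLoop r p) (F 0) (F n).
Proof.
move=> Fr F1 H D o l.
have [//|h1 h2] := l 0; rewrite addn0 /= in h1 h2.
have l1 : located D o.+1 (rcons (compile o.+1 p) (DEC 1 o)).
  by move=> i li; have := l i.+1; rewrite addnS => /(_ li).
rewrite -cats1 in l1; have [{}l1 l2] := located_cat l1.
have [//|h3 h4] := l2 0; rewrite addn0 size_compile /= in h3 h4.
have R k : k <= n -> reach D o (F 0) o (F k).
  elim: k => [|k IH] lk; first exact: reach_refl.
  apply: reach_trans (IH (ltnW lk)) _.
  apply: reach_trans (reach_dec h1 h2 (_ : F k r = (n - k.+1).+1)) _.
    by rewrite Fr; lia.
  apply: reach_trans (H k lk _ _ l1) _.
  exact: reach_dec0 h3 h4 (F1 _ lk).
apply: reach_trans (R n (leqnn n)) _; apply: reach_dec0 h1 h2 _.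
by rewrite Fr // subnn.
Qed.

Lemma computes_clear r f : f 1 = 0 -> r != 1 -> computes (PLoop r PSkip) f (upd f r 0).
Proof.
move=> f1 r1; apply: (@computes_ext _ (upd f r (f r - 0)) _ (upd f r (f r - f r))).
- by move=> i; rewrite updE subn0; case: eqP => [->|].
- by move=> i; rewrite subnn.
apply: (@computes_loop r PSkip (f r) (fun k => upd f r (f r - k))) => k lk.
- by rewrite updE eqxx.
- by rewrite updE eq_sym (negbTE r1).
refine (computes_eq (@computes_skip _) _ _) => //.
by move=> i; rewrite !updE; case: eqP.
Qed.

Lemma computes_move r d f : f 1 = 0 -> r != 1 -> d != 1 -> r != d ->
  computes (PLoop r (PInc d)) f (upd (upd f r 0) d (f d + f r)).
Proof.
move=> f1 r1 d1 rd; pose F k := upd (upd f r (f r - k)) d (f d + k).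
apply: (@computes_ext _ (F 0) _ (F (f r))).
- move=> i; rewrite /F !updE subn0 addn0.
  by case: eqP => [->//|_]; case: eqP => [->|].
- by move=> i; rewrite /F !updE subnn.
apply: (@computes_loop r _ (f r) F) => k lk; rewrite /F.
- by rewrite !updE (negbTE rd) eqxx.
- by rewrite !updE ![1 == _]eq_sym (negbTE r1) (negbTE d1).
refine (computes_eq (@computes_inc _ _) _ _); first by [].
move=> i; rewrite !updE eqxx; case: (eqVneq i d) => [_|id].
  by rewrite eq_sym (negbTE rd) addnS.
by case: eqP.
Qed.

(** The scratch register is [d.+2] because [d.+1] holds the exponent while [cexpr] doubles in a
    loop. *)
Lemma computes_double d f : f 1 = 0 -> 1 < d -> f d.+2 = 0 ->
  computes (PSeq (PLoop d (PSeq (PInc d.+2) (PInc d.+2))) (PLoop d.+2 (PInc d)))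
    f (upd f d (f d).*2).
Proof.
move=> f1 d1 f2; pose F k := upd (upd f d (f d - k)) d.+2 k.*2.
have nd : (d.+2 == d) = false by lia.
have nd' : (d == d.+2) = false by lia.
have n1 : (1 == d.+2) = false by lia.
have n1' : (1 == d) = false by lia.
apply: (@computes_seq _ _ _ (F (f d))).
  apply: (@computes_ext _ (F 0) _ (F (f d))) => //.
    move=> i; rewrite /F !updE subn0.
    by case: eqP => [->//|_]; case: eqP => [->|].
  apply: (@computes_loop d _ (f d) F) => k lk; rewrite /F.
  - by rewrite !updE nd' eqxx.
  - by rewrite !updE n1 n1'.
  apply: computes_seq (@computes_inc _ _) _; refine (computes_eq (@computes_inc _ _) _ _) => //.
  move=> i; rewrite !updE !eqxx nd; case: (eqVneq i d.+2) => [_|id].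
    by rewrite doubleS.
  by case: eqP.
have F1 : F (f d) 1 = 0 by rewrite /F !updE n1 n1'.
have [h1 h2 h3] : [/\ d.+2 != 1, d != 1 & d.+2 != d] by split; lia.
refine (computes_eq (computes_move F1 h1 h2 h3) _ _) => //.
move=> i; rewrite /F !updE nd' !eqxx subnn; case: (eqVneq i d) => [//|_].
by case: eqP => [->|].
Qed.

(** * Arithmetic expressions evaluated by loop programs *)

Inductive expr :=
  | ECst of nat
  | EVar of nat
  | ESucc of expr
  | ECons of expr & expr.

(** The step of [CodeSeq.code] on a cons. The empty list has code 0, so [ECons] and [ECst 0] build
    the codes of all lists. *)
Definition cons_code (a v : nat) : nat := 2 ^ a * v.*2.+1.

Fixpoint eval (f : nat -> nat) (e : expr) : nat :=
  match e with
  | ECst n => n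
  | EVar x => f x
  | ESucc e => (eval f e).+1
  | ECons a v => cons_code (eval f a) (eval f v)
  end.

Fixpoint vars_below (d : nat) (e : expr) : bool :=
  match e with
  | ECst _ => true
  | EVar x => (x < d) && (x != 1)
  | ESucc e => vars_below d e
  | ECons a v => vars_below d a && vars_below d v
  end.

Definition pdouble (d : nat) : prog :=
  PSeq (PLoop d (PSeq (PInc d.+2) (PInc d.+2))) (PLoop d.+2 (PInc d)).

(** A stack discipline: the result goes to [d], registers above [d] are scratch and end at 0, those
    below are preserved. Since loops consume their counter, a variable is copied twice and then
    restored. *)
Fixpoint cexpr (d : nat) (e : expr) : prog :=
  match e with
  | ECst n => iter n (fun p => PSeq p (PInc d)) PSkip
  | EVar x => PSeq (PLoop x (PSeq (PInc d) (PInc d.+1))) (PLoop d.+1 (PInc x))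
  | ESucc e => PSeq (cexpr d e) (PInc d)
  | ECons a v => PSeq (cexpr d v) (PSeq (cexpr d.+1 a)
      (PSeq (PSeq (pdouble d) (PInc d)) (PLoop d.+1 (pdouble d))))
  end.

Lemma eval_ext f f' d e : vars_below d e -> (forall i, i < d -> f i = f' i) ->
  eval f e = eval f' e.
Proof.
move=> + E; elim: e => //= [x /andP[lx _]|e IH|a IHa v IHv]; first exact: E.
  by move=> /IH->.
by case/andP=> /IHa-> /IHv->.
Qed.

Lemma vars_belowW d e : vars_below d e -> vars_below d.+1 e.
Proof.
elim: e => //= [x /andP[lx ->]|a IHa v IHv]; first by rewrite ltnW.
by case/andP=> /IHa-> /IHv->.
Qed.

Lemma computes_expr d e f : f 1 = 0 -> 1 < d -> vars_below d e ->
  (forall i, d <= i -> f i = 0) -> computes (cexpr d e) f (upd f d (eval f e)).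
Proof.
elim: e d f => [n|x|e IH|a IHa v IHv] d f f1 d1 /= vb z.
- apply: (@computes_ext _ f _ (upd f d (f d + n))) => //.
    by move=> i; rewrite z.
  elim: n => [|n IHn]; first by rewrite addn0; refine (computes_eq (@computes_skip f) _ _) => // i;
    rewrite updE; case: eqP => [->|].
  apply: computes_seq IHn _; refine (computes_eq (@computes_inc _ _) _ _) => //.
  by move=> i; rewrite !updE eqxx addnS; case: eqP.
- case/andP: vb => lx x1.
  have [xd xd' dd dd'] :
      [/\ (x == d) = false, (x == d.+1) = false, (d == d.+1) = false & (d.+1 == d) = false] by split; lia.
  have [dx d'x n1 n1'] :
      [/\ (d == x) = false, (d.+1 == x) = false, (1 == d) = false & (1 == d.+1) = false] by split; lia.
  pose F k := upd (upd (upd f x (f x - k)) d k) d.+1 k.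
  apply: (@computes_seq _ _ _ (F (f x))).
    apply: (@computes_ext _ (F 0) _ (F (f x))) => //.
      move=> i; rewrite /F !updE subn0; case: eqP => [->|_]; first by rewrite z.
      by case: eqP => [->|_]; [rewrite z|case: eqP => [->|]].
    apply: (@computes_loop x _ (f x) F) => k lk; rewrite /F.
    + by rewrite !updE xd xd' eqxx.
    + by rewrite !updE n1 n1' eq_sym (negbTE x1).
    apply: computes_seq (@computes_inc _ _) _; refine (computes_eq (@computes_inc _ _) _ _) => //.
    move=> i; rewrite !updE !eqxx ?dx ?d'x ?dd ?dd' ?eqxx.
    case: (eqVneq i d.+1) => // _; case: (eqVneq i d) => // _; by case: eqP.
  have F1 : F (f x) 1 = 0 by rewrite /F !updE n1 n1' eq_sym (negbTE x1).
  have [h1 h2] : d.+1 != 1 /\ d.+1 != x by rewrite d'x eq_sym n1'.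
  refine (computes_eq (computes_move F1 h1 x1 h2) _ _) => // i.
  rewrite /F !updE xd xd' !eqxx subnn add0n.
  case: (eqVneq i x) => [->|ix]; first by rewrite xd.
  by case: (eqVneq i d.+1) => [->|_]; first by rewrite dd' z.
- apply: computes_seq (IH d f f1 d1 vb z) _; refine (computes_eq (@computes_inc _ _) _ _) => //.
  by move=> i; rewrite !updE eqxx; case: eqP.
case/andP: vb => vba vbv.
have [dd dd' d2 d2'] :
    [/\ (d == d.+1) = false, (d.+1 == d) = false, (d.+2 == d) = false &
      (d.+2 == d.+1) = false] by split; lia.
have [n1 n1'] : (1 == d) = false /\ (1 == d.+1) = false by lia.
apply: computes_seq (IHv d f f1 d1 vbv z) _.
set x := eval f v; set y := eval f a.
pose g z1 z2 := upd (upd f d z1) d.+1 z2.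
have g1 z1 z2 : g z1 z2 1 = 0 by rewrite /g !updE n1 n1'.
have gd z1 z2 : g z1 z2 d = z1 by rewrite /g !updE dd eqxx.
have gd2 z1 z2 : g z1 z2 d.+2 = 0 by rewrite /g !updE d2 d2' z // -addn2 leq_addr.
apply: (@computes_seq _ _ _ (g x y)).
  have u1 : upd f d x 1 = 0 by rewrite updE n1.
  have uz i : d < i -> upd f d x i = 0.
    by move=> li; rewrite updE (_ : i == d = false) ?z //; lia.
  refine (computes_eq (IHa d.+1 (upd f d x) u1 (ltnW d1) (vars_belowW vba) uz) _ _) => // i.
  rewrite /g !updE; case: eqP => // _.
  by apply: (eval_ext vba) => j lj; rewrite updE ltn_eqF.
have dbl z1 z2 : computes (pdouble d) (g z1 z2) (g z1.*2 z2).
  refine (computes_eq (computes_double (g1 z1 z2) d1 (gd2 z1 z2)) _ _) => // i.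
  by rewrite updE gd /g !updE; case: (eqVneq i d) => [->|//]; rewrite dd.
apply: (@computes_seq _ _ _ (g x.*2.+1 y)).
  apply: computes_seq (dbl _ _) _; refine (computes_eq (@computes_inc _ _) _ _) => // i.
  by rewrite updE gd /g !updE; case: (eqVneq i d) => [->|//]; rewrite dd.
pose F k := g (2 ^ k * x.*2.+1) (y - k).
apply: (@computes_ext _ (F 0) _ (F y)).
- by move=> i; rewrite /F expn0 mul1n subn0.
- move=> i; rewrite /F subnn /g /cons_code !updE; case: (eqVneq i d.+1) => [->|//].
  by rewrite dd' z.
apply: (@computes_loop d.+1 _ y F) => k lk; rewrite /F.
- by rewrite /g updE eqxx.
- by rewrite g1.
refine (computes_eq (dbl (2 ^ k * x.*2.+1) (y - k.+1)) _ _) => i; rewrite /g !updE.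
  by case: eqP.
by rewrite expnS -mulnA mul2n.
Qed.

(** * A counter machine that computes the code of its own game *)

Lemma pickle_pair (S T : countType) (x : S) (y : T) :
  pickle (x, y) = lab [:: pickle x; pickle y].
Proof. by []. Qed.

Lemma pickle_seqE (T : countType) (s : seq T) : pickle s = lab (map pickle s).
Proof. by []. Qed.

Lemma pickle_inr (S T : countType) (y : T) :
  pickle (inr y : S + T) = lab [:: 0; lab [:: pickle y]].
Proof. by []. Qed.

Lemma pickle_nats (s : seq nat) : pickle s = lab s.
Proof. by rewrite pickle_seqE -[in RHS](map_id s). Qed.

Lemma lab_cons a l : lab (a :: l) = cons_code a (lab l).
Proof. by []. Qed.

Arguments cons_code : simpl never.

Lemma eq_lab1 a a' : a = a' -> lab [:: a] = lab [:: a'].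
Proof. by move=> ->. Qed.

Lemma eq_lab2 a a' b b' : a = a' -> b = b' -> lab [:: a; b] = lab [:: a'; b'].
Proof. by move=> -> ->. Qed.

Definition pair_expr (a b : expr) : expr := ECons a (ECons b (ECst 0)).
Definition kap_expr (e : expr) : expr := pair_expr (ECst 0) e.

(** The register occurs only in the two state labels; everything else, the list of endpoints
    included, is a constant of the program. *)
Definition input_rule_expr (x : nat) : expr :=
  let pre := ECons (ECst READY) (ECons (kap_expr (ESucc (EVar x))) (ECst (lab ends))) in
  let post := ECons (ECst (WR 2 0)) (ECons (kap_expr (EVar x)) (ECst (lab ends))) in
  pair_expr (ECst 0)
    (ECons (pair_expr (pair_expr (pair_expr (ECst (pickle false)) pre) (ECst XX)) post) (ECst 0)).

Lemma eval_pair f a b : eval f (pair_expr a b) = lab [:: eval f a; eval f b].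
Proof. by []. Qed.

Lemma eval_single f a : eval f (ECons a (ECst 0)) = lab [:: eval f a].
Proof. by []. Qed.

Lemma eval_input_rule f x :
  eval f (input_rule_expr x) = pickle (enc_rule (startw (input_entry (f x)))).
Proof.
have E : enc_rule (startw (input_entry (f x))) =
    inr (false, [:: READY; Kap [:: (f x).+1]] ++ ends, XX, [:: WR 2 0; Kap [:: f x]] ++ ends).
  by [].
have Epre n l : eval f (ECons (ECst n) (ECons l (ECst (lab ends)))) =
    lab ([:: n; eval f l] ++ ends) by [].
rewrite E pickle_inr !pickle_pair !pickle_nats /input_rule_expr eval_pair.
apply: eq_lab2; first by [].
rewrite eval_single; apply: eq_lab1; rewrite !eval_pair.
apply: eq_lab2; last by rewrite Epre.
apply: eq_lab2; last by [].
apply: eq_lab2; first by [].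
by rewrite Epre.
Qed.

Definition instance_expr (x y : nat) : expr :=
  pair_expr
    (pair_expr (ECst (pickle (nst + 8, start_edges, start_nodes, start_strong)))
       (ECons (kap_expr (EVar x)) (ECst (lab (READY :: ends ++ start_cells)))))
    (EVar y).

Lemma eval_instance f x y R : f y = pickle (map enc_rule R) ->
  eval f (instance_expr x y) = code (start [:: f x]) R.
Proof.
move=> E; rewrite /code pickle_pair -E /enc_network.
rewrite pickle_pair pickle_nats /instance_expr !eval_pair.
apply: eq_lab2; last by [].
by apply: eq_lab2.
Qed.

Fixpoint rule_codes (m k : nat) : nat :=
  if k is k'.+1 then cons_code (pickle (enc_rule (startw (input_entry k')))) (rule_codes m k')
  else m.

Lemma rule_codesE R k : rule_codes (pickle (map enc_rule R)) k =
  pickle (map enc_rule ([seq startw e | e <- input_w k] ++ R)).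
Proof.
elim: k => // k IH; rewrite -[LHS]/(cons_code _ (rule_codes _ k)) IH.
have -> : input_w k.+1 = input_entry k :: input_w k.
  by rewrite /input_w -addn1 iotaD rev_cat.
by rewrite [RHS]pickle_seqE [RHS]lab_cons.
Qed.

(* Registers: 0 input and output, 2 codes of the rules so far, 3 and 4 copies of the input,
   5 index of the next input rule. *)
Definition code_prog : prog :=
  PSeq (PLoop 0 (PSeq (PInc 2) (PSeq (PInc 3) (PInc 4))))
  (PSeq (PLoop 4 (PSeq (cexpr 6 (ECons (input_rule_expr 5) (EVar 2)))
                 (PSeq (PLoop 2 PSkip) (PSeq (PLoop 6 (PInc 2)) (PInc 5)))))
  (PSeq (cexpr 6 (instance_expr 3 2))
  (PSeq (PLoop 2 PSkip) (PSeq (PLoop 3 PSkip) (PSeq (PLoop 5 PSkip) (PLoop 6 (PInc 0))))))).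

Ltac regs_tac := case=> [|[|[|[|[|[|[|?]]]]]]] //=; rewrite /upd /= ?nth_nil ?add0n //.

(** [m] is used in three ways: as the code of [R] onto which rules are consed, as the number of
    rules to cons, and as the initial state in the label of node 0. The first loop makes the
    copies. *)
Lemma computes_code_prog m R : m = pickle (map enc_rule R) ->
  computes code_prog (nth 0 [:: m])
    (nth 0 [:: code (start [:: m]) ([seq startw e | e <- input_w m] ++ R)]).
Proof.
move=> mE.
apply: (@computes_seq _ _ _ (nth 0 [:: 0; 0; m; m; m])).
  pose F k := nth 0 [:: m - k; 0; k; k; k].
  apply: (@computes_ext _ (F 0) _ (F m)).
  - by rewrite /F subn0; regs_tac.
  - by rewrite /F subnn; regs_tac.
  apply: (@computes_loop 0 _ m F) => // k lk.
  apply: computes_seq (@computes_inc _ _) _; apply: computes_seq (@computes_inc _ _) _.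
  by refine (computes_eq (@computes_inc _ _) _ _); regs_tac.
apply: (@computes_seq _ _ _ (nth 0 [:: 0; 0; rule_codes m m; m; 0; m])).
  pose F k := nth 0 [:: 0; 0; rule_codes m k; m; m - k; k].
  apply: (@computes_ext _ (F 0) _ (F m)).
  - by rewrite /F subn0; regs_tac.
  - by rewrite /F subnn; regs_tac.
  apply: (@computes_loop 4 _ m F) => // k lk.
  pose S a b c := nth 0 [:: 0; 0; a; m; m - k.+1; b; c].
  apply: (@computes_seq _ _ _ (S (rule_codes m k) k (rule_codes m k.+1))).
    refine (computes_eq (@computes_expr 6 (ECons (input_rule_expr 5) (EVar 2))
      (S (rule_codes m k) k 0) _ _ _ _) _ _) => //.
    + by rewrite /S; case=> [|[|[|[|[|[|[|?]]]]]]] //= _; rewrite nth_nil.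
    + by rewrite /S /F; regs_tac.
    + move=> i; rewrite -[eval _ _]/(cons_code (eval _ (input_rule_expr 5)) _) eval_input_rule.
      by move: i; rewrite /S; regs_tac.
  apply: (@computes_seq _ _ _ (S 0 k (rule_codes m k.+1))).
    by refine (computes_eq (@computes_clear 2 (S (rule_codes m k) k _) erefl isT) _ _) => //;
      rewrite /S /F; regs_tac.
  apply: (@computes_seq _ _ _ (S (rule_codes m k.+1) k 0)).
    by refine (computes_eq (@computes_move 6 2 (S 0 k _) erefl isT isT isT) _ _) => //;
      rewrite /S /F; regs_tac.
  by refine (computes_eq (@computes_inc (S (rule_codes m k.+1) k 0) 5) _ _) => //;
    rewrite /S /F; regs_tac.
set n := code _ _.
pose S a b c d := nth 0 [:: 0; 0; a; b; 0; c; d].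
apply: (@computes_seq _ _ _ (S (rule_codes m m) m m n)).
  refine (computes_eq (@computes_expr 6 (instance_expr 3 2)
    (S (rule_codes m m) m m 0) _ _ _ _) _ _) => //.
  - by rewrite /S; case=> [|[|[|[|[|[|[|?]]]]]]] //= _; rewrite nth_nil.
  - by rewrite /S; regs_tac.
  - have E : S (rule_codes m m) m m 0 2 =
        pickle (map enc_rule ([seq startw e | e <- input_w m] ++ R)).
      by rewrite -rule_codesE -mE.
    move=> i; rewrite (eval_instance _ E) -/n.
    by move: i; rewrite /S; regs_tac.
apply: (@computes_seq _ _ _ (S 0 m m n)).
  by refine (computes_eq (@computes_clear 2 (S _ m m n) erefl isT) _ _) => //; rewrite /S; regs_tac.
apply: (@computes_seq _ _ _ (S 0 0 m n)).
  by refine (computes_eq (@computes_clear 3 (S 0 m m n) erefl isT) _ _) => //; rewrite /S; regs_tac.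
apply: (@computes_seq _ _ _ (S 0 0 0 n)).
  by refine (computes_eq (@computes_clear 5 (S 0 0 m n) erefl isT) _ _) => //; rewrite /S; regs_tac.
by refine (computes_eq (@computes_move 6 0 (S 0 0 0 n) erefl isT isT isT) _ _) => //;
  rewrite /S; regs_tac.
Qed.

(* All jumps out of the program of length [n] go to the address [o + n]. *)
Definition shift (o n : nat) (i : instr) : instr :=
  match i with INC r => INC r | DEC r j => DEC r (o + minn j n) end.

(* Runs [q], then [P], and halts iff the output is positive. *)
Definition run_after (q : prog) (P : seq instr) : seq instr :=
  let o := psize q in
  compile 0 q ++ [seq shift o (size P) i | i <- P] ++ [:: DEC 0 (o + size P)].

(** Truncation by [minn] sends every exit of [P] to the first address behind it, and a halted [P] no
    longer changes, so the claim holds for every [k]. *)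
Lemma reach_shift D P o pc regs k :
  located D o [seq shift o (size P) i | i <- P] ->
  reach D (o + minn pc (size P)) (nth 0 regs)
    (o + minn (cm_run P k (pc, regs)).1 (size P)) (nth 0 (cm_run P k (pc, regs)).2).
Proof.
move=> l; elim: k => [|k IH]; first exact: reach_refl.
apply: reach_trans IH _; rewrite /cm_run iterS -/(cm_run P k (pc, regs)).
case: (cm_run P k (pc, regs)) => {pc regs} pc regs /=.
have [lpc|le] := ltnP pc (size P); last by rewrite /= (minn_idPr le); apply: reach_refl.
have [|h1] := l pc; first by rewrite size_map.
rewrite (nth_map (INC 0)) //.
case: (nth _ P pc) => [r|r j] /= h2.
  rewrite (minn_idPl lpc) addnS.
  refine (reach_ext (f1 := nth 0 regs) _ _ (reach_inc h1 h2)) => // i.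
  by rewrite nth_set_nth.
case E: (nth 0 regs r) => [|x] /=; first exact: reach_dec0 h1 h2 E.
rewrite (minn_idPl lpc) addnS; refine (reach_ext _ _ (reach_dec h1 h2 E)) => // i.
by rewrite nth_set_nth.
Qed.

Lemma located_sub D1 c D2 : located (D1 ++ c ++ D2) (size D1) c.
Proof.
move=> i li; rewrite !size_cat nth_cat [_ < size D1]ltnNge leq_addr addKn nth_cat li.
by split=> //; lia.
Qed.

Lemma cm_run_halted D k c : cm_halted D c -> cm_run D k c = c.
Proof.
by move=> h; elim: k => //= k ->; case: c h => pc regs /=; rewrite /cm_halted ltnNge => ->.
Qed.

(** The final [DEC 0] jumps to itself on 0 and otherwise falls off the end of the program. *)
Lemma run_after_halts q P m n b : computes q (nth 0 [:: m]) (nth 0 [:: n]) ->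
  cm_outputs P n b ->
  (b <-> exists k, cm_halted (run_after q P) (cm_run (run_after q P) k (0, [:: m]))).
Proof.
move=> cp [k [hk out]]; set D := run_after q P; set o := psize q.
have l0 : located D 0 (compile 0 q) := @located_sub [::] _ _.
have l1 : located D o [seq shift o (size P) i | i <- P].
  have := @located_sub (compile 0 q) [seq shift o (size P) i | i <- P]
    [:: DEC 0 (o + size P)]; by rewrite size_compile.
have sD : size D = (o + size P).+1 by rewrite !size_cat size_map size_compile addn1 addnS.
have lst : nth (INC 0) D (o + size P) = DEC 0 (o + size P).
  rewrite nth_cat size_compile ltnNge leq_addr addKn.
  by rewrite nth_cat size_map ltnn subnn.
have r1 := cp D 0 l0; rewrite add0n -/o in r1.
have r2 := @reach_shift D P o 0 [:: n] k l1; rewrite min0n addn0 in r2.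
have {r1 r2} r := reach_trans r1 r2.
move: r; rewrite (minn_idPr hk) => r.
have lt_e : o + size P < size D by rewrite sD.
case: b out => out; split=> //.
- move=> _; have r3 := reach_trans r (reach_dec lt_e lst out).
  have [|k3 [regs [E _]]] := r3 [:: m]; first by [].
  by exists k3; rewrite E /cm_halted /= sD.
case=> k3 h3; have [|k4 [regs [E e]]] := r [:: m]; first by [].
have fix_e j : cm_run D j (o + size P, regs) = (o + size P, regs).
  by elim: j => //= j ->; rewrite /= lt_e lst e out.
(* The two runs are composed in both orders: one composition ends in a halted configuration, the
   other at the self-jump. *)
have := fix_e k3; rewrite -E /cm_run -iterD addnC iterD -!/(cm_run D _ _).
rewrite (cm_run_halted _ h3) E => E3; move: h3; rewrite E3 /cm_halted /=.
by rewrite leqNgt lt_e.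
Qed.

Theorem theorem1 :
  ~ exists P : seq instr,
      forall (G : network) (R : seq rule),
        restricted_safety_instance G R ->
        (constructor_wins_safety G R -> cm_outputs P (code G R) true) /\
        (~ constructor_wins_safety G R -> cm_outputs P (code G R) false).
Proof.
case=> P dec; pose D := run_after code_prog P.
(* [D] depends on [P] alone and these rules on [D] alone, so taking [m] to be their code is not
   circular. *)
pose fixed := [seq startw e | e <- prog_w D] ++ ladder_rules (letters D) (machine_q D).
pose m := pickle (map enc_rule fixed).
pose R := game_rules (letters D) (machine_w m D) (machine_q D).
have ER : R = [seq startw e | e <- input_w m] ++ fixed.
  by rewrite /R /game_rules /machine_w map_cat -catA.
have cp : computes code_prog (nth 0 [:: m]) (nth 0 [:: code (start [:: m]) R]).
  by rewrite ER; apply: computes_code_prog.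
have [yes no] := dec (start [:: m]) R (start_instance _ _ _ _).
have [win|lose] := classic (constructor_wins_safety (start [:: m]) R).
  have /(_ isT) hl := (run_after_halts cp (yes win)).1.
  have [t dm] := simulate_halt hl.
  exact: start_loses dm win.
have nh := (run_after_halts cp (no lose)).2.
apply: lose; apply: start_wins.
- exact: machine_w_letters.
- exact: machine_q_letters.
- by rewrite /letters; lia.
by apply: simulate_loop => /nh.
Qed.
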